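(* Let $\Sigma$ be a two-dimensional surface equipped with a $C^3$-smooth Riemannian metric, and let $\gamma\subset\Sigma$ be a germ of $C^3$-smooth curve with positive geodesic curvature $\kappa$. For every small $p>0$ let $\mathcal T_p:\gamma\to\gamma$ denote the corresponding string diffeomorphism. For every points $A$ and $Q$ lying in a compact subarc $\widehat\gamma\Subset\gamma$ one has $$\kappa^{\frac23}(A)\,\lambda(A,\mathcal T_p(A))\simeq\kappa^{\frac23}(Q)\,\lambda(Q,\mathcal T_p(Q)),\quad\text{as } p\to0,$$ uniformly in $A,Q\in\widehat\gamma$.
   Context: $\lambda(A,B)$ is the length of the arc $AB$ of $\gamma$; $f\simeq g$ means that $f/g\to1$. For $A,B\in\gamma$ close enough let $C_{AB}$ be the unique nearby intersection point of the geodesics tangent to $\gamma$ at $A$ and at $B$, and $L(A,B)=|AC_{AB}|+|BC_{AB}|-\lambda(A,B)$, where $|XY|$ is the length of the small geodesic segment $XY$. For small $p>0$ the $p$-th string curve is $\Gamma_p=\{C_{AB}\ |\ L(A,B)=p\}$. The billiard reflection from $\Gamma_p$ sends oriented geodesics tangent to $\gamma$ to geodesics tangent to $\gamma$. The string diffeomorphism $\mathcal T_p$ is the induced map on the tangency points: fixing an orientation of $\gamma$ and orienting the tangent geodesics accordingly, $\mathcal T_p(A)=B$, where $B$ is the point of $\gamma$ following $A$ such that $L(A,B)=p$ (so that the geodesic tangent to $\gamma$ at $A$ is reflected from $\Gamma_p$ at $C_{AB}$ to the geodesic tangent to $\gamma$ at $B$). *)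

(* Defs.v *)
From Stdlib Require Import Reals.
From Coquelicot Require Import Coquelicot.

Open Scope R_scope.

Inductive axis : Set := ax1 | ax2.

Definition other (m : axis) : axis := match m with ax1 => ax2 | ax2 => ax1 end.

Definition sum_axis (f : axis -> R) : R := f ax1 + f ax2.

Definition crd (m : axis) (x : R * R) : R :=
  match m with ax1 => fst x | ax2 => snd x end.

Definition pd (m : axis) (f : R * R -> R) (x : R * R) : R :=
  match m with
  | ax1 => Derive (fun z => f (z, snd x)) (fst x)
  | ax2 => Derive (fun z => f (fst x, z)) (snd x)
  end.

(* Required at every point of an open set, this says that f is C^n there. *)
Definition smooth_at (n : nat) (f : R * R -> R) (x : R * R) : Prop :=
  ex_diff_n (fun x1 x2 => f (x1, x2)) n (fst x) (snd x).

Definition smooth_1d_at (n : nat) (f : R -> R) (t : R) : Prop :=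
  (forall m, (m <= n)%nat -> ex_derive_n f m t) /\
  continuous (Derive_n f n) t.

(* The topology of the surface is the one induced by the atlas.  Changes of
   coordinates are C^4, the least regularity for which a C^3 metric makes
   sense.  [point_at i] inverts [coord i] on the image of [coord i] and is
   arbitrary elsewhere. *)
Record riemannian_surface : Type := {
  point :> Type;
  chart : Type;
  dom : chart -> point -> Prop;
  coord : chart -> point -> R * R;
  point_at : chart -> R * R -> point;
  metric : chart -> axis -> axis -> R * R -> R;

  overlap (i j : chart) (x : R * R) : Prop :=
    exists P, dom i P /\ dom j P /\ coord i P = x;
  transition (i j : chart) (x : R * R) : R * R := coord j (point_at i x);

  point_at_coord : forall i P, dom i P -> point_at i (coord i P) = P;
  countable_cover : exists f : nat -> chart, forall P, exists n, dom (f n) P;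
  overlap_open : forall i j, open (overlap i j);
  transition_smooth : forall i j m x, overlap i j x ->
    smooth_at 4 (fun y => crd m (transition i j y)) x;
  hausdorff : forall P Q, P <> Q ->
    exists i j (V W : R * R -> Prop),
      dom i P /\ dom j Q /\ open V /\ open W /\
      V (coord i P) /\ W (coord j Q) /\
      forall X, dom i X -> dom j X -> V (coord i X) -> W (coord j X) -> False;

  metric_smooth : forall i m n P, dom i P -> smooth_at 3 (metric i m n) (coord i P);
  metric_sym : forall i m n P, dom i P ->
    metric i m n (coord i P) = metric i n m (coord i P);
  metric_pos : forall i P (v : axis -> R), dom i P ->
    (exists m, v m <> 0) ->
    0 < sum_axis (fun m => sum_axis (fun n =>
          metric i m n (coord i P) * v m * v n));
  metric_change : forall i j m n x, overlap i j x ->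
    metric i m n x =
    sum_axis (fun p => sum_axis (fun q =>
      metric j p q (transition i j x)
      * pd m (fun y => crd p (transition i j y)) x
      * pd n (fun y => crd q (transition i j y)) x))
}.

Arguments dom {r} _ _.
Arguments coord {r} _ _.
Arguments metric {r} _ _ _ _.

Definition inner {S : riemannian_surface} (k : chart S) (x : R * R)
    (v w : axis -> R) : R :=
  sum_axis (fun m => sum_axis (fun n => metric k m n x * v m * w n)).

Definition norm_g {S : riemannian_surface} (k : chart S) (x : R * R)
    (v : axis -> R) : R :=
  sqrt (inner k x v v).

Definition det_metric {S : riemannian_surface} (k : chart S) (x : R * R) : R :=
  metric k ax1 ax1 x * metric k ax2 ax2 x - metric k ax1 ax2 x * metric k ax2 ax1 x.

Definition inv_metric {S : riemannian_surface} (k : chart S) (m n : axis)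
    (x : R * R) : R :=
  match m, n with
  | ax1, ax1 | ax2, ax2 => metric k (other m) (other n) x / det_metric k x
  | _, _ => - metric k m n x / det_metric k x
  end.

Definition christoffel {S : riemannian_surface} (k : chart S) (l m n : axis)
    (x : R * R) : R :=
  sum_axis (fun q => inv_metric k l q x / 2 *
    (pd m (metric k n q) x + pd n (metric k m q) x - pd q (metric k m n) x)).

Definition curve_crd {S : riemannian_surface} (k : chart S) (c : R -> S)
    (m : axis) (t : R) : R :=
  crd m (coord k (c t)).

Definition velocity {S : riemannian_surface} (k : chart S) (c : R -> S)
    (t : R) (m : axis) : R :=
  Derive (curve_crd k c m) t.

Definition speed {S : riemannian_surface} (k : chart S) (c : R -> S)
    (t : R) : R :=
  norm_g k (coord k (c t)) (velocity k c t).

Definition cov_acceleration {S : riemannian_surface} (k : chart S) (c : R -> S)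
    (t : R) (l : axis) : R :=
  Derive_n (curve_crd k c l) 2 t +
  sum_axis (fun m => sum_axis (fun n =>
    christoffel k l m n (coord k (c t)) * velocity k c t m * velocity k c t n)).

(* |normal part of the covariant acceleration| / |c'|^2.  This is the unsigned
   curvature, as the surface is not oriented: it is positive exactly when the
   signed curvature is nonzero, hence positive for one choice of the normal. *)
Definition geodesic_curvature {S : riemannian_surface} (k : chart S)
    (c : R -> S) (t : R) : R :=
  let x := coord k (c t) in
  let v := velocity k c t in
  let w := cov_acceleration k c t in
  norm_g k x (fun m => w m - inner k x w v / inner k x v v * v m)
  / inner k x v v.

Definition arc_length {S : riemannian_surface} (k : chart S) (c : R -> S)
    (s t : R) : R :=
  RInt (speed k c) s t.

(* A representative of a germ of curve, parametrized by an open interval: it is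
   small enough to lie in the domain of one chart.  The parametrization fixes
   the orientation of the curve. *)
Definition C3_curve {S : riemannian_surface} (k : chart S) (gamma : R -> S)
    (alpha beta : R) : Prop :=
  (forall t, alpha < t < beta ->
     dom k (gamma t) /\
     (forall m, smooth_1d_at 3 (curve_crd k gamma m) t) /\
     (exists m, velocity k gamma t m <> 0)) /\
  (forall s t, alpha < s < beta -> alpha < t < beta ->
     gamma s = gamma t -> s = t).

Definition unit_speed_geodesic {S : riemannian_surface} (k : chart S)
    (c : R -> S) (r : R) : Prop :=
  forall u, - r < u < r ->
    dom k (c u) /\
    (forall m, smooth_1d_at 2 (curve_crd k c m) u) /\
    (forall m, cov_acceleration k c u m = 0) /\
    speed k c u = 1.

Definition tangent_geodesic {S : riemannian_surface} (k : chart S)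
    (gamma : R -> S) (r t : R) (c : R -> S) : Prop :=
  unit_speed_geodesic k c r /\
  c 0 = gamma t /\
  forall m, velocity k c 0 m = velocity k gamma t m / speed k gamma t.

(* [is_L k gamma delta s t l] : L(gamma s, gamma t) = l, where "close enough"
   and "nearby" mean: at distance less than delta along the curve and along the
   two tangent geodesics.  The intersection point is cA u = cB v; as cA and cB
   have unit speed, its geodesic distances to gamma s and gamma t are |u| and
   |v|.  (The intersection is unique once delta is small.) *)
Definition is_L {S : riemannian_surface} (k : chart S) (gamma : R -> S)
    (delta s t l : R) : Prop :=
  Rabs (arc_length k gamma s t) < delta /\
  exists (cA cB : R -> S) (u v : R),
    tangent_geodesic k gamma delta s cA /\
    tangent_geodesic k gamma delta t cB /\
    - delta < u < delta /\ - delta < v < delta /\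
    cA u = cB v /\
    l = Rabs u + Rabs v - Rabs (arc_length k gamma s t).

(* gamma t is the image of gamma s under the string map with parameter p. *)
Definition string_step {S : riemannian_surface} (k : chart S) (gamma : R -> S)
    (beta delta p s t : R) : Prop :=
  s < t < beta /\ is_L k gamma delta s t p.

(* T p, expressed in the parameter of gamma, is the p-th string map on the
   subarc gamma([a, b]), for all small p. *)
Definition string_maps {S : riemannian_surface} (k : chart S) (gamma : R -> S)
    (beta a b delta : R) (T : R -> R -> R) : Prop :=
  exists p1, 0 < p1 /\
    forall p s, 0 < p < p1 -> a <= s <= b ->
      string_step k gamma beta delta p s (T p s).

(* Main.v *)
Require Import Defs.
From Stdlib Require Import Reals Lra Lia.
From Coquelicot Require Import Coquelicot.
Open Scope R_scope.

(* Everything follows from the expansion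
     L(A, B) = kappa(A)^2 lambda^3 / 12 + O(lambda^4),   lambda = lambda(A, B),
   uniform on compact subarcs: if L(A, T_p A) = p, then lambda^3 <= C p tends to
   0, and the cube of kappa^(2/3) lambda is equivalent to 12 p, whatever A is.

   Let tau be the unit tangent of the curve at A, and f a function, quadratic in
   the coordinates, with vanishing covariant Hessian at A and with gradient tau
   there.  On a curve with unit tangent T the slope df(T) varies at rate
   (Hess f)(T, T) + df(D_T T).  Parametrize the curve and the two geodesics by arc
   length s, with s = 0 at A and s = lambda at B.  At equal parameters the Hessian
   terms agree up to O(lambda^2), since the points are O(lambda^2) apart, the
   tangents O(lambda) apart, and Hess f is Lipschitz and vanishes at A.  As
   <T, D_T T> = 0, df(D_T T) = - kappa^2 s + O(s^2) on the curve.  Hence the slope on the curve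
   is smaller than on the geodesic from A by kappa^2 s^2 / 2, and on the geodesic
   from B by kappa^2 lambda^2 / 2.  The geodesics meet at s = lambda / 2 +
   O(lambda^2), so that integrating the slopes from A to C and from A to B to C
   gives the excess length kappa^2 lambda^3 (1/4 - 1/6). *)

(** * Uniform estimates *)

(** The overview takes it for granted that the geodesics meet near the midpoint. Nothing in [is_L]
    says so: [u] and [v] are only smaller than [delta], neither comparable to lambda nor of known
    sign. The meeting point must therefore be located first. When both geodesics are reparametrized
    so as to meet at parameter 1, their difference solves a second-order equation with small
    coefficients and is nearly affine, so its value at 0 is opposite to its velocity there up to a
    small relative error. The tangential part of this relation controls [u - v - lam]; the normal
    part controls [lam / 2 + v] after division by kappa^2, whence the need for a lower bound on the
    curvature.

    As f is an explicit quadratic polynomial, no normal coordinates are constructed and Lipschitz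
    Christoffel symbols suffice. The price is that f measures length along the geodesic from A only
    up to a relative error O(lambda); the excess is thus bounded by lambda^2 first, and this bound
    is improved to the final remainder lambda^4 in two rounds.

    Uniformity is obtained by letting all the estimates range over every configuration that obeys
    the same bounds, with one constant [M]. *)

Lemma sum_axis_ext (f f' : axis -> R) :
  (forall m, f m = f' m) -> sum_axis f = sum_axis f'.
Proof. intros H. unfold sum_axis. now rewrite !H. Qed.

Lemma sum_axis_ge0 (f : axis -> R) : (forall m, 0 <= f m) -> 0 <= sum_axis f.
Proof. intros H. unfold sum_axis. generalize (H ax1) (H ax2); lra. Qed.

Lemma le_sum_axis (f : axis -> R) (m : axis) :
  (forall m, 0 <= f m) -> f m <= sum_axis f.
Proof.
intros H. unfold sum_axis.
destruct m; generalize (H ax1) (H ax2); lra.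
Qed.

(* An index [j] will carry a whole configuration, so that [C] is uniform in it. *)
Definition bigO {J : Type} (D : J -> Prop) (f e : J -> R) : Prop :=
  exists C, 0 <= C /\ forall j, D j -> Rabs (f j) <= C * e j.

Section BigO.
Context {J : Type} (D : J -> Prop).
Implicit Types f g e : J -> R.

Lemma bigO_ext f f' e :
  (forall j, D j -> f j = f' j) -> bigO D f e -> bigO D f' e.
Proof.
intros H [C [HC Hf]]. exists C. split; [easy|].
intros j Hj. rewrite <- H by easy. auto.
Qed.

Lemma bigO_trans f e e' : bigO D f e -> bigO D e e' -> bigO D f e'.
Proof.
intros [C [HC Hf]] [C' [HC' He]]. exists (C * C').
split; [now apply Rmult_le_pos|]. intros j Hj.
apply Rle_trans with (1 := Hf j Hj). rewrite Rmult_assoc.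
apply Rmult_le_compat_l; [easy|].
apply Rle_trans with (1 := Rle_abs _). auto.
Qed.

Lemma bigO_le f e e' : (forall j, D j -> e j <= e' j) -> bigO D f e -> bigO D f e'.
Proof.
intros H [C [HC Hf]]. exists C. split; [easy|]. intros j Hj.
apply Rle_trans with (1 := Hf j Hj). apply Rmult_le_compat_l; auto.
Qed.

Lemma bigO_bound (C : R) f e : (forall j, D j -> Rabs (f j) <= C * e j) ->
  (forall j, D j -> 0 <= e j) -> bigO D f e.
Proof.
intros H He. exists (Rabs C). split; [apply Rabs_pos|]. intros j Hj.
apply Rle_trans with (1 := H j Hj).
apply Rmult_le_compat_r; [auto | apply Rle_abs].
Qed.

Lemma bigO_refl e : (forall j, D j -> 0 <= e j) -> bigO D e e.
Proof.
intros H. exists 1. split; [lra|]. intros j Hj.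
rewrite Rabs_pos_eq by auto. lra.
Qed.

Lemma bigO_0 e : bigO D (fun _ => 0) e.
Proof. exists 0. split; [lra|]. intros j Hj. rewrite Rabs_R0. lra. Qed.

Lemma bigO_const (c : R) : bigO D (fun _ => c) (fun _ => 1).
Proof. exists (Rabs c). split; [apply Rabs_pos|]. intros; lra. Qed.

Lemma bigO_plus f g e : bigO D f e -> bigO D g e -> bigO D (fun j => f j + g j) e.
Proof.
intros [C [HC Hf]] [C' [HC' Hg]]. exists (C + C'). split; [lra|].
intros j Hj. apply Rle_trans with (1 := Rabs_triang _ _).
rewrite Rmult_plus_distr_r. apply Rplus_le_compat; auto.
Qed.

Lemma bigO_opp f e : bigO D f e -> bigO D (fun j => - f j) e.
Proof.
intros [C [HC Hf]]. exists C. split; [easy|].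
intros j Hj. rewrite Rabs_Ropp. auto.
Qed.

Lemma bigO_minus f g e : bigO D f e -> bigO D g e -> bigO D (fun j => f j - g j) e.
Proof. intros Hf Hg. apply (bigO_plus f (fun j => - g j)); [easy|now apply bigO_opp]. Qed.

Lemma bigO_mult f g e e' : bigO D f e -> bigO D g e' ->
  bigO D (fun j => f j * g j) (fun j => e j * e' j).
Proof.
intros [C [HC Hf]] [C' [HC' Hg]]. exists (C * C').
split; [now apply Rmult_le_pos|]. intros j Hj. rewrite Rabs_mult.
replace (C * C' * (e j * e' j)) with ((C * e j) * (C' * e' j)) by ring.
apply Rmult_le_compat; auto using Rabs_pos.
Qed.

Lemma bigO_mult_l f g e : bigO D f (fun _ => 1) -> bigO D g e ->
  bigO D (fun j => f j * g j) e.
Proof.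
intros Hf Hg. apply bigO_le with (fun j => 1 * e j); [intros; lra|].
now apply bigO_mult.
Qed.

Lemma bigO_mult_r f g e : bigO D f e -> bigO D g (fun _ => 1) ->
  bigO D (fun j => f j * g j) e.
Proof.
intros Hf Hg. apply bigO_le with (fun j => e j * 1); [intros; lra|].
now apply bigO_mult.
Qed.

Lemma bigO_abs f e : bigO D f e -> bigO D (fun j => Rabs (f j)) e.
Proof.
intros [C [HC Hf]]. exists C. split; [easy|]. intros. rewrite Rabs_Rabsolu. auto.
Qed.

Lemma bigO_sum (f : axis -> J -> R) e : (forall m, bigO D (f m) e) ->
  bigO D (fun j => sum_axis (fun m => f m j)) e.
Proof. intros H. unfold sum_axis. now apply bigO_plus. Qed.

(** Equality modulo [O(e)], set up as a congruence so that expansions can be compared factor by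
    factor. *)
Definition congO e f g := bigO D (fun j => f j - g j) e.

Lemma congO_refl e f : congO e f f.
Proof. apply bigO_ext with (fun _ => 0); [intros; ring|apply bigO_0]. Qed.

Lemma congO_eq e f g : (forall j, D j -> f j = g j) -> congO e f g.
Proof.
intros H. apply bigO_ext with (fun _ => 0); [|apply bigO_0].
intros j Hj. rewrite H by easy. ring.
Qed.

Lemma congO_sym e f g : congO e f g -> congO e g f.
Proof.
intros H. apply bigO_ext with (fun j => - (f j - g j)); [intros; ring|].
now apply bigO_opp.
Qed.

Lemma congO_trans e f g h : congO e f g -> congO e g h -> congO e f h.
Proof.
intros H H'. apply bigO_ext with (fun j => (f j - g j) + (g j - h j)); [intros; ring|].
now apply bigO_plus.
Qed.

Lemma congO_plus e f f' g g' : congO e f f' -> congO e g g' ->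
  congO e (fun j => f j + g j) (fun j => f' j + g' j).
Proof.
intros H H'. apply bigO_ext with (fun j => (f j - f' j) + (g j - g' j)); [intros; ring|].
now apply bigO_plus.
Qed.

Lemma congO_minus e f f' g g' : congO e f f' -> congO e g g' ->
  congO e (fun j => f j - g j) (fun j => f' j - g' j).
Proof.
intros H H'. apply bigO_ext with (fun j => (f j - f' j) - (g j - g' j)); [intros; ring|].
now apply bigO_minus.
Qed.

Lemma congO_sum e (f f' : axis -> J -> R) : (forall m, congO e (f m) (f' m)) ->
  congO e (fun j => sum_axis (fun m => f m j)) (fun j => sum_axis (fun m => f' m j)).
Proof. intros H. unfold sum_axis. now apply congO_plus. Qed.

(** Keeps the two error terms apart, for products in which the other factor is itself small and
    bounding it by a constant would lose an order. *)
Lemma congO_mult_split e f f' g g' :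
  bigO D (fun j => (f j - f' j) * g j) e -> bigO D (fun j => f' j * (g j - g' j)) e ->
  congO e (fun j => f j * g j) (fun j => f' j * g' j).
Proof.
intros H H'.
apply bigO_ext with (fun j => (f j - f' j) * g j + f' j * (g j - g' j)); [intros; ring|].
now apply bigO_plus.
Qed.

Lemma congO_mult e f f' g g' :
  congO e f f' -> congO e g g' -> bigO D g (fun _ => 1) -> bigO D f' (fun _ => 1) ->
  congO e (fun j => f j * g j) (fun j => f' j * g' j).
Proof.
intros Hf Hg Bg Bf.
apply congO_mult_split; [now apply bigO_mult_r|now apply bigO_mult_l].
Qed.

End BigO.

(** Restricting a family, evaluating at an end point and changing the parameter are all compositions
    with a map of indices. *)
Lemma bigO_comp {J J' : Type} (D : J -> Prop) (D' : J' -> Prop) (phi : J' -> J) f e :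
  (forall j, D' j -> D (phi j)) -> bigO D f e ->
  bigO D' (fun j => f (phi j)) (fun j => e (phi j)).
Proof.
intros H [C [HC Hf]]. exists C. split; [easy|]. intros j Hj. auto.
Qed.

Lemma bigO_sub {J : Type} (D D' : J -> Prop) f e :
  (forall j, D' j -> D j) -> bigO D f e -> bigO D' f e.
Proof. exact (bigO_comp D D' (fun j => j) f e). Qed.

(** * Mean value inequalities and nearly affine functions *)

Lemma is_derive_continuity_pt (f : R -> R) (x l : R) :
  is_derive f x l -> continuity_pt f x.
Proof.
intros H. apply continuity_pt_filterlim, (@ex_derive_continuous R_AbsRing R_NormedModule).
now exists l.
Qed.

(* Cauchy's mean value inequality: [G] is the derivative of [F] with respect to
   [ell]. *)
Lemma mean_value_le (F G rho ell : R -> R) (a b K : R) : a <= b ->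
  (forall x, a <= x <= b -> is_derive F x (rho x * G x)) ->
  (forall x, a <= x <= b -> is_derive ell x (rho x)) ->
  (forall x, a <= x <= b -> 0 <= rho x) ->
  (forall x, a <= x <= b -> Rabs (G x) <= K) ->
  Rabs (F b - F a) <= K * (ell b - ell a).
Proof.
intros Hab HF Hl Hr HG.
(* The derivative of [K * ell - sg * F] is [rho * (K - sg * G)], which is nonnegative; [sg = 1] and
   [sg = -1] give the two halves of the absolute value. *)
assert (key : forall sg, Rabs sg <= 1 -> sg * (F b - F a) <= K * (ell b - ell a)).
{ intros sg Hsg.
  assert (Hder : forall x, a <= x <= b -> is_derive (fun x => K * ell x - sg * F x) x
    (K * rho x - sg * (rho x * G x))).
  { intros x Hx. apply (is_derive_minus (fun x => K * ell x) (fun x => sg * F x));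
      apply is_derive_scal; auto. }
  destruct (MVT_gen (fun x => K * ell x - sg * F x) a b
    (fun x => K * rho x - sg * (rho x * G x))) as [c [Hc E]].
  - rewrite Rmin_left, Rmax_right by easy. intros x Hx. apply Hder; lra.
  - rewrite Rmin_left, Rmax_right by easy. intros x Hx.
    eapply is_derive_continuity_pt, Hder, Hx.
  - rewrite Rmin_left, Rmax_right in Hc by easy.
    assert (0 <= K * rho c - sg * (rho c * G c)); [|nra].
    assert (Hrc := Hr c Hc).
    assert (Rabs (sg * G c) <= 1 * K).
    { rewrite Rabs_mult. apply Rmult_le_compat; auto using Rabs_pos. }
    apply Rabs_le_between in H. nra. }
apply Rabs_le. split.
- assert (H := key (-1)). rewrite Rabs_left in H by lra. lra.
- assert (H := key 1). rewrite Rabs_pos_eq in H by lra. lra.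
Qed.

Lemma mean_value_abs_le (F G : R -> R) (a b K : R) :
  (forall x, Rmin a b <= x <= Rmax a b -> is_derive F x (G x)) ->
  (forall x, Rmin a b <= x <= Rmax a b -> Rabs (G x) <= K) ->
  Rabs (F b - F a) <= K * Rabs (b - a).
Proof.
intros HF HG.
destruct (MVT_gen F a b G) as [c [Hc E]].
- intros x Hx. apply HF. lra.
- intros x Hx. eapply is_derive_continuity_pt, HF, Hx.
- rewrite E, Rabs_mult. apply Rmult_le_compat_r; [apply Rabs_pos|]. auto.
Qed.

Lemma derive_nonneg_le (f f' : R -> R) (a b : R) : a <= b ->
  (forall x, a <= x <= b -> is_derive f x (f' x)) ->
  (forall x, a <= x <= b -> 0 <= f' x) -> f a <= f b.
Proof.
intros Hab Hf Hf'.
destruct (MVT_gen f a b f') as [c [Hc E]].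
- rewrite Rmin_left, Rmax_right by easy. intros x Hx. apply Hf; lra.
- rewrite Rmin_left, Rmax_right by easy. intros x Hx.
  eapply is_derive_continuity_pt, Hf, Hx.
- rewrite Rmin_left, Rmax_right in Hc by easy. generalize (Hf' c Hc). nra.
Qed.

(** A Gronwall estimate without exponentials: a small [K] allows the maximum of the first derivative
    to be absorbed into the left-hand side, so the function leaves its tangent by a relative error
    of order [K] only. *)
Lemma almost_affine (d d1 d2 : axis -> R -> R) (K : R) :
  0 <= K <= 1 / 8 ->
  (forall m w, 0 <= w <= 1 -> is_derive (d m) w (d1 m w)) ->
  (forall m w, 0 <= w <= 1 -> is_derive (d1 m) w (d2 m w)) ->
  (forall m w, 0 <= w <= 1 -> Rabs (d2 m w) <=
     K * (sum_axis (fun n => Rabs (d n w)) + sum_axis (fun n => Rabs (d1 n w)))) ->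
  forall m, Rabs (d m 1 - d m 0 - d1 m 0) <=
    16 * K * (sum_axis (fun n => Rabs (d n 0)) + sum_axis (fun n => Rabs (d1 n 0))).
Proof.
intros HK Hd Hd1 Hd2.
set (N := fun w => sum_axis (fun n => Rabs (d n w))).
set (N1 := fun w => sum_axis (fun n => Rabs (d1 n w))).
assert (HN1 : forall w, 0 <= N1 w) by (intros; apply sum_axis_ge0; intros; apply Rabs_pos).
assert (HN : forall w, 0 <= N w) by (intros; apply sum_axis_ge0; intros; apply Rabs_pos).
assert (Cd1 : forall w, 0 <= w <= 1 -> continuity_pt N1 w).
{ intros w Hw. apply continuity_pt_plus;
    apply (continuity_pt_comp (d1 _) Rabs); try apply Rcontinuity_abs;
    eapply is_derive_continuity_pt, Hd1, Hw. }
destruct (continuity_ab_maj N1 0 1) as [ws [Hmax Hws]]; [lra|easy|].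
assert (Bd : forall w, 0 <= w <= 1 -> N w <= N 0 + 2 * N1 ws).
{ intros w Hw. assert (H : forall m, Rabs (d m w) <= Rabs (d m 0) + N1 ws).
  { intros m. assert (H := mean_value_abs_le (d m) (d1 m) 0 w (N1 ws)).
    rewrite Rmin_left, Rmax_right in H by lra.
    assert (H' : Rabs (d m w - d m 0) <= N1 ws * Rabs (w - 0)).
    { apply H.
      - intros; apply Hd; lra.
      - intros x Hx. apply Rle_trans with (N1 x); [|apply Hmax; lra].
        apply (le_sum_axis (fun n => Rabs (d1 n x))). intros; apply Rabs_pos. }
    rewrite (Rabs_pos_eq (w - 0)) in H' by lra.
    assert (H1 := Rabs_triang (d m w - d m 0) (d m 0)).
    replace (d m w - d m 0 + d m 0) with (d m w) in H1 by ring.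
    generalize (HN1 ws). nra. }
  unfold N, sum_axis. generalize (H ax1) (H ax2). lra. }
set (Q := N1 ws) in *.
assert (Bd2 : forall m w, 0 <= w <= 1 -> Rabs (d2 m w) <= K * (N 0 + 3 * Q)).
{ intros m w Hw. apply Rle_trans with (1 := Hd2 m w Hw).
  apply Rmult_le_compat_l; [lra|]. fold (N w) (N1 w).
  generalize (Bd w Hw) (Hmax w Hw). lra. }
assert (Bd1 : forall m w, 0 <= w <= 1 -> Rabs (d1 m w - d1 m 0) <= K * (N 0 + 3 * Q)).
{ intros m w Hw. assert (H := mean_value_abs_le (d1 m) (d2 m) 0 w (K * (N 0 + 3 * Q))).
  rewrite Rmin_left, Rmax_right in H by lra.
  rewrite (Rabs_pos_eq (w - 0)) in H by lra.
  assert (HQ := HN1 ws). fold Q in HQ. generalize (HN 0). intros HN0.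
  assert (0 <= K * (N 0 + 3 * Q)) by nra.
  apply Rle_trans with (K * (N 0 + 3 * Q) * (w - 0)); [|nra].
  apply H; intros; [apply Hd1|apply Bd2]; lra. }
assert (BQ : Q <= N1 0 + 2 * (K * (N 0 + 3 * Q))).
{  assert (H : forall m, Rabs (d1 m ws) <= Rabs (d1 m 0) + K * (N 0 + 3 * Q)).
  { intros m. assert (H1 := Rabs_triang (d1 m ws - d1 m 0) (d1 m 0)).
    replace (d1 m ws - d1 m 0 + d1 m 0) with (d1 m ws) in H1 by ring.
    generalize (Bd1 m ws Hws). lra. }
  assert (HA := H ax1). assert (HB := H ax2).
  change (Rabs (d1 ax1 ws) + Rabs (d1 ax2 ws) <=
    Rabs (d1 ax1 0) + Rabs (d1 ax2 0) + 2 * (K * (N 0 + 3 * Q))). lra. }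
assert (HQ := HN1 ws). fold Q in HQ.
assert (HN0 := HN 0). assert (HN10 := HN1 0).
(* [K <= 1 / 8] turns [BQ] into [Q <= N1 0 + (N 0 + 3 * Q) / 4], which can be solved for [Q]. Then
   [N 0 + 3 * Q <= 4 * N 0 + 12 * N1 0], within the factor 16 of the conclusion. *)
assert (HKQ : K * (N 0 + 3 * Q) <= 1 / 8 * (N 0 + 3 * Q)).
{ apply Rmult_le_compat_r; lra. }
assert (BQ' : Q <= 4 * N1 0 + N 0) by lra.
intros m. fold (N 0) (N1 0).
destruct (MVT_gen (d m) 0 1 (d1 m)) as [c [Hc Ec]].
- rewrite Rmin_left, Rmax_right by lra. intros x Hx. apply Hd; lra.
- rewrite Rmin_left, Rmax_right by lra. intros x Hx.
  eapply is_derive_continuity_pt, Hd, Hx.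
- rewrite Rmin_left, Rmax_right in Hc by lra.
  rewrite Ec, Rminus_0_r, Rmult_1_r.
  apply Rle_trans with (1 := Bd1 m c Hc).
  rewrite (Rmult_comm 16), Rmult_assoc. apply Rmult_le_compat_l; lra.
Qed.

(** * Expansion of curves *)

(** The sum norm lets Lipschitz estimates add up axis by axis, without square roots. *)
Definition dist2 (z z' : R * R) : R := sum_axis (fun m => Rabs (crd m z - crd m z')).

(** The bilinear term of the geodesic equation [x'' + Gamma(x', x') = 0]. *)
Definition quad (Gam : axis -> axis -> axis -> R * R -> R) (z : R * R)
    (a b : axis -> R) (l : axis) : R :=
  sum_axis (fun p => sum_axis (fun q => Gam l p q z * a p * b q)).

(* A curve on [lo, hi] with arc length [ell], speed [rho], unit tangent [T] and
   covariant acceleration [W] with respect to arc length. *)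
Record curve_on (Gam : axis -> axis -> axis -> R * R -> R) (lo hi : R)
    (Z : R -> R * R) (T W : axis -> R -> R) (rho ell : R -> R) : Prop := {
  curve_pos : forall m w, lo <= w <= hi ->
    is_derive (fun x => crd m (Z x)) w (rho w * T m w);
  curve_vel : forall m w, lo <= w <= hi ->
    is_derive (T m) w
      (rho w * (W m w - quad Gam (Z w) (fun p => T p w) (fun q => T q w) m));
  curve_ell : forall w, lo <= w <= hi -> is_derive ell w (rho w);
  curve_rho : forall w, lo <= w <= hi -> 0 <= rho w;
  curve_ell0 : ell lo = 0
}.

Lemma is_derive_mult_const (f : R -> R) (x l c : R) :
  is_derive f x l -> is_derive (fun y => f y * c) x (l * c).
Proof.
intros H. rewrite Rmult_comm. apply is_derive_ext with (fun y => c * f y).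
  intros t; apply Rmult_comm.
now apply is_derive_scal.
Qed.

Lemma curve_ell_le Gam lo hi Z T W rho ell w w' :
  curve_on Gam lo hi Z T W rho ell -> lo <= w -> w <= w' -> w' <= hi -> ell w <= ell w'.
Proof.
intros H H1 H2 H3. apply derive_nonneg_le with rho; [easy| |]; intros;
  [eapply curve_ell|eapply curve_rho]; try exact H; lra.
Qed.

(** * Estimates uniform in a family of curves *)

Section Families.
Context {I : Type} (D : I -> Prop) (B : I -> R * R -> Prop) (M : R).
Variable Gam : axis -> axis -> axis -> R * R -> R.
Hypothesis Gam_bd : forall i z l p q, D i -> B i z -> Rabs (Gam l p q z) <= M.
Hypothesis Gam_lip : forall i z z' l p q, D i -> B i z -> B i z' ->
  Rabs (Gam l p q z - Gam l p q z') <= M * dist2 z z'.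

(** An index [j] may carry a parameter besides a configuration; [pr] recovers the configuration,
    whose box is the region where the bounds on [Gam] are known. *)
Definition in_box {J : Type} (D' : J -> Prop) (pr : J -> I) (Z : J -> R * R) : Prop :=
  forall j, D' j -> D (pr j) /\ B (pr j) (Z j).

Lemma Gam_bigO {J : Type} (D' : J -> Prop) (pr : J -> I) Z l p q :
  in_box D' pr Z -> bigO D' (fun j => Gam l p q (Z j)) (fun _ => 1).
Proof.
intros H. apply bigO_bound with M; [|intros; lra].
intros j Hj. destruct (H j Hj) as [H1 H2]. rewrite Rmult_1_r. eauto.
Qed.

Lemma Gam_congO {J : Type} (D' : J -> Prop) (pr : J -> I) Z Z' e l p q :
  in_box D' pr Z -> in_box D' pr Z' ->
  (forall m, congO D' e (fun j => crd m (Z j)) (fun j => crd m (Z' j))) ->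
  congO D' e (fun j => Gam l p q (Z j)) (fun j => Gam l p q (Z' j)).
Proof.
intros H H' HZ.
apply bigO_trans with (fun j => dist2 (Z j) (Z' j)).
- apply bigO_bound with M.
  + intros j Hj. destruct (H j Hj), (H' j Hj). eauto.
  + intros. apply sum_axis_ge0. intros. apply Rabs_pos.
- apply bigO_sum. intros m. apply bigO_abs, HZ.
Qed.

Lemma quad_bigO {J : Type} (D' : J -> Prop) (pr : J -> I) Z (a b : axis -> J -> R) ea eb l :
  in_box D' pr Z -> (forall p, bigO D' (a p) ea) -> (forall p, bigO D' (b p) eb) ->
  bigO D' (fun j => quad Gam (Z j) (fun p => a p j) (fun q => b q j) l)
    (fun j => ea j * eb j).
Proof.
intros HZ Ha Hb. apply bigO_sum. intros p. apply bigO_sum. intros q.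
apply bigO_mult; [|easy]. apply bigO_mult_l; [|easy]. now apply Gam_bigO with pr.
Qed.

Lemma quad_bigO_1 {J : Type} (D' : J -> Prop) (pr : J -> I) Z (a b : axis -> J -> R) l :
  in_box D' pr Z -> (forall p, bigO D' (a p) (fun _ => 1)) ->
  (forall p, bigO D' (b p) (fun _ => 1)) ->
  bigO D' (fun j => quad Gam (Z j) (fun p => a p j) (fun q => b q j) l) (fun _ => 1).
Proof.
intros HZ Ha Hb. apply bigO_le with (fun _ => 1 * 1); [intros; lra|].
now apply quad_bigO with pr.
Qed.

Lemma quad_congO {J : Type} (D' : J -> Prop) (pr : J -> I) Z Z' (a a' b b' : axis -> J -> R) e l :
  in_box D' pr Z -> in_box D' pr Z' ->
  (forall m, congO D' e (fun j => crd m (Z j)) (fun j => crd m (Z' j))) ->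
  (forall p, congO D' e (a p) (a' p)) -> (forall p, congO D' e (b p) (b' p)) ->
  (forall p, bigO D' (a p) (fun _ => 1)) -> (forall p, bigO D' (a' p) (fun _ => 1)) ->
  (forall p, bigO D' (b p) (fun _ => 1)) -> (forall p, bigO D' (b' p) (fun _ => 1)) ->
  congO D' e (fun j => quad Gam (Z j) (fun p => a p j) (fun q => b q j) l)
    (fun j => quad Gam (Z' j) (fun p => a' p j) (fun q => b' q j) l).
Proof.
intros HZ HZ' CZ Ca Cb Ba Ba' Bb Bb'.
apply congO_sum. intros p. apply congO_sum. intros q.
apply congO_mult; auto.
- apply congO_mult; auto.
  + now apply Gam_congO with pr.
  + now apply Gam_bigO with pr.
- apply bigO_mult_l; auto. now apply Gam_bigO with pr.
Qed.

(** Pairs of a configuration and a parameter on its arc, so that a bound over them is uniform in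
    both. *)
Definition seg (lo hi : I -> R) (j : I * R) : Prop :=
  D (fst j) /\ lo (fst j) <= snd j <= hi (fst j).

(** Integration in arc length gains one power: [ell] increases from 0, so [ell ^ n] at the far end
    dominates its values on the whole arc before it. *)
Lemma bigO_integrate (lo hi : I -> R) (F G rho ell : I -> R -> R) (n : nat) :
  (forall i w, D i -> lo i <= w <= hi i -> is_derive (F i) w (rho i w * G i w)) ->
  (forall i w, D i -> lo i <= w <= hi i -> is_derive (ell i) w (rho i w)) ->
  (forall i w, D i -> lo i <= w <= hi i -> 0 <= rho i w) ->
  (forall i, D i -> ell i (lo i) = 0) ->
  bigO (seg lo hi) (fun j => G (fst j) (snd j)) (fun j => ell (fst j) (snd j) ^ n) ->
  bigO (seg lo hi) (fun j => F (fst j) (snd j) - F (fst j) (lo (fst j)))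
    (fun j => ell (fst j) (snd j) ^ S n).
Proof.
intros HF Hl Hr Hl0 [C [HC HG]].
assert (mono : forall i w w', D i -> lo i <= w -> w <= w' -> w' <= hi i ->
  ell i w <= ell i w').
{ intros i w w' Hi H1 H2 H3. apply derive_nonneg_le with (rho i); [easy| |];
    intros; [apply Hl|apply Hr]; try easy; lra. }
exists C. split; [easy|]. intros [i w] [Hi Hw]; cbn [fst snd] in *.
assert (H0 : 0 <= ell i w).
{ rewrite <- (Hl0 i Hi). apply mono; try easy; lra. }
apply Rle_trans with (C * ell i w ^ n * (ell i w - ell i (lo i))).
- apply mean_value_le with (G i) (rho i); try (intros; auto with real; fail).
  + lra.
  + intros; apply HF; [easy|lra].
  + intros; apply Hl; [easy|lra].
  + intros; apply Hr; [easy|lra].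
  + intros x Hx. apply Rle_trans with (C * ell i x ^ n).
    * apply (HG (i, x)). split; cbn; [easy|lra].
    * apply Rmult_le_compat_l; [easy|]. apply pow_incr. split.
      -- rewrite <- (Hl0 i Hi). apply mono; try easy; lra.
      -- apply mono; try easy; lra.
- rewrite Hl0 by easy. cbn. lra.
Qed.

(** * Taylor expansions of a curve in its arc length *)

Section Expansion.
Variables (lo hi : I -> R) (Z : I -> R -> R * R) (T W : I -> axis -> R -> R)
  (rho ell : I -> R -> R).
Hypothesis Hcurve : forall i, D i ->
  curve_on Gam (lo i) (hi i) (Z i) (T i) (W i) (rho i) (ell i).
Hypothesis Hlohi : forall i, D i -> lo i <= hi i.
Hypothesis Hbox : in_box (seg lo hi) fst (fun j => Z (fst j) (snd j)).
Hypothesis T_bd : forall m, bigO (seg lo hi) (fun j => T (fst j) m (snd j)) (fun _ => 1).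
Hypothesis W_bd : forall m, bigO (seg lo hi) (fun j => W (fst j) m (snd j)) (fun _ => 1).
Hypothesis W_lip : forall m, congO (seg lo hi) (fun j => ell (fst j) (snd j) ^ 1)
  (fun j => W (fst j) m (snd j)) (fun j => W (fst j) m (lo (fst j))).

Lemma at_lo (f : I -> R -> R) e : bigO (seg lo hi) (fun j => f (fst j) (snd j)) (fun _ => e) ->
  bigO (seg lo hi) (fun j => f (fst j) (lo (fst j))) (fun _ => e).
Proof.
apply (bigO_comp (seg lo hi) (seg lo hi) (fun j => (fst j, lo (fst j)))
  (fun j => f (fst j) (snd j)) (fun _ => e)).
intros [i w] [Hi Hw]; cbn in *. split; cbn; [easy|]. generalize (Hlohi i Hi); lra.
Qed.

Lemma box_lo : in_box (seg lo hi) fst (fun j => Z (fst j) (lo (fst j))).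
Proof.
intros [i w] [Hi Hw]; cbn in *. apply (Hbox (i, lo i)). split; cbn; [easy|].
generalize (Hlohi i Hi); lra.
Qed.

Lemma curve_integrate (F G : I -> R -> R) (n : nat) :
  (forall i w, D i -> lo i <= w <= hi i -> is_derive (F i) w (rho i w * G i w)) ->
  bigO (seg lo hi) (fun j => G (fst j) (snd j)) (fun j => ell (fst j) (snd j) ^ n) ->
  bigO (seg lo hi) (fun j => F (fst j) (snd j) - F (fst j) (lo (fst j)))
    (fun j => ell (fst j) (snd j) ^ S n).
Proof.
intros HF HG. apply bigO_integrate with G rho; auto.
- intros i w Hi. apply (curve_ell _ _ _ _ _ _ _ _ (Hcurve i Hi)).
- intros i w Hi. apply (curve_rho _ _ _ _ _ _ _ _ (Hcurve i Hi)).
- intros i Hi. apply (curve_ell0 _ _ _ _ _ _ _ _ (Hcurve i Hi)).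
Qed.

Lemma curve_position_1 m : congO (seg lo hi) (fun j => ell (fst j) (snd j) ^ 1)
  (fun j => crd m (Z (fst j) (snd j))) (fun j => crd m (Z (fst j) (lo (fst j)))).
Proof.
apply (curve_integrate (fun i w => crd m (Z i w)) (fun i => T i m)).
- intros i w Hi. apply (curve_pos _ _ _ _ _ _ _ _ (Hcurve i Hi)).
- exact (T_bd m).
Qed.

(* the acceleration in coordinates, with respect to arc length *)
Definition accel (i : I) (m : axis) (w : R) : R :=
  W i m w - quad Gam (Z i w) (fun p => T i p w) (fun q => T i q w) m.

Lemma accel_bd m : bigO (seg lo hi) (fun j => accel (fst j) m (snd j)) (fun _ => 1).
Proof. apply bigO_minus; [apply W_bd|]. now apply quad_bigO_1 with fst. Qed.

Lemma curve_velocity_1 m : congO (seg lo hi) (fun j => ell (fst j) (snd j) ^ 1)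
  (fun j => T (fst j) m (snd j)) (fun j => T (fst j) m (lo (fst j))).
Proof.
apply (curve_integrate (fun i => T i m) (fun i => accel i m)).
- intros i w Hi. apply (curve_vel _ _ _ _ _ _ _ _ (Hcurve i Hi)).
- exact (accel_bd m).
Qed.

(** Plays the role of a bounded third derivative in Taylor's formula. *)
Lemma accel_lip m : congO (seg lo hi) (fun j => ell (fst j) (snd j) ^ 1)
  (fun j => accel (fst j) m (snd j)) (fun j => accel (fst j) m (lo (fst j))).
Proof.
apply congO_minus; [apply W_lip|].
apply quad_congO with fst; auto using curve_position_1, curve_velocity_1.
- exact box_lo.
- intros p. apply (at_lo (fun i => T i p)), T_bd.
- intros p. apply (at_lo (fun i => T i p)), T_bd.
Qed.

Lemma curve_velocity_2 m : congO (seg lo hi) (fun j => ell (fst j) (snd j) ^ 2)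
  (fun j => T (fst j) m (snd j))
  (fun j => T (fst j) m (lo (fst j)) + ell (fst j) (snd j) * accel (fst j) m (lo (fst j))).
Proof.
(* The leading term is subtracted before integrating; it vanishes at [lo] together with [ell], so it
   adds nothing to the initial value. *)
apply bigO_ext with (fun j => (T (fst j) m (snd j)
    - ell (fst j) (snd j) * accel (fst j) m (lo (fst j)))
  - (T (fst j) m (lo (fst j))
    - ell (fst j) (lo (fst j)) * accel (fst j) m (lo (fst j)))).
{ intros [i w] [Hi Hw]; cbn [fst snd] in *.
  rewrite (curve_ell0 _ _ _ _ _ _ _ _ (Hcurve i Hi)). ring. }
apply (curve_integrate (fun i w => T i m w - ell i w * accel i m (lo i))
  (fun i w => accel i m w - accel i m (lo i))).
- intros i w Hi Hw. rewrite Rmult_minus_distr_l.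
  apply (is_derive_minus (T i m) (fun w => ell i w * accel i m (lo i))).
  + now apply (curve_vel _ _ _ _ _ _ _ _ (Hcurve i Hi)).
  + apply (is_derive_mult_const (ell i)). now apply (curve_ell _ _ _ _ _ _ _ _ (Hcurve i Hi)).
- apply accel_lip.
Qed.

Lemma curve_position_2 m : congO (seg lo hi) (fun j => ell (fst j) (snd j) ^ 2)
  (fun j => crd m (Z (fst j) (snd j)))
  (fun j => crd m (Z (fst j) (lo (fst j))) + ell (fst j) (snd j) * T (fst j) m (lo (fst j))).
Proof.
apply bigO_ext with (fun j => (crd m (Z (fst j) (snd j))
    - ell (fst j) (snd j) * T (fst j) m (lo (fst j)))
  - (crd m (Z (fst j) (lo (fst j)))
    - ell (fst j) (lo (fst j)) * T (fst j) m (lo (fst j)))).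
{ intros [i w] [Hi Hw]; cbn [fst snd] in *.
  rewrite (curve_ell0 _ _ _ _ _ _ _ _ (Hcurve i Hi)). ring. }
apply (curve_integrate (fun i w => crd m (Z i w) - ell i w * T i m (lo i))
  (fun i w => T i m w - T i m (lo i))).
- intros i w Hi Hw. rewrite Rmult_minus_distr_l.
  apply (is_derive_minus (fun w => crd m (Z i w)) (fun w => ell i w * T i m (lo i))).
  + now apply (curve_pos _ _ _ _ _ _ _ _ (Hcurve i Hi)).
  + apply (is_derive_mult_const (ell i)). now apply (curve_ell _ _ _ _ _ _ _ _ (Hcurve i Hi)).
- apply curve_velocity_1.
Qed.

Lemma curve_position_3 m : congO (seg lo hi) (fun j => ell (fst j) (snd j) ^ 3)
  (fun j => crd m (Z (fst j) (snd j)))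
  (fun j => crd m (Z (fst j) (lo (fst j))) + ell (fst j) (snd j) * T (fst j) m (lo (fst j))
    + ell (fst j) (snd j) ^ 2 / 2 * accel (fst j) m (lo (fst j))).
Proof.
set (F := fun i w => crd m (Z i w)
  - (ell i w * T i m (lo i) + ell i w ^ 2 / 2 * accel i m (lo i))).
apply bigO_ext with (fun j => F (fst j) (snd j) - F (fst j) (lo (fst j))).
{ intros [i w] [Hi Hw]; cbn [fst snd] in *. unfold F.
  rewrite (curve_ell0 _ _ _ _ _ _ _ _ (Hcurve i Hi)). field. }
apply (curve_integrate F
  (fun i w => T i m w - (T i m (lo i) + ell i w * accel i m (lo i)))).
- intros i w Hi Hw. unfold F.
  assert (H1 := curve_pos _ _ _ _ _ _ _ _ (Hcurve i Hi) m w Hw).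
  assert (H2 := curve_ell _ _ _ _ _ _ _ _ (Hcurve i Hi) w Hw).
  rewrite Rmult_minus_distr_l.
  apply (is_derive_minus (fun w => crd m (Z i w))); [easy|].
  auto_derive; [repeat split; now exists (rho i w)|].
  replace (Derive (fun x => ell i x) w) with (rho i w); [field|].
  symmetry. now apply is_derive_unique.
- apply curve_velocity_2.
Qed.

End Expansion.
End Families.

(** * Compactness and local Lipschitz continuity *)

(** Induction along an interval, by the supremum of the initial segments on which [P] holds. It
    replaces open covers in the compactness argument and also confines the geodesics to a ball. *)
Lemma real_induction (P : R -> Prop) (a b : R) :
  P a ->
  (forall x, a <= x < b -> (forall y, a <= y <= x -> P y) ->
     exists eps, 0 < eps /\ forall y, x < y < x + eps -> P y) ->
  (forall x, a < x <= b -> (forall y, a <= y < x -> P y) -> P x) ->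
  forall x, a <= x <= b -> P x.
Proof.
intros Pa Hr Hl x Hx.
set (E := fun x => a <= x <= b /\ forall y, a <= y <= x -> P y).
destruct (completeness E) as [s [Hub Hlub]].
- exists b. intros y Hy. apply Hy.
- exists a. split; [lra|]. intros y Hy. now replace y with a by lra.
- assert (Has : a <= s).
  { apply Hub. split; [lra|]. intros y Hy. now replace y with a by lra. }
  assert (Hsb : s <= b) by (apply Hlub; intros y Hy; apply Hy).
  assert (Hlt : forall y, a <= y < s -> P y).
  { intros y Hy. destruct (Classical_Prop.classic (P y)) as [|N]; [easy|].
    exfalso. assert (s <= y); [|lra]. apply Hlub. intros z [_ Hz].
    destruct (Rle_or_lt z y) as [|H]; [easy|]. destruct N. apply Hz; lra. }
  assert (Ps : P s).
  { destruct (Req_dec s a) as [->|N]; [easy|]. apply Hl; [lra|easy]. }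
  assert (Hle : forall y, a <= y <= s -> P y).
  { intros y Hy. destruct (Req_dec y s) as [->|N]; [easy|]. apply Hlt; lra. }
  destruct (Rle_or_lt b s) as [H|H]; [apply Hle; lra|].
  exfalso. destruct (Hr s (conj Has H) Hle) as [eps [Peps He]].
  set (s' := Rmin b (s + eps / 2)).
  assert (Hs' : s < s' <= b).
  { split; [apply Rmin_glb_lt; lra|apply Rmin_l]. }
  assert (Hs2 : s' <= s + eps / 2) by apply Rmin_r.
  assert (s' <= s); [|lra]. apply Hub. split; [lra|].
  intros y Hy. destruct (Rle_or_lt y s); [apply Hle; lra|apply He; lra].
Qed.

(** Monotonicity in the constant is what lets neighbouring local constants be merged into their
    maximum. *)
Lemma compact_uniform (P : R -> R -> Prop) (a b : R) :
  (forall t M M', P t M -> M <= M' -> P t M') ->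
  (forall t, a <= t <= b -> exists M eps, 0 < eps /\
     forall t', a <= t' <= b -> Rabs (t' - t) < eps -> P t' M) ->
  exists M, forall t, a <= t <= b -> P t M.
Proof.
intros mono loc. destruct (Rle_or_lt a b) as [Hab|Hab].
2:{ exists 0. intros; lra. }
(* The repeated bound [t <= b] is the induction variable at its final value. *)
cut (exists M, forall t, a <= t <= b -> t <= b -> P t M).
{ intros [M H]. exists M. intros t Ht. now apply H. }
apply (real_induction (fun x => exists M, forall t, a <= t <= b -> t <= x -> P t M) a b).
- destruct (loc a) as [M [eps [Peps H]]]; [lra|]. exists M. intros t Ht Ht'.
  apply H; [easy|]. apply Rabs_def1; lra.
- intros x Hx H. destruct (H x) as [M HM]; [lra|].
  destruct (loc x) as [M' [eps [Peps H']]]; [lra|]. exists eps. split; [easy|].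
  intros y Hy. exists (Rmax M M'). intros t Ht Ht'.
  destruct (Rle_or_lt t x).
  + apply mono with (2 := Rmax_l _ _). auto.
  + apply mono with (2 := Rmax_r _ _). apply H'; [easy|]. apply Rabs_def1; lra.
- intros x Hx H. destruct (loc x) as [M' [eps [Peps H']]]; [lra|].
  destruct (H (Rmax a (x - eps / 2))) as [M HM].
  { split; [apply Rmax_l|]. apply Rmax_lub_lt; lra. }
  exists (Rmax M M'). intros t Ht Ht'.
  destruct (Rle_or_lt t (Rmax a (x - eps / 2))) as [L|L].
  + apply mono with (2 := Rmax_l _ _). auto.
  + apply mono with (2 := Rmax_r _ _). apply H'; [easy|].
    assert (x - eps / 2 < t) by (apply Rle_lt_trans with (2 := L), Rmax_r).
    apply Rabs_def1; lra.
- lra.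
Qed.

(** The velocity is bounded only as long as the curve is in the ball, so the bound cannot be
    integrated at once; the time spent in the ball is extended step by step. *)
Lemma stays_in_ball_pos (y V : axis -> R -> R) (c : axis -> R) (r K d : R) :
  (forall m w, 0 <= w < d -> is_derive (y m) w (V m w)) ->
  (forall w, 0 <= w < d -> sum_axis (fun m => Rabs (c m - y m w)) < r ->
     forall m, Rabs (V m w) <= K) ->
  0 <= K -> sum_axis (fun m => Rabs (c m - y m 0)) + 2 * K * d < r ->
  forall w, 0 <= w < d -> sum_axis (fun m => Rabs (c m - y m w)) < r.
Proof.
intros Hy HV PK H0 w Hw.
set (N := fun w => sum_axis (fun m => Rabs (c m - y m w))) in *.
assert (CN : forall x, 0 <= x < d -> continuity_pt N x).
{ intros x Hx. unfold N, sum_axis.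
  apply continuity_pt_plus; apply (continuity_pt_comp (fun w => c _ - y _ w) Rabs);
    try apply Rcontinuity_abs; apply continuity_pt_minus;
    try (apply continuity_pt_const; now intros ? ?);
    eapply is_derive_continuity_pt, Hy, Hx. }
assert (nearN : forall x e, 0 <= x < d -> 0 < e -> exists eta, 0 < eta /\
  forall z, Rabs (z - x) < eta -> Rabs (N z - N x) < e).
{ intros x e Hx He. destruct (CN x Hx e He) as [eta [Peta H]].
  exists eta. split; [easy|]. intros z Hz.
  destruct (Req_dec z x) as [->|E]; [unfold Rminus; rewrite Rplus_opp_r, Rabs_R0; easy|].
  apply H. split; [|easy]. split; [easy|auto]. }
assert (bd : forall z, 0 <= z < d -> (forall z', 0 <= z' <= z -> N z' < r) ->
  N z <= N 0 + 2 * K * z).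
{ intros z Hz H.
  assert (B : forall m, Rabs (c m - y m z) <= Rabs (c m - y m 0) + K * z).
  { intros m. assert (A := mean_value_abs_le (y m) (V m) 0 z K).
    rewrite Rmin_left, Rmax_right, (Rabs_pos_eq (z - 0)), Rminus_0_r in A by lra.
    assert (A' : Rabs (y m z - y m 0) <= K * z).
    { apply A; intros x Hx; [apply Hy; lra|apply HV; [lra|now apply H]]. }
    replace (c m - y m z) with ((c m - y m 0) + - (y m z - y m 0)) by ring.
    apply Rle_trans with (1 := Rabs_triang _ _). rewrite Rabs_Ropp. lra. }
  unfold N, sum_axis. generalize (B ax1) (B ax2). lra. }
change (N 0 + 2 * K * d < r) in H0.
assert (HN0 : N 0 < r).
{ assert (0 <= K * d) by (apply Rmult_le_pos; lra). lra. }
apply (real_induction (fun x => N x < r) 0 w); [easy| | |lra].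
- intros x Hx H. destruct (nearN x (r - N x)) as [eta [Peta He]]; [lra| |].
  { assert (N x < r) by (apply H; lra). lra. }
  exists eta. split; [easy|]. intros z Hz.
  assert (A : Rabs (N z - N x) < r - N x) by (apply He, Rabs_def1; lra).
  apply Rabs_def2 in A. lra.
(* The margin [r - N 0 - 2 * K * d] is the same at all times; hence the limit at [x] is still
   strictly inside the ball. *)
- intros x Hx H. destruct (nearN x (r - N 0 - 2 * K * d)) as [eta [Peta He]]; [lra|lra|].
  set (z := Rmax 0 (x - eta / 2)).
  assert (Hz : 0 <= z < x) by (split; [apply Rmax_l|apply Rmax_lub_lt; lra]).
  assert (Hz' : x - eta / 2 <= z) by apply Rmax_r.
  assert (A : Rabs (N z - N x) < r - N 0 - 2 * K * d) by (apply He, Rabs_def1; lra).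
  apply Rabs_def2 in A.
  assert (B : N z <= N 0 + 2 * K * z) by (apply bd; [lra|intros; apply H; lra]).
  assert (2 * K * z <= 2 * K * d) by (apply Rmult_le_compat_l; lra). lra.
Qed.

Lemma stays_in_ball (y V : axis -> R -> R) (c : axis -> R) (r K d : R) :
  (forall m w, Rabs w < d -> is_derive (y m) w (V m w)) ->
  (forall w, Rabs w < d -> sum_axis (fun m => Rabs (c m - y m w)) < r ->
     forall m, Rabs (V m w) <= K) ->
  0 <= K -> sum_axis (fun m => Rabs (c m - y m 0)) + 2 * K * d < r ->
  forall w, Rabs w < d -> sum_axis (fun m => Rabs (c m - y m w)) < r.
Proof.
intros Hy HV PK H0 w Hw. destruct (Rle_or_lt 0 w) as [P|P].
- rewrite Rabs_pos_eq in Hw by easy.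
  apply (stays_in_ball_pos y V c r K d); try easy.
  + intros; apply Hy. rewrite Rabs_pos_eq; lra.
  + intros x Hx. apply HV. rewrite Rabs_pos_eq; lra.
- rewrite Rabs_left in Hw by easy. rewrite <- (Ropp_involutive w).
  apply (stays_in_ball_pos (fun m x => y m (- x)) (fun m x => - V m (- x)) c r K d); try lra.
  + intros m x Hx. rewrite <- (Rmult_1_l (V _ _)), <- Ropp_mult_distr_l_reverse.
    apply (is_derive_comp (y m) Ropp); [|auto_derive; [easy|ring]].
    apply Hy. rewrite Rabs_Ropp, Rabs_pos_eq; lra.
  + intros x Hx H m. rewrite Rabs_Ropp. apply HV; [|easy].
    rewrite Rabs_Ropp, Rabs_pos_eq; lra.
  + now rewrite Ropp_0.
Qed.

(** * Calculus of locally Lipschitz functions *)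

Section LocallyLipschitz.
Context {X : Type} (d : X -> X -> R).
Hypothesis d_ge0 : forall x y, 0 <= d x y.
Hypothesis d_refl : forall x, d x x = 0.
Hypothesis d_sym : forall x y, d x y = d y x.

(** Boundedness is included so that the class is stable under products. The distance is a parameter
    in order to treat functions on the line and on the chart alike. *)
Definition loc_lip (f : X -> R) (x : X) : Prop :=
  exists K eps, 0 <= K /\ 0 < eps /\ forall y z, d x y < eps -> d x z < eps ->
    Rabs (f y) <= K /\ Rabs (f y - f z) <= K * d y z.

Lemma loc_lip_ext f f' x : (forall y, f y = f' y) -> loc_lip f x -> loc_lip f' x.
Proof.
intros E [K [eps [PK [Pe H]]]]. exists K, eps. split; [easy|]. split; [easy|].
intros y z. rewrite <- !E. auto.
Qed.

Lemma loc_lip_const c x : loc_lip (fun _ => c) x.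
Proof.
exists (Rabs c), 1. split; [apply Rabs_pos|]. split; [lra|]. intros y z _ _.
unfold Rminus. rewrite Rplus_opp_r, Rabs_R0. split; [lra|].
apply Rmult_le_pos; [apply Rabs_pos|easy].
Qed.

Lemma loc_lip_plus f g x : loc_lip f x -> loc_lip g x -> loc_lip (fun y => f y + g y) x.
Proof.
intros [K [eps [PK [Pe H]]]] [K' [eps' [PK' [Pe' H']]]].
exists (K + K'), (Rmin eps eps'). split; [lra|]. split; [now apply Rmin_pos|].
intros y z Hy Hz.
destruct (H y z) as [A B]; [apply Rlt_le_trans with (2 := Rmin_l _ eps'); easy
  |apply Rlt_le_trans with (2 := Rmin_l _ eps'); easy|].
destruct (H' y z) as [A' B']; [apply Rlt_le_trans with (2 := Rmin_r eps _); easy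
  |apply Rlt_le_trans with (2 := Rmin_r eps _); easy|].
split.
- apply Rle_trans with (1 := Rabs_triang _ _). lra.
- replace (f y + g y - (f z + g z)) with ((f y - f z) + (g y - g z)) by ring.
  apply Rle_trans with (1 := Rabs_triang _ _). lra.
Qed.

Lemma loc_lip_mult f g x : loc_lip f x -> loc_lip g x -> loc_lip (fun y => f y * g y) x.
Proof.
intros [K [eps [PK [Pe H]]]] [K' [eps' [PK' [Pe' H']]]].
exists (2 * K * K' + K * K'), (Rmin eps eps'). split; [nra|]. split; [now apply Rmin_pos|].
intros y z Hy Hz.
destruct (H y z) as [A B]; [apply Rlt_le_trans with (2 := Rmin_l _ eps'); easy
  |apply Rlt_le_trans with (2 := Rmin_l _ eps'); easy|].
destruct (H' y z) as [A' B']; [apply Rlt_le_trans with (2 := Rmin_r eps _); easy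
  |apply Rlt_le_trans with (2 := Rmin_r eps _); easy|].
destruct (H z y) as [A0 _]; [apply Rlt_le_trans with (2 := Rmin_l _ eps'); easy
  |apply Rlt_le_trans with (2 := Rmin_l _ eps'); easy|].
split.
- rewrite Rabs_mult. apply Rle_trans with (K * K'); [|nra].
  apply Rmult_le_compat; auto using Rabs_pos.
- replace (f y * g y - f z * g z) with ((f y - f z) * g y + f z * (g y - g z)) by ring.
  apply Rle_trans with (1 := Rabs_triang _ _). rewrite !Rabs_mult.
  assert (Rabs (f y - f z) * Rabs (g y) <= (K * d y z) * K').
  { apply Rmult_le_compat; auto using Rabs_pos. }
  assert (Rabs (f z) * Rabs (g y - g z) <= K * (K' * d y z)).
  { apply Rmult_le_compat; auto using Rabs_pos. }
  generalize (d_ge0 y z). intros. assert (0 <= K * K') by nra. nra.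
Qed.

Lemma loc_lip_opp f x : loc_lip f x -> loc_lip (fun y => - f y) x.
Proof.
intros H. apply loc_lip_ext with (fun y => -1 * f y); [intros; ring|].
apply loc_lip_mult; [apply loc_lip_const|easy].
Qed.

Lemma loc_lip_minus f g x : loc_lip f x -> loc_lip g x -> loc_lip (fun y => f y - g y) x.
Proof. intros. apply loc_lip_plus; [easy|now apply loc_lip_opp]. Qed.

Lemma loc_lip_near f x e : loc_lip f x -> 0 < e ->
  exists eps, 0 < eps /\ forall y, d x y < eps -> Rabs (f y - f x) < e.
Proof.
intros [K [eps [PK [Pe H]]]] He.
exists (Rmin eps (e / (K + 1))). split.
{ apply Rmin_pos; [easy|]. apply Rdiv_lt_0_compat; lra. }
intros y Hy. destruct (H y x) as [_ B].
- apply Rlt_le_trans with (1 := Hy), Rmin_l.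
- now rewrite d_refl.
- apply Rle_lt_trans with (1 := B). rewrite d_sym.
  assert (Hd : d x y < e / (K + 1)) by (apply Rlt_le_trans with (1 := Hy), Rmin_r).
  apply Rle_lt_trans with (K * (e / (K + 1))); [apply Rmult_le_compat_l; lra|].
  apply Rmult_lt_reg_r with (K + 1); [lra|]. field_simplify; lra.
Qed.

Lemma loc_lip_inv f x : loc_lip f x -> f x <> 0 -> loc_lip (fun y => / f y) x.
Proof.
intros Hf Hx. assert (Px := Rabs_pos_lt _ Hx). set (c := Rabs (f x) / 2).
assert (Pc : 0 < c) by (unfold c; lra).
destruct (loc_lip_near f x c Hf Pc) as [eps0 [Pe0 H0]].
assert (low : forall y, d x y < eps0 -> c <= Rabs (f y)).
{ intros y Hy. assert (T := Rabs_triang_inv (f x) (f x - f y)).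
  replace (f x - (f x - f y)) with (f y) in T by ring.
  rewrite (Rabs_minus_sym (f x)) in T. generalize (H0 y Hy). unfold c. lra. }
destruct Hf as [K [eps [PK [Pe H]]]].
(* [/ c] bounds the values and [K / c ^ 2] is the Lipschitz constant; their sum serves for both. *)
exists (/ c + K * / c * / c), (Rmin eps eps0).
assert (Pic : 0 < / c) by now apply Rinv_0_lt_compat.
split; [assert (0 <= K * / c) by nra; nra|]. split; [now apply Rmin_pos|].
intros y z Hy Hz.
assert (Hy0 : d x y < eps0) by (apply Rlt_le_trans with (1 := Hy), Rmin_r).
assert (Hz0 : d x z < eps0) by (apply Rlt_le_trans with (1 := Hz), Rmin_r).
destruct (H y z) as [_ B]; [apply Rlt_le_trans with (2 := Rmin_l _ eps0); easy
  |apply Rlt_le_trans with (2 := Rmin_l _ eps0); easy|].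
assert (L1 := low y Hy0). assert (L2 := low z Hz0).
assert (N1 : f y <> 0) by (intros E; rewrite E, Rabs_R0 in L1; lra).
assert (N2 : f z <> 0) by (intros E; rewrite E, Rabs_R0 in L2; lra).
assert (I1 : Rabs (/ f y) <= / c) by (rewrite Rabs_inv; now apply Rinv_le_contravar).
assert (I2 : Rabs (/ f z) <= / c) by (rewrite Rabs_inv; now apply Rinv_le_contravar).
assert (Q : 0 <= K * / c * / c) by (apply Rmult_le_pos; [apply Rmult_le_pos|]; lra).
split; [lra|].
replace (/ f y - / f z) with (- ((f y - f z) * / f y * / f z)) by (field; easy).
rewrite Rabs_Ropp, !Rabs_mult.
assert (Rabs (f y - f z) * Rabs (/ f y) * Rabs (/ f z) <= K * d y z * / c * / c).
{ apply Rmult_le_compat; try apply Rabs_pos; [|apply Rmult_le_compat| ];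
  auto using Rabs_pos. apply Rmult_le_pos; apply Rabs_pos. }
generalize (d_ge0 y z). intros. assert (0 <= / c * d y z) by nra.
replace ((/ c + K * / c * / c) * d y z) with (/ c * d y z + K * d y z * / c * / c) by ring.
lra.
Qed.

Lemma loc_lip_div f g x : loc_lip f x -> loc_lip g x -> g x <> 0 ->
  loc_lip (fun y => f y / g y) x.
Proof. intros. apply loc_lip_mult; [easy|now apply loc_lip_inv]. Qed.

Lemma loc_lip_sum (f : axis -> X -> R) x : (forall m, loc_lip (f m) x) ->
  loc_lip (fun y => sum_axis (fun m => f m y)) x.
Proof. intros. now apply loc_lip_plus. Qed.

End LocallyLipschitz.

Definition dist1 (x y : R) : R := Rabs (y - x).

Lemma dist1_ge0 x y : 0 <= dist1 x y.
Proof. apply Rabs_pos. Qed.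

Lemma dist1_refl x : dist1 x x = 0.
Proof. unfold dist1, Rminus. now rewrite Rplus_opp_r, Rabs_R0. Qed.

Lemma dist1_sym x y : dist1 x y = dist1 y x.
Proof. apply Rabs_minus_sym. Qed.

Lemma dist2_ge0 x y : 0 <= dist2 x y.
Proof. apply sum_axis_ge0. intros; apply Rabs_pos. Qed.

Lemma dist2_refl x : dist2 x x = 0.
Proof. unfold dist2, sum_axis, Rminus. rewrite !Rplus_opp_r, Rabs_R0. lra. Qed.

Lemma dist2_sym x y : dist2 x y = dist2 y x.
Proof. apply sum_axis_ext. intros. apply Rabs_minus_sym. Qed.

Lemma dist2_triang x y z : dist2 x z <= dist2 x y + dist2 y z.
Proof.
unfold dist2, sum_axis.
assert (H : forall m, Rabs (crd m x - crd m z) <= Rabs (crd m x - crd m y) + Rabs (crd m y - crd m z)).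
{ intros m. replace (crd m x - crd m z) with ((crd m x - crd m y) + (crd m y - crd m z)) by ring.
  apply Rabs_triang. }
generalize (H ax1) (H ax2). lra.
Qed.

Lemma loc_lip_comp (f : R * R -> R) (g : R -> R * R) (t : R) :
  loc_lip dist2 f (g t) -> (forall m, loc_lip dist1 (fun x => crd m (g x)) t) ->
  loc_lip dist1 (fun x => f (g x)) t.
Proof.
intros [K [eps [PK [Pe H]]]] Hg.
assert (G : exists K eps, 0 <= K /\ 0 < eps /\ forall y z, dist1 t y < eps -> dist1 t z < eps ->
  dist2 (g y) (g z) <= K * dist1 y z).
{ destruct (Hg ax1) as [K1 [e1 [P1 [Q1 H1]]]]. destruct (Hg ax2) as [K2 [e2 [P2 [Q2 H2]]]].
  exists (K1 + K2), (Rmin e1 e2). split; [lra|]. split; [now apply Rmin_pos|].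
  intros y z Hy Hz. unfold dist2, sum_axis.
  destruct (H1 y z) as [_ A1]; [apply Rlt_le_trans with (2 := Rmin_l _ e2); easy
    |apply Rlt_le_trans with (2 := Rmin_l _ e2); easy|].
  destruct (H2 y z) as [_ A2]; [apply Rlt_le_trans with (2 := Rmin_r e1 _); easy
    |apply Rlt_le_trans with (2 := Rmin_r e1 _); easy|]. lra. }
destruct G as [K' [eps' [PK' [Pe' G]]]].
set (e := Rmin eps' (eps / (K' + 1))).
assert (Hd : forall y, dist1 t y < e -> dist2 (g t) (g y) < eps).
{ intros y Hy. apply Rle_lt_trans with (K' * dist1 t y).
  - apply G; [now rewrite dist1_refl|apply Rlt_le_trans with (1 := Hy), Rmin_l].
  - assert (Hd : dist1 t y < eps / (K' + 1)) by (apply Rlt_le_trans with (1 := Hy), Rmin_r).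
    apply Rle_lt_trans with (K' * (eps / (K' + 1))); [apply Rmult_le_compat_l; lra|].
    apply Rmult_lt_reg_r with (K' + 1); [lra|]. field_simplify; lra. }
exists (K + K * K'), e. split; [nra|]. split.
{ apply Rmin_pos; [easy|]. apply Rdiv_lt_0_compat; lra. }
intros y z Hy Hz. destruct (H (g y) (g z)) as [A B]; auto.
assert (C : dist2 (g y) (g z) <= K' * dist1 y z).
{ apply G; [apply Rlt_le_trans with (1 := Hy), Rmin_l|apply Rlt_le_trans with (1 := Hz), Rmin_l]. }
split; [nra|]. apply Rle_trans with (1 := B).
apply Rle_trans with (K * (K' * dist1 y z)); [now apply Rmult_le_compat_l|].
generalize (dist1_ge0 y z). nra.
Qed.

Lemma loc_lip_C1 (f f' : R -> R) (t eps : R) : 0 < eps ->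
  (forall x, Rabs (x - t) < eps -> is_derive f x (f' x)) -> continuity_pt f' t ->
  loc_lip dist1 f t.
Proof.
intros Pe Hf Cf. destruct (Cf 1 Rlt_0_1) as [eta [Peta He]].
set (e := Rmin 1 (Rmin eps eta)).
assert (Pe' : 0 < e) by (unfold e; repeat apply Rmin_pos; lra).
assert (E1 : e <= 1) by apply Rmin_l.
assert (E2 : e <= eps) by (apply Rle_trans with (1 := Rmin_r _ _), Rmin_l).
assert (E3 : e <= eta) by (apply Rle_trans with (1 := Rmin_r _ _), Rmin_r).
set (K := Rabs (f' t) + 1).
assert (PK : 0 < K) by (unfold K; generalize (Rabs_pos (f' t)); lra).
assert (B' : forall x, Rabs (x - t) < e -> Rabs (f' x) <= K).
{ intros x Hx. destruct (Req_dec x t) as [->|N]; [unfold K; lra|].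
  assert (H : Rabs (f' x - f' t) < 1).
  { apply (He x). split; [split; [easy|auto]|]. unfold dist; cbn; unfold R_dist. lra. }
  assert (T := Rabs_triang (f' x - f' t) (f' t)).
  replace (f' x - f' t + f' t) with (f' x) in T by ring. unfold K. lra. }
assert (L : forall y z, Rabs (y - t) < e -> Rabs (z - t) < e -> Rabs (f y - f z) <= K * dist1 y z).
{ intros y z Hy Hz. rewrite dist1_sym. apply Rabs_def2 in Hy. apply Rabs_def2 in Hz.
  apply mean_value_abs_le with f'; intros x Hx;
  (assert (Hxt : Rabs (x - t) < e);
  [apply Rabs_def1; revert Hx; unfold Rmin, Rmax; destruct Rle_dec; lra|]).
  - apply Hf. lra.
  - now apply B'. }
exists (K + Rabs (f t)), e. split; [generalize (Rabs_pos (f t)); lra|].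
split; [easy|].
intros y z Hy Hz. unfold dist1 in Hy, Hz. split.
- assert (A := L y t Hy). rewrite dist1_sym in A.
  assert (A' : Rabs (f y - f t) <= K * dist1 t y).
  { apply A. unfold Rminus. rewrite Rplus_opp_r, Rabs_R0. lra. }
  assert (T := Rabs_triang (f y - f t) (f t)).
  replace (f y - f t + f t) with (f y) in T by ring.
  assert (K * dist1 t y <= K * 1); [apply Rmult_le_compat_l; unfold dist1; lra|]. lra.
- apply Rle_trans with (1 := L y z Hy Hz).
  apply Rmult_le_compat_r; [apply dist1_ge0|]. generalize (Rabs_pos (f t)); intros; lra.
Qed.

Lemma loc_lip_C1_2d (f : R * R -> R) (x : R * R) (eps : R) : 0 < eps ->
  (forall y, dist2 x y < eps -> smooth_at 1 f y) -> loc_lip dist2 f x.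
Proof.
intros Pe Hf.
assert (Hx : smooth_at 1 f x) by (apply Hf; now rewrite dist2_refl).
destruct Hx as [_ [_ [_ [[C1 _] [C2 _]]]]].
destruct (C1 (mkposreal 1 Rlt_0_1)) as [e1 H1]. destruct (C2 (mkposreal 1 Rlt_0_1)) as [e2 H2].
destruct x as [a b]; cbn [fst snd] in *.
set (e := Rmin 1 (Rmin eps (Rmin e1 e2))).
assert (E0 : e <= 1) by apply Rmin_l.
assert (E1 : e <= eps) by (apply Rle_trans with (1 := Rmin_r _ _), Rmin_l).
assert (E2 : e <= e1).
{ apply Rle_trans with (1 := Rmin_r _ _). apply Rle_trans with (1 := Rmin_r _ _), Rmin_l. }
assert (E3 : e <= e2).
{ apply Rle_trans with (1 := Rmin_r _ _). apply Rle_trans with (1 := Rmin_r _ _), Rmin_r. }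
assert (Pe' : 0 < e).
{ unfold e. repeat apply Rmin_pos; try lra; [apply (cond_pos e1)|apply (cond_pos e2)]. }
set (K := Rabs (pd ax1 f (a, b)) + Rabs (pd ax2 f (a, b)) + 1).
assert (PK : 0 < K).
{ unfold K. generalize (Rabs_pos (pd ax1 f (a, b))) (Rabs_pos (pd ax2 f (a, b))). lra. }
assert (near : forall p q, dist2 (a, b) (p, q) < e -> Rabs (p - a) < e /\ Rabs (q - b) < e).
{ intros p q. unfold dist2, sum_axis; cbn. rewrite (Rabs_minus_sym a), (Rabs_minus_sym b).
  generalize (Rabs_pos (p - a)) (Rabs_pos (q - b)). lra. }
assert (B1 : forall p q, dist2 (a, b) (p, q) < e -> Rabs (pd ax1 f (p, q)) <= K).
{ intros p q H. destruct (near p q H) as [Hp Hq].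
  assert (A : Rabs (pd ax1 f (p, q) - pd ax1 f (a, b)) < 1) by (apply (H1 p q); lra).
  assert (T := Rabs_triang (pd ax1 f (p, q) - pd ax1 f (a, b)) (pd ax1 f (a, b))).
  replace (pd ax1 f (p, q) - pd ax1 f (a, b) + pd ax1 f (a, b)) with (pd ax1 f (p, q)) in T by ring.
  unfold K. generalize (Rabs_pos (pd ax2 f (a, b))). lra. }
assert (B2 : forall p q, dist2 (a, b) (p, q) < e -> Rabs (pd ax2 f (p, q)) <= K).
{ intros p q H. destruct (near p q H) as [Hp Hq].
  assert (A : Rabs (pd ax2 f (p, q) - pd ax2 f (a, b)) < 1) by (apply (H2 p q); lra).
  assert (T := Rabs_triang (pd ax2 f (p, q) - pd ax2 f (a, b)) (pd ax2 f (a, b))).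
  replace (pd ax2 f (p, q) - pd ax2 f (a, b) + pd ax2 f (a, b)) with (pd ax2 f (p, q)) in T by ring.
  unfold K. generalize (Rabs_pos (pd ax1 f (a, b))). lra. }
(* the broken segment through (p', q) stays in a ball for [dist2] of twice the radius *)
assert (L : forall y z, dist2 (a, b) y < e / 2 -> dist2 (a, b) z < e / 2 ->
  Rabs (f y - f z) <= K * dist2 y z).
{ intros [p q] [p' q'] Hy Hz. rewrite dist2_sym.
  assert (In : forall s t, Rmin p' p <= s <= Rmax p' p -> Rmin q' q <= t <= Rmax q' q ->
    dist2 (a, b) (s, t) < e).
  { intros s t Hs Ht. revert Hy Hz. unfold dist2, sum_axis; cbn.
    assert (Gs : Rabs (a - s) <= Rabs (a - p) \/ Rabs (a - s) <= Rabs (a - p')).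
    { revert Hs. unfold Rmin, Rmax, Rabs.
      destruct Rle_dec; repeat destruct Rcase_abs; intros;
        ((left; lra) || (right; lra)). }
    assert (Gt : Rabs (b - t) <= Rabs (b - q) \/ Rabs (b - t) <= Rabs (b - q')).
    { revert Ht. unfold Rmin, Rmax, Rabs.
      destruct Rle_dec; repeat destruct Rcase_abs; intros;
        ((left; lra) || (right; lra)). }
    generalize (Rabs_pos (a - p)) (Rabs_pos (a - p')) (Rabs_pos (b - q)) (Rabs_pos (b - q')).
    destruct Gs, Gt; lra. }
  replace (f (p, q) - f (p', q')) with ((f (p, q) - f (p', q)) + (f (p', q) - f (p', q'))) by ring.
  apply Rle_trans with (1 := Rabs_triang _ _).
  assert (A1 : Rabs (f (p, q) - f (p', q)) <= K * Rabs (p - p')).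
  { apply (mean_value_abs_le (fun s => f (s, q)) (fun s => pd ax1 f (s, q))); intros s Hs.
    - apply Derive_correct.
      assert (S : smooth_at 1 f (s, q)).
      { apply Hf. apply Rlt_le_trans with e; [|easy]. apply In; [easy|].
        split; [apply Rmin_r|apply Rmax_r]. }
      apply S.
    - apply B1, In; [easy|]. split; [apply Rmin_r|apply Rmax_r]. }
  assert (A2 : Rabs (f (p', q) - f (p', q')) <= K * Rabs (q - q')).
  { apply (mean_value_abs_le (fun s => f (p', s)) (fun s => pd ax2 f (p', s))); intros s Hs.
    - apply Derive_correct.
      assert (S : smooth_at 1 f (p', s)).
      { apply Hf. apply Rlt_le_trans with e; [|easy]. apply In; [|easy].
        split; [apply Rmin_l|apply Rmax_l]. }
      apply S.
    - apply B2, In; [|easy]. split; [apply Rmin_l|apply Rmax_l]. }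
  rewrite dist2_sym. unfold dist2, sum_axis; cbn. lra. }
exists (K + Rabs (f (a, b))), (e / 2).
split; [generalize (Rabs_pos (f (a, b))); lra|]. split; [lra|].
intros y z Hy Hz. split.
- assert (A := L y (a, b) Hy). rewrite dist2_refl, (dist2_sym y) in A.
  assert (T := Rabs_triang (f y - f (a, b)) (f (a, b))).
  replace (f y - f (a, b) + f (a, b)) with (f y) in T by ring.
  assert (K * dist2 (a, b) y <= K * 1); [apply Rmult_le_compat_l; lra|].
  assert (Rabs (f y - f (a, b)) <= K * dist2 (a, b) y) by (apply A; lra). lra.
- apply Rle_trans with (1 := L y z Hy Hz).
  apply Rmult_le_compat_r; [apply dist2_ge0|]. generalize (Rabs_pos (f (a, b))); lra.
Qed.

(** One number [M] stands for the bound, the Lipschitz constant and, through [/ M], the radius of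
    the balls around the path: each requirement gets weaker as [M] grows, as [compact_uniform]
    demands. *)
Lemma loc_lip_uniform (f : R * R -> R) (g : R -> R * R) (a b : R) :
  (forall t, a <= t <= b -> loc_lip dist2 f (g t)) ->
  (forall t m, a <= t <= b -> loc_lip dist1 (fun x => crd m (g x)) t) ->
  exists M, forall t, a <= t <= b -> 0 < M /\
    forall y z, dist2 (g t) y < / M -> dist2 (g t) z < / M ->
      Rabs (f y) <= M /\ Rabs (f y - f z) <= M * dist2 y z.
Proof.
intros Hf Hg.
apply (compact_uniform (fun t M => 0 < M /\
    forall y z, dist2 (g t) y < / M -> dist2 (g t) z < / M ->
      Rabs (f y) <= M /\ Rabs (f y - f z) <= M * dist2 y z)).
- intros t M M' [PM H] HM. split; [lra|]. intros y z Hy Hz.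
  assert (HI : / M' <= / M) by (apply Rinv_le_contravar; lra).
  destruct (H y z) as [A B]; [lra|lra|]. split; [lra|].
  apply Rle_trans with (1 := B). apply Rmult_le_compat_r; [apply dist2_ge0|easy].
- intros t Ht. destruct (Hf t Ht) as [K [eps [PK [Pe H]]]].
  assert (G : exists eta, 0 < eta /\ forall t', dist1 t t' < eta -> dist2 (g t) (g t') < eps / 2).
  { destruct (loc_lip_near dist1 dist1_refl dist1_sym _ _ (eps / 4) (Hg t ax1 Ht)) as [e1 [P1 H1]]; [lra|].
    destruct (loc_lip_near dist1 dist1_refl dist1_sym _ _ (eps / 4) (Hg t ax2 Ht)) as [e2 [P2 H2]]; [lra|].
    exists (Rmin e1 e2). split; [now apply Rmin_pos|]. intros t' Ht'.
    rewrite dist2_sym. unfold dist2, sum_axis.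
    assert (A1 := H1 t' (Rlt_le_trans _ _ _ Ht' (Rmin_l _ _))).
    assert (A2 := H2 t' (Rlt_le_trans _ _ _ Ht' (Rmin_r _ _))). lra. }
  destruct G as [eta [Peta G]].
  (* The summand [2 / eps] brings the radius [/ M] below [eps / 2]; the other half of [eps] is for
     the displacement from [g t] to [g t']. *)
  exists (K + 2 / eps), eta. split; [easy|]. intros t' Ht' Htt'.
  assert (Pe2 : 0 < 2 / eps) by (apply Rdiv_lt_0_compat; lra).
  split; [lra|]. intros y z Hy Hz.
  assert (HI : / (K + 2 / eps) <= eps / 2).
  { replace (eps / 2) with (/ (2 / eps)) by (field; lra). apply Rinv_le_contravar; lra. }
  assert (Hg' := G t' Htt').
  destruct (H y z) as [A B].
  + apply Rle_lt_trans with (1 := dist2_triang _ (g t') _). lra.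
  + apply Rle_lt_trans with (1 := dist2_triang _ (g t') _). lra.
  + split; [lra|]. apply Rle_trans with (1 := B).
    apply Rmult_le_compat_r; [apply dist2_ge0|lra].
Qed.

Lemma loc_lip_uniform_1d (f : R -> R) (a b : R) :
  (forall t, a <= t <= b -> loc_lip dist1 f t) ->
  exists M, 0 < M /\ forall t t', a <= t <= b -> a <= t' <= b ->
    Rabs (f t) <= M /\ Rabs (f t - f t') <= M * Rabs (t - t').
Proof.
intros Hf.
destruct (compact_uniform (fun t M => 0 < M /\
    forall y z, Rabs (y - t) < / M -> Rabs (z - t) < / M ->
      Rabs (f y) <= M /\ Rabs (f y - f z) <= M * Rabs (y - z)) a b) as [M HM].
- intros t M M' [PM H] HM. split; [lra|]. intros y z Hy Hz.
  assert (HI : / M' <= / M) by (apply Rinv_le_contravar; lra).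
  destruct (H y z) as [A B]; [lra|lra|]. split; [lra|].
  apply Rle_trans with (1 := B). apply Rmult_le_compat_r; [apply Rabs_pos|easy].
- intros t Ht. destruct (Hf t Ht) as [K [eps [PK [Pe H]]]].
  exists (K + 2 / eps), (eps / 2). split; [lra|]. intros t' Ht' Htt'.
  assert (Pe2 : 0 < 2 / eps) by (apply Rdiv_lt_0_compat; lra).
  split; [lra|]. intros y z Hy Hz.
  assert (HI : / (K + 2 / eps) <= eps / 2).
  { replace (eps / 2) with (/ (2 / eps)) by (field; lra). apply Rinv_le_contravar; lra. }
  apply Rabs_def2 in Htt'. apply Rabs_def2 in Hy. apply Rabs_def2 in Hz.
  destruct (H y z) as [A B]; [unfold dist1; apply Rabs_def1; lra..|].
  split; [lra|]. apply Rle_trans with (1 := B). rewrite dist1_sym.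
  apply Rmult_le_compat_r; [apply Rabs_pos|lra].
(* Points at distance at least [/ M] fall outside the local estimate, but there the variation is at
   most [2 * M <= 2 * M * M * Rabs (t - t')]. On an empty interval the sign of [M] is unknown,
   whence [Rabs M] and the 1. *)
- exists (Rabs M + 2 * M * M + 1).
  assert (PM2 : 0 <= 2 * M * M) by nra.
  split; [generalize (Rabs_pos M); lra|]. intros t t' Ht Ht'.
  destruct (HM t Ht) as [PM H]. destruct (HM t' Ht') as [_ H'].
  assert (PIM : 0 < / M) by now apply Rinv_0_lt_compat.
  assert (R0 : forall x, Rabs (x - x) < / M) by (intros; unfold Rminus; now rewrite Rplus_opp_r, Rabs_R0).
  destruct (H t t) as [A _]; [easy|easy|]. destruct (H' t' t') as [A' _]; [easy|easy|].
  rewrite (Rabs_pos_eq M) by lra. split; [lra|].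
  assert (Pt := Rabs_pos (t - t')).
  destruct (Rlt_or_le (Rabs (t' - t)) (/ M)) as [L|L].
  + destruct (H t t' (R0 t) L) as [_ B]. nra.
  + rewrite Rabs_minus_sym in L.
    assert (1 <= M * Rabs (t - t')).
    { replace 1 with (M * / M) by (field; lra). apply Rmult_le_compat_l; lra. }
    apply Rle_trans with (2 * M).
    * apply Rle_trans with (1 := Rabs_triang _ _). rewrite Rabs_Ropp. lra.
    * nra.
Qed.

(** * The metric and the connection in a chart *)

(** [smooth_at] speaks of partial derivatives, whereas the chain rule along a curve takes a total
    differential. *)
Lemma smooth_differentiable (f : R * R -> R) (x : R * R) (eps : R) : 0 < eps ->
  (forall y, dist2 x y < eps -> smooth_at 1 f y) ->
  differentiable_pt_lim (fun p q => f (p, q)) (fst x) (snd x) (pd ax1 f x) (pd ax2 f x).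
Proof.
intros Pe Hf. destruct x as [a b]. apply filterdiff_differentiable_pt_lim.
assert (S0 : smooth_at 1 f (a, b)) by (apply Hf; now rewrite dist2_refl).
eapply filterdiff_ext_lin.
- apply (is_derive_filterdiff (fun p q => f (p, q)) a b (fun p q => pd ax1 f (p, q)) (pd ax2 f (a, b))).
  + exists (mkposreal (eps / 2) (Rdiv_lt_0_compat _ _ Pe Rlt_0_2)). intros [p q] [Hp Hq].
    apply Derive_correct. apply Hf.
    change (Rabs (p - a) < eps / 2) in Hp. change (Rabs (q - b) < eps / 2) in Hq.
    unfold dist2, sum_axis; cbn. rewrite (Rabs_minus_sym a), (Rabs_minus_sym b). lra.
  + apply Derive_correct. apply S0.
  + destruct S0 as [_ [_ [_ [[C1 _] _]]]]. apply continuity_2d_pt_filterlim in C1. exact C1.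
- intros [p q]. reflexivity.
Qed.

Lemma is_derive_comp_2d (f : R * R -> R) (Z : R -> R * R) (t : R) (V : axis -> R) (eps : R) :
  0 < eps -> (forall y, dist2 (Z t) y < eps -> smooth_at 1 f y) ->
  (forall m, is_derive (fun s => crd m (Z s)) t (V m)) ->
  is_derive (fun s => f (Z s)) t (sum_axis (fun m => pd m f (Z t) * V m)).
Proof.
intros Pe Hf HV.
apply is_derive_ext with (fun s => f (crd ax1 (Z s), crd ax2 (Z s))).
  intros s. now rewrite (surjective_pairing (Z s)) at 3.
apply is_derive_Reals.
apply (derivable_pt_lim_comp_2d (fun p q => f (p, q))).
- apply (smooth_differentiable f (Z t) eps Pe Hf).
- apply is_derive_Reals, (HV ax1).
- apply is_derive_Reals, (HV ax2).
Qed.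

Section Chart.
Context {S : riemannian_surface} (k : chart S).

(** The image of the chart, written as its overlap with itself so that [overlap_open] shows it to be
    open. *)
Definition img (z : R * R) : Prop := overlap S k k z.

Lemma img_coord P : dom k P -> img (coord k P).
Proof. intros H. now exists P. Qed.

Lemma img_open z : img z -> exists eps, 0 < eps /\ forall y, dist2 z y < eps -> img y.
Proof.
intros Hz. destruct (overlap_open S k k z Hz) as [eps H]. exists eps.
split; [apply cond_pos|]. intros y Hy. apply H.
unfold dist2, sum_axis in Hy. destruct z as [a b], y as [p q]; cbn in Hy.
generalize (Rabs_pos (a - p)) (Rabs_pos (b - q)). intros.
split; [change (Rabs (p - a) < eps)|change (Rabs (q - b) < eps)];
  rewrite Rabs_minus_sym; lra.
Qed.

Lemma metric_smooth_img z m n : img z -> smooth_at 3 (metric k m n) z.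
Proof. intros [P [HP [_ <-]]]. now apply metric_smooth. Qed.

Lemma metric_sym_img z m n : img z -> metric k m n z = metric k n m z.
Proof. intros [P [HP [_ <-]]]. now apply metric_sym. Qed.

Lemma inner_pos z v : img z -> (exists m, v m <> 0) -> 0 < inner k z v v.
Proof. intros [P [HP [_ <-]]]. now apply metric_pos. Qed.

Lemma inner_ge0 z v : img z -> 0 <= inner k z v v.
Proof.
intros Hz. destruct (Req_dec (v ax1) 0) as [E1|N1].
- destruct (Req_dec (v ax2) 0) as [E2|N2].
  + unfold inner, sum_axis. rewrite E1, E2. lra.
  + left. apply inner_pos; [easy|]. now exists ax2.
- left. apply inner_pos; [easy|]. now exists ax1.
Qed.

Lemma pd_smooth z m f n : smooth_at (Datatypes.S n) f z -> smooth_at n (pd m f) z.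
Proof. intros [_ [_ [_ [H1 H2]]]]. destruct m; [exact H1|exact H2]. Qed.

Lemma smooth_weaken n n' f z : (n' <= n)%nat -> smooth_at n f z -> smooth_at n' f z.
Proof. intros. now apply ex_diff_n_m with n. Qed.

Lemma metric_loc_lip z m n : img z -> loc_lip dist2 (metric k m n) z.
Proof.
intros Hz. destruct (img_open z Hz) as [eps [Pe H]].
apply loc_lip_C1_2d with eps; [easy|]. intros y Hy.
apply (smooth_weaken 3); [lia|]. now apply metric_smooth_img, H.
Qed.

Lemma pd_metric_loc_lip z q m n : img z -> loc_lip dist2 (pd q (metric k m n)) z.
Proof.
intros Hz. destruct (img_open z Hz) as [eps [Pe H]].
apply loc_lip_C1_2d with eps; [easy|]. intros y Hy. apply pd_smooth.
apply (smooth_weaken 3); [lia|]. now apply metric_smooth_img, H.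
Qed.

Lemma metric22_pos z : img z -> 0 < metric k ax2 ax2 z.
Proof.
intros Hz. assert (H := inner_pos z (fun m => match m with ax1 => 0 | ax2 => 1 end) Hz).
refine (Rlt_le_trans _ _ _ (H _) (Req_le _ _ _)); [exists ax2; lra|].
unfold inner, sum_axis. ring.
Qed.

Lemma metric11_pos z : img z -> 0 < metric k ax1 ax1 z.
Proof.
intros Hz. assert (H := inner_pos z (fun m => match m with ax1 => 1 | ax2 => 0 end) Hz).
refine (Rlt_le_trans _ _ _ (H _) (Req_le _ _ _)); [exists ax1; lra|].
unfold inner, sum_axis. ring.
Qed.

Lemma det_pos z : img z -> 0 < det_metric k z.
Proof.
intros Hz. assert (P22 := metric22_pos z Hz).
(* The vector [(g22, - g12)] has squared norm [g22 * det]. *)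
assert (H := inner_pos z (fun m => match m with ax1 => metric k ax2 ax2 z
  | ax2 => - metric k ax1 ax2 z end) Hz).
unfold inner, sum_axis in H. rewrite (metric_sym_img z ax2 ax1) in H by easy.
unfold det_metric. rewrite (metric_sym_img z ax2 ax1) by easy.
apply Rmult_lt_reg_l with (metric k ax2 ax2 z); [easy|].
rewrite Rmult_0_r.
refine (Rlt_le_trans _ _ _ (H _) (Req_le _ _ _)); [exists ax1; lra|ring].
Qed.

(* Completing the square: [det * v_m ^ 2 <= g_nn * <v, v>]. *)
Lemma unit_vector_bound z v m : img z -> inner k z v v = 1 ->
  v m ^ 2 <= metric k (other m) (other m) z / det_metric k z.
Proof.
intros Hz H. assert (Pd := det_pos z Hz).
assert (P22 := metric22_pos z Hz). assert (P11 := metric11_pos z Hz).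
apply Rmult_le_reg_r with (det_metric k z); [easy|].
unfold Rdiv. rewrite Rmult_assoc, Rinv_l, Rmult_1_r by lra.
revert H. unfold inner, sum_axis, det_metric. rewrite (metric_sym_img z ax2 ax1) by easy.
intros H.
assert (E : forall P Q R, 0 <= Q ^ 2 -> P + Q ^ 2 = R * 1 -> P <= R) by (intros; lra).
destruct m; cbn [other].
- apply (E _ (metric k ax1 ax2 z * v ax1 + metric k ax2 ax2 z * v ax2));
    [apply pow2_ge_0|rewrite <- H; ring].
- apply (E _ (metric k ax1 ax1 z * v ax1 + metric k ax1 ax2 z * v ax2));
    [apply pow2_ge_0|rewrite <- H; ring].
Qed.

Lemma det_loc_lip z : img z -> loc_lip dist2 (det_metric k) z.
Proof.
intros Hz. apply (loc_lip_minus dist2 dist2_ge0);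
  apply (loc_lip_mult dist2 dist2_ge0); now apply metric_loc_lip.
Qed.

Lemma metric_det_loc_lip z m n : img z ->
  loc_lip dist2 (fun y => metric k m n y / det_metric k y) z.
Proof.
intros Hz. apply (loc_lip_div dist2 dist2_ge0 dist2_refl dist2_sym).
- now apply metric_loc_lip.
- now apply det_loc_lip.
- generalize (det_pos z Hz). lra.
Qed.

Lemma inv_metric_loc_lip z m n : img z -> loc_lip dist2 (inv_metric k m n) z.
Proof.
intros Hz.
destruct m, n; unfold inv_metric; cbn [other]; try now apply metric_det_loc_lip.
- apply loc_lip_ext with (fun y => - (metric k ax1 ax2 y / det_metric k y)).
    intros y. unfold Rdiv. ring.
  apply (loc_lip_opp dist2 dist2_ge0). now apply metric_det_loc_lip.
- apply loc_lip_ext with (fun y => - (metric k ax2 ax1 y / det_metric k y)).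
    intros y. unfold Rdiv. ring.
  apply (loc_lip_opp dist2 dist2_ge0). now apply metric_det_loc_lip.
Qed.

Lemma christoffel_loc_lip z l m n : img z -> loc_lip dist2 (christoffel k l m n) z.
Proof.
intros Hz. apply (loc_lip_sum dist2). intros q.
apply (loc_lip_mult dist2 dist2_ge0).
- apply (loc_lip_mult dist2 dist2_ge0); [now apply inv_metric_loc_lip|].
  apply (loc_lip_const dist2 dist2_ge0).
- apply (loc_lip_minus dist2 dist2_ge0); [apply (loc_lip_plus dist2)|];
    now apply pd_metric_loc_lip.
Qed.

Lemma pd_metric_sym z q m n : img z -> pd q (metric k m n) z = pd q (metric k n m) z.
Proof.
intros Hz. destruct (img_open z Hz) as [eps [Pe H]]. destruct z as [a b].
assert (R0 : forall x, Rabs (x - x) = 0) by (intros; unfold Rminus; now rewrite Rplus_opp_r, Rabs_R0).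
destruct q; cbn [pd fst snd]; apply Derive_ext_loc; exists (mkposreal eps Pe);
  intros y Hy; apply metric_sym_img, H; unfold dist2, sum_axis; cbn; rewrite R0.
- change (Rabs (y - a) < eps) in Hy. rewrite Rabs_minus_sym in Hy. lra.
- change (Rabs (y - b) < eps) in Hy. rewrite Rabs_minus_sym in Hy. lra.
Qed.

Lemma christoffel_sym z l m n : img z -> christoffel k l m n z = christoffel k l n m z.
Proof.
intros Hz. unfold christoffel. apply sum_axis_ext. intros q.
rewrite (pd_metric_sym z q m n) by easy. ring.
Qed.

(** The Levi-Civita connection preserves the metric: lowering the upper index in [christoffel]
    cancels [inv_metric], and the remaining derivatives of the metric combine. *)
Lemma metric_compatible z q m n : img z ->
  pd q (metric k m n) z = sum_axis (fun l =>
    metric k n l z * christoffel k l q m z + metric k m l z * christoffel k l q n z).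
Proof.
intros Hz. assert (Pd := det_pos z Hz). revert Pd.
unfold christoffel, sum_axis, inv_metric, det_metric; cbn [other].
rewrite (metric_sym_img z ax2 ax1) by easy. intros Pd.
destruct q, m, n; rewrite ?(pd_metric_sym z ax1 ax2 ax1), ?(pd_metric_sym z ax2 ax2 ax1),
  ?(metric_sym_img z ax2 ax1) by easy; field; lra.
Qed.

End Chart.

(** * The string length of a small arc *)

Record geodesic_on (Gam : axis -> axis -> axis -> R * R -> R) (box : R * R -> Prop)
    (M del : R) (Z : R -> R * R) (V : axis -> R -> R) : Prop := {
  geod_box : forall w, Rabs w < del -> box (Z w);
  geod_pos : forall m w, Rabs w < del -> is_derive (fun x => crd m (Z x)) w (V m w);
  geod_vel : forall m w, Rabs w < del ->
    is_derive (V m) w (- quad Gam (Z w) (fun p => V p w) (fun q => V q w) m);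
  geod_bd : forall m w, Rabs w < del -> Rabs (V m w) <= M
}.

(* The arc of [Zg] between the parameters [ds] and [dt], the geodesics [Za], [Zb] tangent to it
   at its end points, and the parameters [u], [v] at which they meet. *)
Record string_data : Type := {
  ds : R; dt : R; del : R; u : R; v : R;
  Zg : R -> R * R; Tg : axis -> R -> R; Wg : axis -> R -> R;
  rho : R -> R; ell : R -> R; gg : axis -> axis -> R -> R;
  Za : R -> R * R; Va : axis -> R -> R;
  Zb : R -> R * R; Vb : axis -> R -> R;
  box : R * R -> Prop
}.

Definition lam (i : string_data) : R := ell i (dt i).
Definition x0 (i : string_data) : R * R := Zg i (ds i).
Definition tau (i : string_data) (m : axis) : R := Tg i m (ds i).
Definition W0 (i : string_data) (m : axis) : R := Wg i m (ds i).
Definition g0 (i : string_data) (m n : axis) : R := gg i m n (ds i).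

Definition form (g : axis -> axis -> R) (a b : axis -> R) : R :=
  sum_axis (fun m => sum_axis (fun n => g m n * a m * b n)).

(** The squared geodesic curvature at the first end point, since [W0] is the covariant acceleration
    with respect to arc length. *)
Definition kap2 (i : string_data) : R := form (g0 i) (W0 i) (W0 i).

(** All that the expansion uses of a configuration. The metric enters only through its values along
    the arc, with metric compatibility as [c_g_der]; [c_curv] keeps the curvature away from 0. An
    estimate over all configurations with given [Gam] and [M] is uniform in the end points of the
    arc. *)
Record string_config (Gam : axis -> axis -> axis -> R * R -> R) (M : R)
    (i : string_data) : Prop := {
  c_M : 0 < M;
  c_st : ds i <= dt i;
  c_lam : 0 < lam i < del i;
  c_del : del i <= 1;
  c_u : Rabs (u i) < del i;
  c_v : Rabs (v i) < del i;
  c_Gam_bd : forall z l p q, box i z -> Rabs (Gam l p q z) <= M;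
  c_Gam_lip : forall z z' l p q, box i z -> box i z' ->
    Rabs (Gam l p q z - Gam l p q z') <= M * dist2 z z';
  c_Gam_sym : forall z l p q, box i z -> Gam l p q z = Gam l q p z;
  c_gamma : curve_on Gam (ds i) (dt i) (Zg i) (Tg i) (Wg i) (rho i) (ell i);
  c_gamma_box : forall w, ds i <= w <= dt i -> box i (Zg i w);
  c_T_bd : forall m w, ds i <= w <= dt i -> Rabs (Tg i m w) <= M;
  c_W_bd : forall m w, ds i <= w <= dt i -> Rabs (Wg i m w) <= M;
  c_W_lip : forall m w, ds i <= w <= dt i ->
    Rabs (Wg i m w - Wg i m (ds i)) <= M * ell i w;
  c_A : geodesic_on Gam (box i) M (del i) (Za i) (Va i);
  c_B : geodesic_on Gam (box i) M (del i) (Zb i) (Vb i);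
  c_A0 : Za i 0 = Zg i (ds i);
  c_VA0 : forall m, Va i m 0 = Tg i m (ds i);
  c_B0 : Zb i 0 = Zg i (dt i);
  c_VB0 : forall m, Vb i m 0 = Tg i m (dt i);
  c_meet : Za i (u i) = Zb i (v i);
  c_g_bd : forall m n w, ds i <= w <= dt i -> Rabs (gg i m n w) <= M;
  c_g_sym : forall m n w, ds i <= w <= dt i -> gg i m n w = gg i n m w;
  c_g_der : forall m n w, ds i <= w <= dt i ->
    is_derive (gg i m n) w (rho i w * sum_axis (fun l => sum_axis (fun k =>
      (gg i n l w * Gam l k m (Zg i w) + gg i m l w * Gam l k n (Zg i w)) * Tg i k w)));
  c_unit : form (g0 i) (tau i) (tau i) = 1;
  c_orth : forall w, ds i <= w <= dt i ->
    form (fun m n => gg i m n w) (fun m => Tg i m w) (fun n => Wg i n w) = 0;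
  c_curv : / M <= kap2 i
}.

Section Core.
Variables (Gam : axis -> axis -> axis -> R * R -> R) (M : R) (D : string_data -> Prop).
Hypothesis HD : forall i, D i -> string_config Gam M i.

Lemma Gam_bd_D i z l p q : D i -> box i z -> Rabs (Gam l p q z) <= M.
Proof. intros Hi. apply (c_Gam_bd _ _ _ (HD i Hi)). Qed.

Lemma Gam_lip_D i z z' l p q : D i -> box i z -> box i z' ->
  Rabs (Gam l p q z - Gam l p q z') <= M * dist2 z z'.
Proof. intros Hi. apply (c_Gam_lip _ _ _ (HD i Hi)). Qed.

Definition DG := seg D ds dt.
Definition DA := seg D (fun _ => 0) lam.

Lemma bigO_1_of_bound {J} (D' : J -> Prop) (f : J -> R) :
  (forall j, D' j -> Rabs (f j) <= M) -> bigO D' f (fun _ => 1).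
Proof. intros H. apply bigO_bound with M; intros; [rewrite Rmult_1_r; auto|lra]. Qed.

Lemma DG_ell j : DG j -> 0 <= ell (fst j) (snd j) <= lam (fst j).
Proof.
destruct j as [i w]; intros [Hi Hw]; cbn in *.
assert (H := c_gamma _ _ _ (HD i Hi)).
split; [rewrite <- (curve_ell0 _ _ _ _ _ _ _ _ H)|];
  apply (curve_ell_le _ _ _ _ _ _ _ _ _ _ H); lra.
Qed.

Lemma DG_lo i : D i -> DG (i, ds i).
Proof.
intros Hi. split; [easy|]. cbn. generalize (c_st _ _ _ (HD i Hi)). lra.
Qed.

Lemma DG_hi i : D i -> DG (i, dt i).
Proof.
intros Hi. split; [easy|]. cbn. generalize (c_st _ _ _ (HD i Hi)). lra.
Qed.

Lemma DG_DA j : DG j -> DA (fst j, ell (fst j) (snd j)).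
Proof. intros Hj. exact (conj (proj1 Hj) (DG_ell j Hj)). Qed.

Lemma DA_del j : DA j -> Rabs (snd j) < del (fst j).
Proof.
destruct j as [i w]; intros [Hi Hw]; cbn in *.
generalize (c_lam _ _ _ (HD i Hi)). rewrite Rabs_pos_eq; lra.
Qed.

Lemma DA_hi i : D i -> DA (i, lam i).
Proof.
intros Hi. split; [easy|]. cbn. generalize (c_lam _ _ _ (HD i Hi)). lra.
Qed.

Lemma lam_bounds i : D i -> 0 < lam i <= 1.
Proof. intros Hi. generalize (c_lam _ _ _ (HD i Hi)) (c_del _ _ _ (HD i Hi)). lra. Qed.

Lemma box_g : in_box D box DG fst (fun j => Zg (fst j) (snd j)).
Proof.
intros [i w] [Hi Hw]; cbn in *. split; [easy|].
now apply (c_gamma_box _ _ _ (HD i Hi)).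
Qed.

Lemma box_0 {J} (D' : J -> Prop) (pr : J -> string_data) :
  (forall j, D' j -> D (pr j)) -> in_box D box D' pr (fun j => x0 (pr j)).
Proof.
intros H j Hj. split; [auto|]. apply (c_gamma_box _ _ _ (HD _ (H j Hj))).
generalize (c_st _ _ _ (HD _ (H j Hj))). lra.
Qed.

Lemma box_a {J} (D' : J -> Prop) (pr : J -> string_data) (w : J -> R) :
  (forall j, D' j -> D (pr j)) -> (forall j, D' j -> Rabs (w j) < del (pr j)) ->
  in_box D box D' pr (fun j => Za (pr j) (w j)).
Proof.
intros H Hw j Hj. split; [auto|]. apply (geod_box _ _ _ _ _ _ (c_A _ _ _ (HD _ (H j Hj)))).
auto.
Qed.

Lemma box_b {J} (D' : J -> Prop) (pr : J -> string_data) (w : J -> R) :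
  (forall j, D' j -> D (pr j)) -> (forall j, D' j -> Rabs (w j) < del (pr j)) ->
  in_box D box D' pr (fun j => Zb (pr j) (w j)).
Proof.
intros H Hw j Hj. split; [auto|]. apply (geod_box _ _ _ _ _ _ (c_B _ _ _ (HD _ (H j Hj)))).
auto.
Qed.

Lemma Va_bd {J} (D' : J -> Prop) (pr : J -> string_data) (w : J -> R) p :
  (forall j, D' j -> D (pr j)) -> (forall j, D' j -> Rabs (w j) < del (pr j)) ->
  bigO D' (fun j => Va (pr j) p (w j)) (fun _ => 1).
Proof.
intros H Hw. apply bigO_1_of_bound. intros j Hj.
apply (geod_bd _ _ _ _ _ _ (c_A _ _ _ (HD _ (H j Hj)))). auto.
Qed.

Lemma Vb_bd {J} (D' : J -> Prop) (pr : J -> string_data) (w : J -> R) p :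
  (forall j, D' j -> D (pr j)) -> (forall j, D' j -> Rabs (w j) < del (pr j)) ->
  bigO D' (fun j => Vb (pr j) p (w j)) (fun _ => 1).
Proof.
intros H Hw. apply bigO_1_of_bound. intros j Hj.
apply (geod_bd _ _ _ _ _ _ (c_B _ _ _ (HD _ (H j Hj)))). auto.
Qed.

Lemma Tg_bd m : bigO DG (fun j => Tg (fst j) m (snd j)) (fun _ => 1).
Proof.
apply bigO_1_of_bound. intros [i w] [Hi Hw]. now apply (c_T_bd _ _ _ (HD i Hi)).
Qed.

Lemma Wg_bd m : bigO DG (fun j => Wg (fst j) m (snd j)) (fun _ => 1).
Proof.
apply bigO_1_of_bound. intros [i w] [Hi Hw]. now apply (c_W_bd _ _ _ (HD i Hi)).
Qed.

Lemma tau_bd {J} (D' : J -> Prop) (pr : J -> string_data) m :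
  (forall j, D' j -> D (pr j)) -> bigO D' (fun j => tau (pr j) m) (fun _ => 1).
Proof.
intros H. apply bigO_1_of_bound. intros j Hj.
apply (c_T_bd _ _ _ (HD _ (H j Hj))). apply (DG_lo _ (H j Hj)).
Qed.

Lemma W0_bd {J} (D' : J -> Prop) (pr : J -> string_data) m :
  (forall j, D' j -> D (pr j)) -> bigO D' (fun j => W0 (pr j) m) (fun _ => 1).
Proof.
intros H. apply bigO_1_of_bound. intros j Hj.
apply (c_W_bd _ _ _ (HD _ (H j Hj))). apply (DG_lo _ (H j Hj)).
Qed.

Lemma g0_bd {J} (D' : J -> Prop) (pr : J -> string_data) m n :
  (forall j, D' j -> D (pr j)) -> bigO D' (fun j => g0 (pr j) m n) (fun _ => 1).
Proof.
intros H. apply bigO_1_of_bound. intros j Hj.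
apply (c_g_bd _ _ _ (HD _ (H j Hj))). apply (DG_lo _ (H j Hj)).
Qed.

Lemma Wg_lip m : congO DG (fun j => ell (fst j) (snd j) ^ 1)
  (fun j => Wg (fst j) m (snd j)) (fun j => Wg (fst j) m (ds (fst j))).
Proof.
apply bigO_bound with M.
- intros [i w] [Hi Hw]. cbn. rewrite Rmult_1_r. now apply (c_W_lip _ _ _ (HD i Hi)).
- intros j Hj. apply pow_le. now apply DG_ell.
Qed.

Lemma gamma_curve_on i : D i ->
  curve_on Gam (ds i) (dt i) (Zg i) (Tg i) (Wg i) (rho i) (ell i).
Proof. intros Hi. apply (c_gamma _ _ _ (HD i Hi)). Qed.

Lemma ds_le_dt i : D i -> ds i <= dt i.
Proof. intros Hi. apply (c_st _ _ _ (HD i Hi)). Qed.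

(** A geodesic is a curve without covariant acceleration whose parameter is its arc length, so the
    general expansions apply to it. *)
Lemma geodesic_curve_on i : D i ->
  curve_on Gam 0 (lam i) (Za i) (Va i) (fun _ _ => 0) (fun _ => 1) (fun w => w).
Proof.
intros Hi. assert (H := c_A _ _ _ (HD i Hi)).
split; try (intros; lra).
- intros m w Hw. rewrite Rmult_1_l. apply (geod_pos _ _ _ _ _ _ H).
  now apply (DA_del (i, w)).
- intros m w Hw. rewrite Rmult_1_l, Rminus_0_l. apply (geod_vel _ _ _ _ _ _ H).
  now apply (DA_del (i, w)).
- intros w Hw. apply (is_derive_id (K := R_AbsRing)).
Qed.

Lemma lam_ge0 i : D i -> 0 <= lam i.
Proof. intros Hi. generalize (lam_bounds i Hi). lra. Qed.

(* The geodesic [Za] has the same expansion as the curve, without [W0]. *)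
Definition acc0 (i : string_data) (m : axis) : R := quad Gam (x0 i) (tau i) (tau i) m.

Lemma g_velocity_2 m : congO DG (fun j => ell (fst j) (snd j) ^ 2)
  (fun j => Tg (fst j) m (snd j))
  (fun j => tau (fst j) m + ell (fst j) (snd j) * (W0 (fst j) m - acc0 (fst j) m)).
Proof.
exact (curve_velocity_2 D box M Gam Gam_bd_D Gam_lip_D ds dt Zg Tg Wg rho ell
  gamma_curve_on ds_le_dt box_g Tg_bd Wg_bd Wg_lip m).
Qed.

Lemma g_position_2 m : congO DG (fun j => ell (fst j) (snd j) ^ 2)
  (fun j => crd m (Zg (fst j) (snd j)))
  (fun j => crd m (x0 (fst j)) + ell (fst j) (snd j) * tau (fst j) m).
Proof.
exact (curve_position_2 D box M Gam Gam_bd_D ds dt Zg Tg Wg rho ell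
  gamma_curve_on box_g Tg_bd Wg_bd m).
Qed.

Lemma g_position_3 m : congO DG (fun j => ell (fst j) (snd j) ^ 3)
  (fun j => crd m (Zg (fst j) (snd j)))
  (fun j => crd m (x0 (fst j)) + ell (fst j) (snd j) * tau (fst j) m
    + ell (fst j) (snd j) ^ 2 / 2 * (W0 (fst j) m - acc0 (fst j) m)).
Proof.
exact (curve_position_3 D box M Gam Gam_bd_D Gam_lip_D ds dt Zg Tg Wg rho ell
  gamma_curve_on ds_le_dt box_g Tg_bd Wg_bd Wg_lip m).
Qed.

Lemma g_velocity_1 m : congO DG (fun j => ell (fst j) (snd j) ^ 1)
  (fun j => Tg (fst j) m (snd j)) (fun j => tau (fst j) m).
Proof.
exact (curve_velocity_1 D box M Gam Gam_bd_D ds dt Zg Tg Wg rho ell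
  gamma_curve_on box_g Tg_bd Wg_bd m).
Qed.

Lemma g_position_1 m : congO DG (fun j => ell (fst j) (snd j) ^ 1)
  (fun j => crd m (Zg (fst j) (snd j))) (fun j => crd m (x0 (fst j))).
Proof.
exact (curve_position_1 D Gam ds dt Zg Tg Wg rho ell gamma_curve_on Tg_bd m).
Qed.

Lemma box_a_arc : in_box D box DA fst (fun j => Za (fst j) (snd j)).
Proof. apply box_a; [now intros j [H _]|apply DA_del]. Qed.

Lemma Va_bd_arc m : bigO DA (fun j => Va (fst j) m (snd j)) (fun _ => 1).
Proof. apply Va_bd; [now intros j [H _]|apply DA_del]. Qed.

Lemma Va0 m i : D i -> Va i m 0 = tau i m.
Proof. intros Hi. apply (c_VA0 _ _ _ (HD i Hi)). Qed.

Lemma Za0 i : D i -> Za i 0 = x0 i.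
Proof. intros Hi. apply (c_A0 _ _ _ (HD i Hi)). Qed.

Lemma accel_a0 m i : D i ->
  accel Gam Za Va (fun _ _ _ => 0) i m 0 = - acc0 i m.
Proof.
intros Hi. unfold accel, acc0. rewrite Za0 by easy.
rewrite Rminus_0_l. f_equal.
apply sum_axis_ext. intros p. apply sum_axis_ext. intros q.
now rewrite !Va0 by easy.
Qed.

Lemma a_velocity_2 m : congO DA (fun j => snd j ^ 2)
  (fun j => Va (fst j) m (snd j))
  (fun j => tau (fst j) m + snd j * (- acc0 (fst j) m)).
Proof.
(* The general expansion is in terms of the data of [Za] at 0; this equality turns them into those
   of the curve at [x0]. *)
apply congO_trans with (2 := congO_eq _ _ _ _ (fun j (Hj : DA j) =>
  f_equal2 Rplus (Va0 m (fst j) (proj1 Hj))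
   (f_equal (Rmult (snd j)) (accel_a0 m (fst j) (proj1 Hj))))).
apply (curve_velocity_2 D box M Gam Gam_bd_D Gam_lip_D (fun _ => 0) lam Za Va
  (fun _ _ _ => 0) (fun _ _ => 1) (fun _ w => w)
  geodesic_curve_on lam_ge0 box_a_arc Va_bd_arc).
- intros _. apply bigO_0.
- intros _. apply congO_refl.
Qed.

Lemma a_position_3 m : congO DA (fun j => snd j ^ 3)
  (fun j => crd m (Za (fst j) (snd j)))
  (fun j => crd m (x0 (fst j)) + snd j * tau (fst j) m
    + snd j ^ 2 / 2 * (- acc0 (fst j) m)).
Proof.
apply congO_trans with (2 := congO_eq _ _ _ _ (fun j (Hj : DA j) =>
  f_equal2 Rplus (f_equal2 Rplus (f_equal (crd m) (Za0 (fst j) (proj1 Hj)))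
    (f_equal (Rmult (snd j)) (Va0 m (fst j) (proj1 Hj))))
   (f_equal (Rmult (snd j ^ 2 / 2)) (accel_a0 m (fst j) (proj1 Hj))))).
apply (curve_position_3 D box M Gam Gam_bd_D Gam_lip_D (fun _ => 0) lam Za Va
  (fun _ _ _ => 0) (fun _ _ => 1) (fun _ w => w)
  geodesic_curve_on lam_ge0 box_a_arc Va_bd_arc).
- intros _. apply bigO_0.
- intros _. apply congO_refl.
Qed.

Lemma a_velocity_1 m : congO DA (fun j => snd j ^ 1)
  (fun j => Va (fst j) m (snd j)) (fun j => tau (fst j) m).
Proof.
apply congO_trans with (2 := congO_eq _ _ _ _ (fun j (Hj : DA j) =>
  Va0 m (fst j) (proj1 Hj))).
apply (curve_velocity_1 D box M Gam Gam_bd_D (fun _ => 0) lam Za Va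
  (fun _ _ _ => 0) (fun _ _ => 1) (fun _ w => w)
  geodesic_curve_on box_a_arc Va_bd_arc).
intros _. apply bigO_0.
Qed.

Lemma a_position_1 m : congO DA (fun j => snd j ^ 1)
  (fun j => crd m (Za (fst j) (snd j))) (fun j => crd m (x0 (fst j))).
Proof.
apply congO_trans with (2 := congO_eq _ _ _ _ (fun j (Hj : DA j) =>
  f_equal (crd m) (Za0 (fst j) (proj1 Hj)))).
exact (curve_position_1 D Gam (fun _ => 0) lam Za Va
  (fun _ _ _ => 0) (fun _ _ => 1) (fun _ w => w) geodesic_curve_on Va_bd_arc m).
Qed.

(** Prepares the comparison at equal arc length, by setting the parameter of the geodesic to
    [ell]. *)
Lemma congO_DA_DG e f g : congO DA e f g ->
  congO DG (fun j => e (fst j, ell (fst j) (snd j)))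
    (fun j => f (fst j, ell (fst j) (snd j))) (fun j => g (fst j, ell (fst j) (snd j))).
Proof. apply (bigO_comp DA DG (fun j => (fst j, ell (fst j) (snd j)))). apply DG_DA. Qed.

(** The Christoffel terms [acc0] are common to both expansions and cancel, which leaves the
    curvature vector [W0]. *)
Lemma ga_velocity_2 m : congO DG (fun j => ell (fst j) (snd j) ^ 2)
  (fun j => Tg (fst j) m (snd j))
  (fun j => Va (fst j) m (ell (fst j) (snd j)) + ell (fst j) (snd j) * W0 (fst j) m).
Proof.
apply congO_trans with (1 := g_velocity_2 m).
apply bigO_ext with (2 := congO_sym _ _ _ _ (congO_DA_DG _ _ _ (a_velocity_2 m))).
intros; cbn; ring.
Qed.

Lemma ga_position_3 m : congO DG (fun j => ell (fst j) (snd j) ^ 3)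
  (fun j => crd m (Zg (fst j) (snd j)))
  (fun j => crd m (Za (fst j) (ell (fst j) (snd j)))
     + ell (fst j) (snd j) ^ 2 / 2 * W0 (fst j) m).
Proof.
apply congO_trans with (1 := g_position_3 m).
apply bigO_ext with (2 := congO_sym _ _ _ _ (congO_DA_DG _ _ _ (a_position_3 m))).
intros; cbn; field.
Qed.

(** Higher powers are smaller because [c_del] keeps all lengths below 1. *)
Lemma ell_le (n n' : nat) j : (n' <= n)%nat -> DG j ->
  ell (fst j) (snd j) ^ n <= ell (fst j) (snd j) ^ n'.
Proof.
intros Hn Hj. assert (H := DG_ell j Hj). assert (H' := lam_bounds (fst j) (proj1 Hj)).
replace n with (n' + (n - n'))%nat by lia. rewrite pow_add.
rewrite <- (Rmult_1_r (_ ^ n')) at 2. apply Rmult_le_compat_l.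
- now apply pow_le.
- rewrite <- (pow1 (n - n')). apply pow_incr. lra.
Qed.

Lemma ga_velocity_1 m : congO DG (fun j => ell (fst j) (snd j) ^ 1)
  (fun j => Tg (fst j) m (snd j)) (fun j => Va (fst j) m (ell (fst j) (snd j))).
Proof.
apply congO_trans with (1 := g_velocity_1 m).
exact (congO_sym _ _ _ _ (congO_DA_DG _ _ _ (a_velocity_1 m))).
Qed.

Lemma ga_position_2 m : congO DG (fun j => ell (fst j) (snd j) ^ 2)
  (fun j => crd m (Zg (fst j) (snd j))) (fun j => crd m (Za (fst j) (ell (fst j) (snd j)))).
Proof.
apply congO_trans with (fun j => crd m (Za (fst j) (ell (fst j) (snd j)))
     + ell (fst j) (snd j) ^ 2 / 2 * W0 (fst j) m).
- apply bigO_le with (2 := ga_position_3 m). intros j Hj. apply ell_le; [lia|easy].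
- apply bigO_ext with (fun j => ell (fst j) (snd j) ^ 2 * (/ 2 * W0 (fst j) m)).
    intros; field.
  apply bigO_mult_r.
  + apply bigO_refl. intros j Hj. apply pow_le. now apply DG_ell.
  + apply bigO_mult_l; [apply bigO_const|]. apply W0_bd. now intros j [H _].
Qed.

(** * Location of the meeting point *)

Definition meet_m (i : string_data) : R := Rabs (v i) + Rabs (u i - lam i).

Definition D01 := seg D (fun _ => 0) (fun _ => 1).

(* The two geodesics seen from their tangency with the curve, both
   parametrized by [0, 1], with the meeting point at 1.  An affine change of
   parameter preserves the geodesic equation. *)
Definition gapA (i : string_data) (w : R) : R := lam i + (u i - lam i) * w.
Definition gapB (i : string_data) (w : R) : R := v i * w.
Definition gap (i : string_data) (m : axis) (w : R) : R :=
  crd m (Zb i (gapB i w)) - crd m (Za i (gapA i w)).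
Definition velB (i : string_data) (m : axis) (w : R) : R := v i * Vb i m (gapB i w).
Definition velA (i : string_data) (m : axis) (w : R) : R := (u i - lam i) * Va i m (gapA i w).
Definition gap1 (i : string_data) (m : axis) (w : R) : R := velB i m w - velA i m w.
Definition gap2 (i : string_data) (m : axis) (w : R) : R :=
  - (quad Gam (Zb i (gapB i w)) (fun p => velB i p w) (fun q => velB i q w) m
     - quad Gam (Za i (gapA i w)) (fun p => velA i p w) (fun q => velA i q w) m).

Lemma between_lt x y w d : x < d -> y < d -> 0 <= w <= 1 -> x + (y - x) * w < d.
Proof.
intros Hx Hy Hw. assert (H1 : 0 <= (1 - w) * (d - x)) by (apply Rmult_le_pos; lra).
assert (H2 : 0 <= w * (d - y)) by (apply Rmult_le_pos; lra).
destruct (Req_dec w 0) as [->|E]; [lra|].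
assert (0 < w * (d - y)) by (apply Rmult_lt_0_compat; lra). lra.
Qed.

Lemma gapA_del j : D01 j -> Rabs (gapA (fst j) (snd j)) < del (fst j).
Proof.
destruct j as [i w]; intros [Hi Hw]; cbn in *. unfold gapA.
assert (H1 := c_u _ _ _ (HD i Hi)). assert (H2 := c_lam _ _ _ (HD i Hi)).
apply Rabs_def2 in H1. apply Rabs_def1.
- apply between_lt; lra.
- assert (H := between_lt (- lam i) (- u i) w (del i)). lra.
Qed.

Lemma gapB_del j : D01 j -> Rabs (gapB (fst j) (snd j)) < del (fst j).
Proof.
destruct j as [i w]; intros [Hi Hw]; cbn in *. unfold gapB.
assert (H1 := c_v _ _ _ (HD i Hi)).
apply Rabs_def2 in H1. apply Rabs_def1; nra.
Qed.

Lemma D01_D j : D01 j -> D (fst j).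
Proof. now intros [H _]. Qed.

Lemma gap_derive i m w : D i -> 0 <= w <= 1 -> is_derive (gap i m) w (gap1 i m w).
Proof.
intros Hi Hw.
assert (HA := geod_pos _ _ _ _ _ _ (c_A _ _ _ (HD i Hi)) m _ (gapA_del (i, w) (conj Hi Hw))).
assert (HB := geod_pos _ _ _ _ _ _ (c_B _ _ _ (HD i Hi)) m _ (gapB_del (i, w) (conj Hi Hw))).
cbn [fst snd] in HA, HB. unfold gap, gap1, velA, velB.
apply (is_derive_minus (fun w => crd m (Zb i (gapB i w))) (fun w => crd m (Za i (gapA i w)))).
- apply (is_derive_comp (fun x => crd m (Zb i x)) (gapB i)); [easy|].
  unfold gapB. auto_derive; [easy|ring].
- apply (is_derive_comp (fun x => crd m (Za i x)) (gapA i)); [easy|].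
  unfold gapA. auto_derive; [easy|ring].
Qed.

Lemma gap1_derive i m w : D i -> 0 <= w <= 1 -> is_derive (gap1 i m) w (gap2 i m w).
Proof.
intros Hi Hw.
assert (HA := geod_vel _ _ _ _ _ _ (c_A _ _ _ (HD i Hi)) m _ (gapA_del (i, w) (conj Hi Hw))).
assert (HB := geod_vel _ _ _ _ _ _ (c_B _ _ _ (HD i Hi)) m _ (gapB_del (i, w) (conj Hi Hw))).
cbn [fst snd] in HA, HB. unfold gap1, gap2, velA, velB.
match goal with |- is_derive _ _ (- (?qb - ?qa)) =>
  replace (- (qb - qa)) with
   (v i * (v i * - quad Gam (Zb i (gapB i w)) (fun p => Vb i p (gapB i w)) (fun q => Vb i q (gapB i w)) m)
   - (u i - lam i) * ((u i - lam i) * - quad Gam (Za i (gapA i w)) (fun p => Va i p (gapA i w)) (fun q => Va i q (gapA i w)) m))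
end.
2:{ unfold quad, sum_axis. ring. }
apply (is_derive_minus (fun w => v i * Vb i m (gapB i w))
  (fun w => (u i - lam i) * Va i m (gapA i w))).
- apply is_derive_scal. apply (is_derive_comp (Vb i m) (gapB i)); [easy|].
  unfold gapB. auto_derive; [easy|ring].
- apply is_derive_scal. apply (is_derive_comp (Va i m) (gapA i)); [easy|].
  unfold gapA. auto_derive; [easy|ring].
Qed.

Definition gap_size (f : string_data -> axis -> R -> R) (i : string_data) (w : R) : R :=
  sum_axis (fun n => Rabs (f i n w)).

Lemma gap_size_ge0 f i w : 0 <= gap_size f i w.
Proof. apply sum_axis_ge0. intros; apply Rabs_pos. Qed.

Lemma gap_size_bigO {J} (D' : J -> Prop) (f : string_data -> axis -> R -> R) (pr : J -> string_data)
  (w : J -> R) e : (forall m, bigO D' (fun j => f (pr j) m (w j)) e) ->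
  bigO D' (fun j => gap_size f (pr j) (w j)) e.
Proof. intros H. apply bigO_sum. intros m. apply bigO_abs, H. Qed.

Lemma meet_m_bound i : D i -> 0 <= meet_m i <= 3 * del i.
Proof.
intros Hi. unfold meet_m.
assert (H1 := c_u _ _ _ (HD i Hi)). assert (H2 := c_lam _ _ _ (HD i Hi)).
assert (H3 := c_v _ _ _ (HD i Hi)).
generalize (Rabs_pos (v i)) (Rabs_pos (u i - lam i)) (Rabs_triang (u i) (- lam i)).
rewrite Rabs_Ropp, (Rabs_pos_eq (lam i)) by lra. unfold Rminus. lra.
Qed.

(** The geodesic equation is quadratic in the velocities, and both are [O(meet_m)]. Each part of the
    difference keeps one velocity as a factor, which is the small coefficient that [almost_affine]
    asks for. *)
Lemma gap2_bigO m : bigO D01 (fun j => gap2 (fst j) m (snd j))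
  (fun j => meet_m (fst j) * (gap_size gap (fst j) (snd j) + gap_size gap1 (fst j) (snd j))).
Proof.
set (e := fun j : string_data * R => gap_size gap (fst j) (snd j) + gap_size gap1 (fst j) (snd j)).
assert (He : forall j, 0 <= e j).
{ intros j. unfold e. generalize (gap_size_ge0 gap (fst j) (snd j)) (gap_size_ge0 gap1 (fst j) (snd j)). lra. }
assert (Hm : bigO D01 (fun j => meet_m (fst j)) (fun _ => 1)).
{ apply bigO_bound with 3; [|intros; lra]. intros j Hj.
  generalize (meet_m_bound (fst j) (proj1 Hj)) (c_del _ _ _ (HD _ (proj1 Hj))).
  intros. rewrite Rabs_pos_eq; lra. }
assert (BA : forall p, bigO D01 (fun j => velA (fst j) p (snd j)) (fun j => meet_m (fst j))).
{ intros p. unfold velA. apply bigO_mult_r; [|apply Va_bd; [apply D01_D|apply gapA_del]].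
  apply bigO_bound with 1; intros j Hj; [|apply meet_m_bound, Hj].
  unfold meet_m. generalize (Rabs_pos (v (fst j))). lra. }
assert (BB : forall p, bigO D01 (fun j => velB (fst j) p (snd j)) (fun j => meet_m (fst j))).
{ intros p. unfold velB. apply bigO_mult_r; [|apply Vb_bd; [apply D01_D|apply gapB_del]].
  apply bigO_bound with 1; intros j Hj; [|apply meet_m_bound, Hj].
  unfold meet_m. generalize (Rabs_pos (u (fst j) - lam (fst j))). lra. }
assert (CV : forall p, congO D01 e (fun j => velB (fst j) p (snd j)) (fun j => velA (fst j) p (snd j))).
{ intros p. apply bigO_bound with 1; [|auto]. intros j _. unfold e.
  assert (H := le_sum_axis (fun n => Rabs (gap1 (fst j) n (snd j))) p (fun _ => Rabs_pos _)).
  cbv beta in H. fold (gap_size gap1 (fst j) (snd j)) in H. unfold gap1 at 1 in H.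
  generalize (gap_size_ge0 gap (fst j) (snd j)). lra. }
assert (CZ : forall p, congO D01 e (fun j => crd p (Zb (fst j) (gapB (fst j) (snd j))))
   (fun j => crd p (Za (fst j) (gapA (fst j) (snd j))))).
{ intros p. apply bigO_bound with 1; [|auto]. intros j _. unfold e.
  assert (H := le_sum_axis (fun n => Rabs (gap (fst j) n (snd j))) p (fun _ => Rabs_pos _)).
  cbv beta in H. fold (gap_size gap (fst j) (snd j)) in H. unfold gap at 1 in H.
  generalize (gap_size_ge0 gap1 (fst j) (snd j)). lra. }
assert (XA := box_a D01 fst _ D01_D gapA_del).
assert (XB := box_b D01 fst _ D01_D gapB_del).
unfold gap2. apply bigO_opp.
apply congO_sum. intros p. apply congO_sum. intros q.
apply congO_mult_split.
- apply bigO_le with (fun j => e j * meet_m (fst j)); [intros; unfold e; lra|].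
  apply bigO_mult; [|apply BB].
  apply congO_mult.
  + now apply Gam_congO with (1 := Gam_lip_D) (pr := fst).
  + apply CV.
  + now apply bigO_trans with (2 := Hm).
  + now apply Gam_bigO with (1 := Gam_bd_D) (pr := fst).
- apply bigO_mult; [|apply CV].
  apply bigO_mult_l; [|apply BA]. now apply Gam_bigO with (1 := Gam_bd_D) (pr := fst).
Qed.

Definition small (eta : R) (i : string_data) : Prop := D i /\ del i <= eta.

Lemma small_D eta i : small eta i -> D i.
Proof. now intros [H _]. Qed.

Lemma gap_end i m : D i -> gap i m 1 = 0.
Proof.
intros Hi. unfold gap, gapA, gapB. rewrite !Rmult_1_r.
replace (lam i + (u i - lam i)) with (u i) by ring.
rewrite (c_meet _ _ _ (HD i Hi)). ring.
Qed.

(** The gap vanishes at 1, so near-affinity makes its value at 0 opposite to its velocity there; the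
    velocity on the error side is absorbed, which also yields the second estimate. *)
Lemma gap_start : exists eta, 0 < eta /\
  (forall m, bigO (small eta) (fun i => gap i m 0 + gap1 i m 0)
    (fun i => meet_m i * gap_size gap i 0)) /\
  (forall m, bigO (small eta) (fun i => gap1 i m 0) (fun i => gap_size gap i 0)).
Proof.
assert (HC : exists C, 0 <= C /\ forall m i w, D i -> 0 <= w <= 1 ->
  Rabs (gap2 i m w) <= C * meet_m i * (gap_size gap i w + gap_size gap1 i w)).
{ destruct (gap2_bigO ax1) as [C1 [P1 H1]]. destruct (gap2_bigO ax2) as [C2 [P2 H2]].
  exists (C1 + C2). split; [lra|]. intros m i w Hi Hw.
  assert (E1 := H1 (i, w) (conj Hi Hw)). assert (E2 := H2 (i, w) (conj Hi Hw)).
  cbn [fst snd] in E1, E2.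
  assert (0 <= meet_m i * (gap_size gap i w + gap_size gap1 i w)).
  { apply Rmult_le_pos; [apply meet_m_bound, Hi|].
    generalize (gap_size_ge0 gap i w) (gap_size_ge0 gap1 i w). lra. }
  destruct m; nra. }
destruct HC as [C [PC HC]].
assert (PC' : 0 < 300 * (C + 1)) by lra.
(* As [meet_m <= 3 * eta], this gives [C * meet_m <= 1 / 100]: below the 1/8 of [almost_affine], and
   small enough for [16 * C * meet_m] to be absorbed below. *)
set (eta := / (300 * (C + 1))).
assert (Peta : 0 < eta) by now apply Rinv_0_lt_compat.
assert (Heta : 300 * C * eta <= 1).
{ assert (E : 300 * (C + 1) * eta = 1) by (unfold eta; field; lra). nra. }
assert (main : forall i m, small eta i -> Rabs (gap i m 0 + gap1 i m 0) <=
   16 * (C * meet_m i) * (gap_size gap i 0 + gap_size gap1 i 0)).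
{ intros i m [Hi Hs].
  assert (Hm := meet_m_bound i Hi).
  assert (H : 0 <= C * meet_m i <= 1 / 8).
  { split; [apply Rmult_le_pos; lra|].
    apply Rle_trans with (C * (3 * eta)); [apply Rmult_le_compat_l; lra|lra]. }
  assert (A := almost_affine (gap i) (gap1 i) (gap2 i) (C * meet_m i) H
    (fun m w => gap_derive i m w Hi) (fun m w => gap1_derive i m w Hi)
    (fun m w => HC m i w Hi) m).
  rewrite gap_end in A by easy.
  replace (gap i m 0 + gap1 i m 0) with (- (0 - gap i m 0 - gap1 i m 0)) by ring.
  rewrite Rabs_Ropp. exact A. }
assert (main1 : forall i, small eta i -> gap_size gap1 i 0 <= 3 * gap_size gap i 0).
{ intros i Hi. assert (Hm := meet_m_bound i (proj1 Hi)).
  assert (G0 := gap_size_ge0 gap i 0). assert (G1 := gap_size_ge0 gap1 i 0).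
  assert (H : forall m, Rabs (gap1 i m 0) <= Rabs (gap i m 0) +
    16 * (C * meet_m i) * (gap_size gap i 0 + gap_size gap1 i 0)).
  { intros m. assert (T := Rabs_triang (gap i m 0 + gap1 i m 0) (- gap i m 0)).
    rewrite Rabs_Ropp in T.
    replace (gap i m 0 + gap1 i m 0 + - gap i m 0) with (gap1 i m 0) in T by ring.
    generalize (main i m Hi). lra. }
  assert (HCm : 16 * (C * meet_m i) <= 16 / 100).
  { apply Rle_trans with (16 * (C * (3 * eta))); [|lra].
    apply Rmult_le_compat_l; [lra|]. apply Rmult_le_compat_l; [lra|].
    destruct Hi. lra. }
  assert (16 * (C * meet_m i) * (gap_size gap i 0 + gap_size gap1 i 0) <=
    16 / 100 * (gap_size gap i 0 + gap_size gap1 i 0)).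
  { apply Rmult_le_compat_r; lra. }
  assert (A1 := H ax1). assert (A2 := H ax2).
  assert (E : gap_size gap1 i 0 = Rabs (gap1 i ax1 0) + Rabs (gap1 i ax2 0)) by easy.
  assert (E' : gap_size gap i 0 = Rabs (gap i ax1 0) + Rabs (gap i ax2 0)) by easy.
  lra. }
exists eta. split; [easy|]. split; intros m.
- apply bigO_bound with (64 * C).
  + intros i Hi. apply Rle_trans with (1 := main i m Hi).
    assert (Hm := meet_m_bound i (proj1 Hi)). assert (M1 := main1 i Hi).
    assert (0 <= C * meet_m i) by (apply Rmult_le_pos; lra).
    apply Rle_trans with (16 * (C * meet_m i) * (4 * gap_size gap i 0)); [|lra].
    apply Rmult_le_compat_l; lra.
  + intros i Hi. apply Rmult_le_pos; [apply meet_m_bound, Hi|apply gap_size_ge0].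
- apply bigO_bound with 3; [|intros; apply gap_size_ge0].
  intros i Hi. apply Rle_trans with (2 := main1 i Hi).
  apply (le_sum_axis (fun n => Rabs (gap1 i n 0))). intros; apply Rabs_pos.
Qed.

Definition con (a b : axis -> R) : R := sum_axis (fun m => a m * b m).
(** The covector dual to [tau], while [beta] is dual to [W0]. Pairing with [omega] extracts
    tangential components; [beta] annihilates [tau] and extracts normal ones. *)
Definition omega (i : string_data) (m : axis) : R := sum_axis (fun n => g0 i m n * tau i n).
Definition beta (i : string_data) (m : axis) : R := sum_axis (fun n => g0 i m n * W0 i n).

Lemma g0_sym i m n : D i -> g0 i m n = g0 i n m.
Proof. intros Hi. apply (c_g_sym _ _ _ (HD i Hi)). apply (DG_lo i Hi). Qed.

Lemma con_omega_tau i : D i -> con (omega i) (tau i) = 1.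
Proof.
intros Hi. rewrite <- (c_unit _ _ _ (HD i Hi)).
unfold con, omega, form, sum_axis. ring.
Qed.

Lemma con_beta_W0 i : con (beta i) (W0 i) = kap2 i.
Proof. unfold con, beta, kap2, form, sum_axis. ring. Qed.

Lemma con_beta_tau i : D i -> con (beta i) (tau i) = 0.
Proof.
intros Hi. rewrite <- (c_orth _ _ _ (HD i Hi) (ds i)) by apply (DG_lo i Hi).
unfold con, beta, form, sum_axis. fold (tau i). fold (W0 i).
change (fun m n => gg i m n (ds i)) with (g0 i).
change (fun m => Tg i m (ds i)) with (tau i). unfold tau, W0, g0. ring.
Qed.

Lemma omega_bd {J} (D' : J -> Prop) (pr : J -> string_data) m :
  (forall j, D' j -> D (pr j)) -> bigO D' (fun j => omega (pr j) m) (fun _ => 1).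
Proof.
intros H. apply bigO_sum. intros n. apply bigO_mult_l; [now apply g0_bd|now apply tau_bd].
Qed.

Lemma beta_bd {J} (D' : J -> Prop) (pr : J -> string_data) m :
  (forall j, D' j -> D (pr j)) -> bigO D' (fun j => beta (pr j) m) (fun _ => 1).
Proof.
intros H. apply bigO_sum. intros n. apply bigO_mult_l; [now apply g0_bd|now apply W0_bd].
Qed.

Lemma con_bigO {J} (D' : J -> Prop) (a b : J -> axis -> R) e :
  (forall m, bigO D' (fun j => a j m) (fun _ => 1)) ->
  (forall m, bigO D' (fun j => b j m) e) -> bigO D' (fun j => con (a j) (b j)) e.
Proof. intros Ha Hb. apply bigO_sum. intros m. now apply bigO_mult_l. Qed.

Lemma con_congO {J} (D' : J -> Prop) (a b b' : J -> axis -> R) e :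
  (forall m, bigO D' (fun j => a j m) (fun _ => 1)) ->
  (forall m, congO D' e (fun j => b j m) (fun j => b' j m)) ->
  congO D' e (fun j => con (a j) (b j)) (fun j => con (a j) (b' j)).
Proof.
intros Ha Hb. apply bigO_ext with (fun j => con (a j) (fun m => b j m - b' j m)).
  intros j _. unfold con, sum_axis. ring.
now apply con_bigO.
Qed.

Lemma bigO_hi f e : bigO DG f e -> bigO D (fun i => f (i, dt i)) (fun i => e (i, dt i)).
Proof. apply (bigO_comp DG D (fun i => (i, dt i))). apply DG_hi. Qed.

Lemma congO_hi e f g : congO DG e f g ->
  congO D (fun i => e (i, dt i)) (fun i => f (i, dt i)) (fun i => g (i, dt i)).
Proof. apply (bigO_hi (fun j => f j - g j)). Qed.

Lemma end_position m : congO D (fun i => lam i ^ 3) (fun i => crd m (Zg i (dt i)))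
  (fun i => crd m (Za i (lam i)) + lam i ^ 2 / 2 * W0 i m).
Proof. exact (congO_hi _ _ _ (ga_position_3 m)). Qed.

Lemma end_velocity m : congO D (fun i => lam i ^ 2) (fun i => Tg i m (dt i))
  (fun i => Va i m (lam i) + lam i * W0 i m).
Proof. exact (congO_hi _ _ _ (ga_velocity_2 m)). Qed.

Lemma end_velocity_1 m : congO D lam (fun i => Tg i m (dt i)) (fun i => Va i m (lam i)).
Proof. apply bigO_le with (2 := congO_hi _ _ _ (ga_velocity_1 m)). intros; cbn. unfold lam; lra. Qed.

Lemma end_geodesic m : congO D lam (fun i => Va i m (lam i)) (fun i => tau i m).
Proof.
apply bigO_le with (2 := bigO_comp DA D (fun i => (i, lam i)) _ _ DA_hi (a_velocity_1 m)).
intros; cbn. lra.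
Qed.

Lemma lam_pow_le (n n' : nat) i : (n' <= n)%nat -> D i -> lam i ^ n <= lam i ^ n'.
Proof. intros Hn Hi. exact (ell_le n n' (i, dt i) Hn (DG_hi i Hi)). Qed.

Lemma lam_pow_bigO n : bigO D (fun i => lam i ^ n) (fun i => lam i ^ n).
Proof. apply bigO_refl. intros i Hi. now apply pow_le, lam_ge0. Qed.

Lemma gap_0 i m : D i -> gap i m 0 = crd m (Zg i (dt i)) - crd m (Za i (lam i)).
Proof.
intros Hi. unfold gap, gapA, gapB. rewrite !Rmult_0_r, Rplus_0_r.
now rewrite (c_B0 _ _ _ (HD i Hi)).
Qed.

Lemma gap1_0 i m : D i ->
  gap1 i m 0 = v i * Tg i m (dt i) - (u i - lam i) * Va i m (lam i).
Proof.
intros Hi. unfold gap1, velA, velB, gapA, gapB. rewrite !Rmult_0_r, Rplus_0_r.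
now rewrite (c_VB0 _ _ _ (HD i Hi)).
Qed.

Lemma gap_0_congO m : congO D (fun i => lam i ^ 3) (fun i => gap i m 0)
  (fun i => lam i ^ 2 / 2 * W0 i m).
Proof.
apply bigO_ext with (2 := end_position m). intros i Hi. rewrite gap_0 by easy. ring.
Qed.

Lemma gap_size_0 : bigO D (fun i => gap_size gap i 0) (fun i => lam i ^ 2).
Proof.
apply (gap_size_bigO D gap (fun i => i) (fun _ => 0)). intros m.
apply bigO_ext with (fun i => (gap i m 0 - lam i ^ 2 / 2 * W0 i m) + lam i ^ 2 * (/ 2 * W0 i m)).
  intros; field.
apply bigO_plus.
- apply bigO_le with (2 := gap_0_congO m). intros i Hi. apply lam_pow_le; [lia|easy].
- apply bigO_mult_r; [apply lam_pow_bigO|].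
  apply bigO_mult_l; [apply bigO_const|]. now apply (W0_bd D (fun i => i)).
Qed.

Lemma bigO_self {J} (D' : J -> Prop) (f : J -> R) : bigO D' f (fun j => Rabs (f j)).
Proof. apply bigO_bound with 1; intros; [lra|apply Rabs_pos]. Qed.

(* the opposite of the string length [u - v - lam], once [v <= 0 <= u] *)
Definition excess (i : string_data) : R := v i - u i + lam i.

Lemma small_le eta eta' i : eta' <= eta -> small eta' i -> small eta i.
Proof. intros H [Hi Hs]. split; [easy|lra]. Qed.

Lemma lam_small eta i : small eta i -> 0 < lam i <= eta.
Proof. intros [Hi Hs]. generalize (c_lam _ _ _ (HD i Hi)). lra. Qed.

(** Tangential part of the velocity gap. Both velocities pair with [omega] to nearly 1, so [gap1]
    pairs to nearly [v - (u - lam)], which is [excess]. The velocity gap is of the size of the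
    position gap, hence [O(lam ^ 2)]. *)
Lemma excess_bigO : exists eta, 0 < eta /\
  bigO (small eta) excess (fun i => lam i * (lam i + Rabs (v i))).
Proof.
destruct gap_start as [eta [Peta [_ H]]].
set (e := fun i => lam i * (lam i + Rabs (v i) + Rabs (excess i))).
assert (A : bigO (small eta) excess e).
{ assert (Dle := lam_small eta).
  apply bigO_ext with (fun i => con (omega i) (fun m => gap1 i m 0)
    - v i * con (omega i) (fun m => Tg i m (dt i) - Va i m (lam i))
    - excess i * con (omega i) (fun m => Va i m (lam i) - tau i m)).
  { intros i [Hi _].
    assert (E1 : con (omega i) (fun m => Va i m (lam i) - tau i m) =
      con (omega i) (fun m => Va i m (lam i)) - 1).
    { rewrite <- (con_omega_tau i Hi). unfold con, sum_axis. ring. }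
    rewrite E1. unfold con, sum_axis. rewrite !gap1_0 by easy. unfold excess. ring. }
  apply bigO_minus; [apply bigO_minus|].
  - apply con_bigO; [intros m; apply (omega_bd _ (fun i => i)), small_D|]. intros m.
    apply bigO_trans with (1 := H m).
    apply bigO_le with (2 := bigO_sub _ _ _ _ (small_D eta) gap_size_0).
    intros i Hi. unfold e. generalize (Rabs_pos (v i)) (Rabs_pos (excess i)) (Dle i Hi). nra.
  - apply bigO_le with (fun i => Rabs (v i) * lam i).
    { intros i Hi. unfold e. generalize (Rabs_pos (v i)) (Rabs_pos (excess i)) (Dle i Hi). nra. }
    apply bigO_mult; [apply bigO_self|].
    apply con_bigO; [intros m; apply (omega_bd _ (fun i => i)), small_D|].
    intros m. exact (bigO_sub _ _ _ _ (small_D eta) (end_velocity_1 m)).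
  - apply bigO_le with (fun i => Rabs (excess i) * lam i).
    { intros i Hi. unfold e. generalize (Rabs_pos (v i)) (Rabs_pos (excess i)) (Dle i Hi). nra. }
    apply bigO_mult; [apply bigO_self|].
    apply con_bigO; [intros m; apply (omega_bd _ (fun i => i)), small_D|].
    intros m. exact (bigO_sub _ _ _ _ (small_D eta) (end_geodesic m)). }
destruct A as [C [PC HC]].
assert (PC' : 0 < 2 * (C + 1)) by lra.
(* The error contains [lam * Rabs (excess i)]; with [C * lam <= 1 / 2] half of the excess moves to
   the left-hand side, whence the constant [2 * C]. *)
exists (Rmin eta (/ (2 * (C + 1)))). split.
{ apply Rmin_pos; [easy|]. now apply Rinv_0_lt_compat. }
apply bigO_bound with (2 * C).
- intros i Hi. assert (Hs := small_le _ _ i (Rmin_l _ _) Hi).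
  assert (Hl := lam_small _ i (small_le _ _ i (Rmin_r _ _) Hi)).
  assert (HCl : C * lam i <= 1 / 2).
  { apply Rle_trans with (C * / (2 * (C + 1))); [apply Rmult_le_compat_l; lra|].
    apply Rmult_le_reg_r with (2 * (C + 1)); [easy|].
    rewrite Rmult_assoc, Rinv_l by lra. lra. }
  assert (H1 := HC i Hs). unfold e in H1.
  assert (C * lam i * Rabs (excess i) <= 1 / 2 * Rabs (excess i)).
  { apply Rmult_le_compat_r; [apply Rabs_pos|easy]. }
  lra.
- intros i Hi. generalize (lam_small _ i Hi) (Rabs_pos (v i)). nra.
Qed.

(** Normal part of the relation between [gap] and [gap1]. The position gap is about
    [lam ^ 2 / 2 * W0], and the normal part of the velocity gap is about [v * lam * W0]; pairing
    with [beta] makes [kap2 * lam * (lam / 2 + v)] small. *)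
Lemma midpoint_bigO : exists eta, 0 < eta /\
  bigO (small eta) excess (fun i => lam i * (lam i + Rabs (v i))) /\
  bigO (small eta) (fun i => lam i / 2 + v i)
    (fun i => lam i * (meet_m i + lam i + Rabs (v i))).
Proof.
destruct gap_start as [eta1 [Peta1 [H1 _]]].
destruct excess_bigO as [eta2 [Peta2 H2]].
exists (Rmin eta1 eta2). split; [now apply Rmin_pos|].
assert (S1 : forall i, small (Rmin eta1 eta2) i -> small eta1 i).
{ intros i. apply small_le, Rmin_l. }
assert (S2 : forall i, small (Rmin eta1 eta2) i -> small eta2 i).
{ intros i. apply small_le, Rmin_r. }
assert (Sl := lam_small (Rmin eta1 eta2)).
assert (SD := small_D (Rmin eta1 eta2)).
set (DS := small (Rmin eta1 eta2)) in *.
assert (H2' := bigO_sub _ DS _ _ S2 H2). split; [easy|].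
set (e := fun i => lam i ^ 2 * (meet_m i + lam i + Rabs (v i))).
assert (Hm : forall i, DS i -> 0 <= meet_m i).
{ intros i Hi. apply meet_m_bound. auto. }
assert (Ble : forall f, bigO DS f (fun i => lam i ^ 2 * meet_m i) -> bigO DS f e).
{ intros f. apply bigO_le. intros i Hi. unfold e.
  generalize (Rabs_pos (v i)) (Sl i Hi) (Hm i Hi). nra. }
assert (Bv : forall f, bigO DS f (fun i => Rabs (v i) * lam i ^ 2) -> bigO DS f e).
{ intros f. apply bigO_le. intros i Hi. unfold e.
  generalize (Rabs_pos (v i)) (Sl i Hi) (Hm i Hi) (pow_le (lam i) 2). nra. }
assert (B3 : forall f, bigO DS f (fun i => lam i ^ 3) -> bigO DS f e).
{ intros f. apply bigO_le. intros i Hi. unfold e.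
  replace (lam i ^ 3) with (lam i ^ 2 * lam i) by ring.
  generalize (Rabs_pos (v i)) (Sl i Hi) (Hm i Hi) (pow_le (lam i) 2). nra. }
assert (Bex : forall f, bigO DS f (fun i => lam i * (lam i + Rabs (v i)) * lam i) -> bigO DS f e).
{ intros f. apply bigO_le. intros i Hi. unfold e.
  replace (lam i * (lam i + Rabs (v i)) * lam i) with (lam i ^ 2 * (lam i + Rabs (v i))) by ring.
  generalize (Rabs_pos (v i)) (Sl i Hi) (Hm i Hi) (pow_le (lam i) 2). nra. }
assert (Bbeta : forall m, bigO DS (fun i => beta i m) (fun _ => 1)).
{ intros m. now apply (beta_bd _ (fun i => i)). }
assert (A : bigO DS (fun i => kap2 i * lam i * (lam i / 2 + v i)) e).
{ apply bigO_ext with (fun i => con (beta i) (fun m => gap i m 0 + gap1 i m 0)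
    - con (beta i) (fun m => gap i m 0 - lam i ^ 2 / 2 * W0 i m)
    - v i * con (beta i) (fun m => Tg i m (dt i) - (Va i m (lam i) + lam i * W0 i m))
    - excess i * con (beta i) (fun m => Va i m (lam i) - tau i m)).
  { intros i Hi.
    assert (E1 : con (beta i) (fun m => Va i m (lam i) - tau i m) =
      con (beta i) (fun m => Va i m (lam i))).
    { transitivity (con (beta i) (fun m => Va i m (lam i)) - con (beta i) (tau i)).
        unfold con, sum_axis. ring.
      rewrite con_beta_tau by auto. ring. }
    rewrite E1, <- con_beta_W0. unfold con, sum_axis. rewrite !gap1_0 by auto.
    unfold excess. field. }
  apply bigO_minus; [apply bigO_minus; [apply bigO_minus|]|].
  - apply con_bigO; [easy|]. intros m. apply Ble.
    apply bigO_trans with (1 := bigO_sub _ DS _ _ S1 (H1 m)).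
    apply bigO_le with (fun i => meet_m i * lam i ^ 2); [intros; lra|].
    apply bigO_mult; [now apply bigO_refl|]. exact (bigO_sub _ DS _ _ SD gap_size_0).
  - apply con_bigO; [easy|]. intros m. apply B3. exact (bigO_sub _ DS _ _ SD (gap_0_congO m)).
  - apply Bv, bigO_mult; [apply bigO_self|]. apply con_bigO; [easy|].
    intros m. exact (bigO_sub _ DS _ _ SD (end_velocity m)).
  - apply Bex, bigO_mult; [easy|]. apply con_bigO; [easy|].
    intros m. exact (bigO_sub _ DS _ _ SD (end_geodesic m)). }
destruct A as [C [PC HC]].
(* Division by [kap2 * lam]: the lower bound [c_curv] costs the factor [M]. *)
apply bigO_bound with (C * M).
- intros i Hi. assert (Hl := Sl i Hi). assert (H := HC i Hi). unfold e in H.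
  assert (Hi' := SD i Hi).
  assert (PM := c_M _ _ _ (HD i Hi')). assert (Hk := c_curv _ _ _ (HD i Hi')).
  assert (Pk : 0 < / M) by now apply Rinv_0_lt_compat.
  rewrite !Rabs_mult, (Rabs_pos_eq (kap2 i)), (Rabs_pos_eq (lam i)) in H by lra.
  apply Rmult_le_reg_l with (lam i * / M); [apply Rmult_lt_0_compat; lra|].
  replace (lam i * / M * (C * M * (lam i * (meet_m i + lam i + Rabs (v i)))))
    with (C * (lam i ^ 2 * (meet_m i + lam i + Rabs (v i)))) by (field; lra).
  apply Rle_trans with (2 := H). rewrite (Rmult_comm (lam i)).
  apply Rmult_le_compat_r; [apply Rabs_pos|]. apply Rmult_le_compat_r; lra.
- intros i Hi. generalize (Sl i Hi) (Hm i Hi) (Rabs_pos (v i)). nra.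
Qed.

(** A small [del] first gives [Rabs (lam / 2 + v) <= lam / 4], so that [v], [u - lam] and [meet_m]
    are [O(lam)]; inserted again, this yields the orders [lam ^ 2]. The signs also follow, and they
    remove the absolute values from the string length. *)
Lemma meeting_point : exists eta, 0 < eta /\
  (forall i, small eta i -> - lam i <= v i <= 0 /\ 0 <= u i <= lam i) /\
  bigO (small eta) (fun i => lam i / 2 + v i) (fun i => lam i ^ 2) /\
  bigO (small eta) excess (fun i => lam i ^ 2).
Proof.
destruct midpoint_bigO as [eta [Peta [[C1 [PC1 HC1]] [C2 [PC2 HC2]]]]].
assert (Kinv : forall K, 0 <= K -> 0 < / (K + 1) /\ K * / (K + 1) <= 1).
{ intros K HK. assert (0 < / (K + 1)) by (apply Rinv_0_lt_compat; lra).
  split; [easy|]. assert ((K + 1) * / (K + 1) = 1) by (field; lra). lra. }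
(* The bracket of the midpoint estimate is at most [5 * eta'], so 20 brings [C2 * 5 * eta'] down to
   1/4; the summand with [C1] likewise gives [2 * C1 * lam <= 1 / 10]. *)
set (K := 20 * C2 + 20 * C1).
assert (PK : 0 <= K) by (unfold K; lra).
destruct (Kinv K PK) as [P1 P2]. set (eta' := / (K + 1)) in *.
exists (Rmin eta eta'). split; [now apply Rmin_pos|].
assert (main : forall i, small (Rmin eta eta') i ->
  Rabs (lam i / 2 + v i) <= lam i / 4 /\ Rabs (excess i) <= 2 * C1 * lam i ^ 2 /\
  Rabs (excess i) <= lam i / 4 /\
  Rabs (lam i / 2 + v i) <= C2 * (4 + 2 * C1) * lam i ^ 2).
{ intros i Hi.
  assert (Hs := small_le _ _ i (Rmin_l _ _) Hi).
  assert (Hs' := small_le _ _ i (Rmin_r _ _) Hi).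
  assert (Hl := lam_small _ i Hs'). assert (Hi' := small_D _ _ Hi).
  assert (Hdel : del i <= eta') by apply Hs'.
  assert (Hm := meet_m_bound i Hi').
  assert (Hv := c_v _ _ _ (HD i Hi')). assert (Hll := c_lam _ _ _ (HD i Hi')).
  assert (B1 := HC1 i Hs). assert (B2 := HC2 i Hs). cbv beta in B2.
  assert (Q1 : Rabs (lam i / 2 + v i) <= lam i / 4).
  { apply Rle_trans with (1 := B2).
    replace (lam i / 4) with (lam i * / 4) by field.
    rewrite <- Rmult_assoc, (Rmult_comm C2), Rmult_assoc.
    apply Rmult_le_compat_l; [lra|].
    apply Rle_trans with (C2 * (5 * eta')); [apply Rmult_le_compat_l; lra|].
    assert (C2 * eta' <= K / 20 * eta') by (apply Rmult_le_compat_r; unfold K; lra). lra. }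
  assert (Q2 : Rabs (v i) <= lam i).
  { apply Rabs_le_between in Q1. apply Rabs_le. lra. }
  assert (Q3 : Rabs (excess i) <= 2 * C1 * lam i ^ 2).
  { apply Rle_trans with (1 := B1).
    apply Rle_trans with (C1 * (lam i * (2 * lam i))); [|lra].
    apply Rmult_le_compat_l; [easy|]. apply Rmult_le_compat_l; lra. }
  split; [easy|]. split; [easy|]. split.
  - apply Rle_trans with (1 := Q3).
    assert (C1 * lam i <= K / 20 * eta').
    { apply Rmult_le_compat; unfold K; lra. }
    assert (C1 * lam i * lam i <= 1 / 20 * lam i) by (apply Rmult_le_compat_r; lra). lra.
  - apply Rle_trans with (1 := B2).
    rewrite (Rmult_assoc C2). apply Rmult_le_compat_l; [easy|].
    replace ((4 + 2 * C1) * lam i ^ 2) with (lam i * ((4 + 2 * C1) * lam i)) by ring.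
    apply Rmult_le_compat_l; [lra|].
    assert (Hul : Rabs (u i - lam i) <= Rabs (v i) + Rabs (excess i)).
    { replace (u i - lam i) with (v i - excess i) by (unfold excess; ring).
      apply Rle_trans with (1 := Rabs_triang _ _). rewrite Rabs_Ropp. lra. }
    unfold meet_m.
    assert (2 * C1 * lam i ^ 2 <= 2 * C1 * lam i).
    { apply Rmult_le_compat_l; [lra|]. generalize (lam_bounds i Hi'). nra. }
    lra. }
split; [|split].
- intros i Hi. destruct (main i Hi) as [Q1 [_ [Q2 _]]].
  apply Rabs_le_between in Q1. apply Rabs_le_between in Q2. unfold excess in Q2.
  assert (Hl := lam_small _ i Hi). lra.
- apply bigO_bound with (C2 * (4 + 2 * C1)); [apply main|].
  intros i _. apply pow2_ge_0.
- apply bigO_bound with (2 * C1); [apply main|].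
  intros i _. apply pow2_ge_0.
Qed.

(* [test_fun i] is the function omega(y + Gamma(y, y) / 2), with y the coordinates
   centered at [x0 i]: its covariant Hessian vanishes at [x0 i], and its
   differential there is dual to [tau i].  [test_hess] is its Hessian on [V]. *)
Definition rel (i : string_data) (z : R * R) (m : axis) : R := crd m z - crd m (x0 i).

Definition test_fun (i : string_data) (z : R * R) : R :=
  con (omega i) (fun m => rel i z m + / 2 * quad Gam (x0 i) (rel i z) (rel i z) m).

Definition test_slope (i : string_data) (z : R * R) (V : axis -> R) : R :=
  con (omega i) (fun m => V m + quad Gam (x0 i) (rel i z) V m).

Definition test_hess (i : string_data) (z : R * R) (V : axis -> R) : R :=
  con (omega i) (fun m => quad Gam (x0 i) V V m - quad Gam z V V m
    - quad Gam (x0 i) (rel i z) (quad Gam z V V) m).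

(** The quadratic term contributes two halves on differentiation, which the symmetry of the
    Christoffel symbols at [x0] merges into the single term of [test_slope]. *)
Lemma test_fun_derive i (Z : R -> R * R) (V : axis -> R) (w r : R) : D i ->
  (forall m, is_derive (fun x => crd m (Z x)) w (r * V m)) ->
  is_derive (fun x => test_fun i (Z x)) w (r * test_slope i (Z w) V).
Proof.
intros Hi HZ.
assert (Hsym : Gam ax1 ax1 ax2 (x0 i) = Gam ax1 ax2 ax1 (x0 i)).
{ apply (c_Gam_sym _ _ _ (HD i Hi)). apply (box_0 D (fun i => i) (fun i H => H) i Hi). }
assert (Hsym2 : Gam ax2 ax1 ax2 (x0 i) = Gam ax2 ax2 ax1 (x0 i)).
{ apply (c_Gam_sym _ _ _ (HD i Hi)). apply (box_0 D (fun i => i) (fun i H => H) i Hi). }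
cut (forall X : axis -> R -> R, (forall m, is_derive (X m) w (r * V m)) ->
  is_derive (fun x => con (omega i) (fun m => (X m x - crd m (x0 i))
    + / 2 * quad Gam (x0 i) (fun p => X p x - crd p (x0 i)) (fun p => X p x - crd p (x0 i)) m)) w
    (r * con (omega i) (fun m => V m + quad Gam (x0 i) (fun p => X p w - crd p (x0 i)) V m))).
{ intros H. exact (H (fun m x => crd m (Z x)) HZ). }
intros X HX. assert (H1 := HX ax1). assert (H2 := HX ax2).
unfold con, quad, sum_axis.
auto_derive; [repeat split; eexists; eassumption|].
change (fun x => X ax1 x) with (X ax1). change (fun x => X ax2 x) with (X ax2).
rewrite (is_derive_unique _ _ _ H1), (is_derive_unique _ _ _ H2).
rewrite Hsym, Hsym2. unfold crd. field.
Qed.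

(** The coordinate derivative of [V] is [W - Gamma(V, V)]; its Christoffel part goes into the
    covariant Hessian, and [W] alone remains in the slope. *)
Lemma test_slope_derive i (Z : R -> R * R) (V : axis -> R -> R) (W : axis -> R) (w r : R) :
  (forall m, is_derive (fun x => crd m (Z x)) w (r * V m w)) ->
  (forall m, is_derive (V m) w (r * (W m - quad Gam (Z w) (fun p => V p w) (fun q => V q w) m))) ->
  is_derive (fun x => test_slope i (Z x) (fun m => V m x)) w
    (r * (test_hess i (Z w) (fun m => V m w) + test_slope i (Z w) W)).
Proof.
intros HZ HV.
cut (forall X : axis -> R -> R, (forall m, is_derive (X m) w (r * V m w)) ->
  is_derive (fun x => con (omega i) (fun m => V m x
    + quad Gam (x0 i) (fun p => X p x - crd p (x0 i)) (fun q => V q x) m)) w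
    (r * (con (omega i) (fun m => quad Gam (x0 i) (fun p => V p w) (fun q => V q w) m
       - quad Gam (Z w) (fun p => V p w) (fun q => V q w) m
       - quad Gam (x0 i) (fun p => X p w - crd p (x0 i))
           (quad Gam (Z w) (fun p => V p w) (fun q => V q w)) m)
      + con (omega i) (fun m => W m + quad Gam (x0 i) (fun p => X p w - crd p (x0 i)) W m)))).
{ intros H. exact (H (fun m x => crd m (Z x)) HZ). }
intros X HX. assert (H1 := HX ax1). assert (H2 := HX ax2).
assert (H3 := HV ax1). assert (H4 := HV ax2).
set (N := quad Gam (Z w) (fun p => V p w) (fun q => V q w)) in *.
unfold con, quad, sum_axis.
auto_derive; [repeat split; eexists; eassumption|].
change (fun x => X ax1 x) with (X ax1). change (fun x => X ax2 x) with (X ax2).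
change (fun x => V ax1 x) with (V ax1). change (fun x => V ax2 x) with (V ax2).
rewrite (is_derive_unique _ _ _ H1), (is_derive_unique _ _ _ H2),
  (is_derive_unique _ _ _ H3), (is_derive_unique _ _ _ H4). unfold crd. ring.
Qed.

(** Why the difference is of second order: either it carries a position difference, which is
    [O(e ^ 2)], or a velocity difference [O(e)] multiplied by a coefficient that vanishes at [x0]
    and hence is [O(e)] too. *)
Lemma test_hess_congO {J} (D' : J -> Prop) (pr : J -> string_data) (Z Z' : J -> R * R)
    (V V' : axis -> J -> R) (e : J -> R) :
  (forall j, D' j -> D (pr j)) -> in_box D box D' pr Z -> in_box D box D' pr Z' ->
  (forall m, bigO D' (V m) (fun _ => 1)) -> (forall m, bigO D' (V' m) (fun _ => 1)) ->
  (forall m, congO D' e (fun j => crd m (Z j)) (fun j => crd m (x0 (pr j)))) ->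
  (forall m, congO D' e (fun j => crd m (Z' j)) (fun j => crd m (x0 (pr j)))) ->
  (forall m, congO D' (fun j => e j ^ 2) (fun j => crd m (Z j)) (fun j => crd m (Z' j))) ->
  (forall m, congO D' e (V m) (V' m)) ->
  (forall j, D' j -> 0 <= e j <= 1) ->
  congO D' (fun j => e j ^ 2) (fun j => test_hess (pr j) (Z j) (fun m => V m j))
    (fun j => test_hess (pr j) (Z' j) (fun m => V' m j)).
Proof.
intros HpD HZ HZ' BV BV' CZ0 CZ0' CZZ CV He.
assert (H0 := box_0 D' pr HpD).
assert (CZe : forall m, congO D' e (fun j => crd m (Z j)) (fun j => crd m (Z' j))).
{ intros m. apply bigO_le with (2 := CZZ m). intros j Hj. generalize (He j Hj). nra. }
assert (BQ : forall m, bigO D' (fun j => quad Gam (Z j) (fun p => V p j) (fun q => V q j) m) (fun _ => 1)).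
{ intros m. now apply quad_bigO_1 with (1 := Gam_bd_D) (pr := pr). }
apply con_congO; [intros m; now apply omega_bd|]. intros m.
assert (Hsq : forall j, D' j -> e j * e j <= e j ^ 2) by (intros; lra).
apply congO_minus.
(* Grouping the coefficients as [Gamma(x0) - Gamma(z)] exposes their vanishing at [x0]. *)
- apply bigO_ext with (fun j =>
    sum_axis (fun p => sum_axis (fun q => (Gam m p q (x0 (pr j)) - Gam m p q (Z j)) * (V p j * V q j)))
    - sum_axis (fun p => sum_axis (fun q => (Gam m p q (x0 (pr j)) - Gam m p q (Z' j)) * (V' p j * V' q j)))).
  { intros j _. unfold quad, sum_axis. ring. }
  apply congO_sum. intros p. apply congO_sum. intros q.
  apply congO_mult_split.
  + apply bigO_mult_r; [|now apply bigO_mult_l].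
    apply bigO_ext with (fun j => Gam m p q (Z' j) - Gam m p q (Z j)); [intros; ring|].
    apply congO_sym. now apply Gam_congO with (1 := Gam_lip_D) (pr := pr).
  + apply bigO_le with (1 := Hsq). apply bigO_mult.
    * apply congO_sym. now apply Gam_congO with (1 := Gam_lip_D) (pr := pr).
    * now apply congO_mult.
- apply congO_sum. intros p. apply congO_sum. intros q.
  apply congO_mult_split.
  + apply bigO_mult_r; [|apply BQ].
    apply bigO_ext with (fun j => Gam m p q (x0 (pr j)) * (crd p (Z j) - crd p (Z' j))).
      intros j _. unfold rel. ring.
    apply bigO_mult_l; [|apply CZZ].
    now apply Gam_bigO with (1 := Gam_bd_D) (pr := pr).
  + apply bigO_le with (1 := Hsq). apply bigO_mult.
    * apply bigO_mult_l; [|apply CZ0'].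
      now apply Gam_bigO with (1 := Gam_bd_D) (pr := pr).
    * now apply quad_congO with (1 := Gam_bd_D) (2 := Gam_lip_D) (pr := pr).
Qed.

(** * The test function along the curve and along the geodesic from its first end *)

Lemma ell_pow_bigO n : bigO DG (fun j => ell (fst j) (snd j) ^ n) (fun j => ell (fst j) (snd j) ^ n).
Proof. apply bigO_refl. intros j Hj. apply pow_le. now apply DG_ell. Qed.

Lemma ell_bigO_1 n : bigO DG (fun j => ell (fst j) (snd j) ^ n) (fun _ => 1).
Proof.
apply bigO_le with (2 := ell_pow_bigO n). intros j Hj.
apply (ell_le n 0 j); [lia|easy].
Qed.

(* derivative of the metric along the curve, at its first end point *)
Definition g1 (i : string_data) (m n : axis) : R :=
  sum_axis (fun l => sum_axis (fun k =>
    (g0 i n l * Gam l k m (x0 i) + g0 i m l * Gam l k n (x0 i)) * tau i k)).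

(** Orthogonality of tangent and acceleration holds for the metric at the moving point, while
    [omega] and [kap2] use the metric at [x0]; this expansion links the two. *)
Lemma gg_expansion m n : congO DG (fun j => ell (fst j) (snd j) ^ 2)
  (fun j => gg (fst j) m n (snd j))
  (fun j => g0 (fst j) m n + ell (fst j) (snd j) * g1 (fst j) m n).
Proof.
assert (HDG : forall j, DG j -> D (fst j)) by now intros j [H _].
set (g' := fun i w m n => sum_axis (fun l => sum_axis (fun k =>
  (gg i n l w * Gam l k m (Zg i w) + gg i m l w * Gam l k n (Zg i w)) * Tg i k w))).
assert (Bg : forall m n, bigO DG (fun j => gg (fst j) m n (snd j)) (fun _ => 1)).
{ intros m' n'. apply bigO_1_of_bound. intros [i w] [Hi Hw]. now apply (c_g_bd _ _ _ (HD i Hi)). }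
assert (BG : forall l p q, bigO DG (fun j => Gam l p q (Zg (fst j) (snd j))) (fun _ => 1)).
{ intros. apply Gam_bigO with (1 := Gam_bd_D) (pr := fst). apply box_g. }
assert (BG0 : forall l p q, bigO DG (fun j => Gam l p q (x0 (fst j))) (fun _ => 1)).
{ intros. apply Gam_bigO with (1 := Gam_bd_D) (pr := fst). now apply box_0. }
assert (Bg' : forall m n, bigO DG (fun j => g' (fst j) (snd j) m n) (fun _ => 1)).
{ intros m' n'. apply bigO_sum. intros l. apply bigO_sum. intros k.
  apply bigO_mult_l; [|apply Tg_bd]. apply bigO_plus; now apply bigO_mult_l. }
assert (Hder : forall i w m n, D i -> ds i <= w <= dt i ->
  is_derive (gg i m n) w (rho i w * g' i w m n)).
{ intros i w m' n' Hi Hw. now apply (c_g_der _ _ _ (HD i Hi)). }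
assert (L1 : forall m n, congO DG (fun j => ell (fst j) (snd j) ^ 1)
  (fun j => gg (fst j) m n (snd j)) (fun j => g0 (fst j) m n)).
{ intros m' n'. apply (curve_integrate D Gam ds dt Zg Tg Wg rho ell gamma_curve_on
    (fun i => gg i m' n') (fun i w => g' i w m' n') 0); auto. }
assert (L2 : congO DG (fun j => ell (fst j) (snd j) ^ 1)
  (fun j => g' (fst j) (snd j) m n) (fun j => g1 (fst j) m n)).
{ apply congO_sum. intros l. apply congO_sum. intros k.
  assert (CG : forall l p q, congO DG (fun j => ell (fst j) (snd j) ^ 1)
    (fun j => Gam l p q (Zg (fst j) (snd j))) (fun j => Gam l p q (x0 (fst j)))).
  { intros. apply Gam_congO with (1 := Gam_lip_D) (pr := fst).
    - apply box_g.
    - now apply box_0.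
    - apply g_position_1. }
  apply congO_mult; [|apply g_velocity_1|apply Tg_bd|].
  - apply congO_plus; apply congO_mult; auto; now apply g0_bd.
  - apply bigO_plus; apply bigO_mult_l; auto; now apply g0_bd. }
apply bigO_ext with (fun j => (gg (fst j) m n (snd j) - ell (fst j) (snd j) * g1 (fst j) m n)
  - (gg (fst j) m n (ds (fst j)) - ell (fst j) (ds (fst j)) * g1 (fst j) m n)).
{ intros [i w] [Hi Hw]; cbn [fst snd] in *.
  rewrite (curve_ell0 _ _ _ _ _ _ _ _ (gamma_curve_on i Hi)). unfold g0. ring. }
apply (curve_integrate D Gam ds dt Zg Tg Wg rho ell gamma_curve_on
    (fun i w => gg i m n w - ell i w * g1 i m n) (fun i w => g' i w m n - g1 i m n) 1); [|easy].
intros i w Hi Hw. rewrite Rmult_minus_distr_l.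
apply (is_derive_minus (gg i m n) (fun w => ell i w * g1 i m n)); [auto|].
apply (is_derive_mult_const (ell i)). now apply (curve_ell _ _ _ _ _ _ _ _ (gamma_curve_on i Hi)).
Qed.

(* This expands <T, W> = 0 along the curve. *)
Lemma test_slope_W : congO DG (fun j => ell (fst j) (snd j) ^ 2)
  (fun j => test_slope (fst j) (Zg (fst j) (snd j)) (fun m => Wg (fst j) m (snd j)))
  (fun j => - (ell (fst j) (snd j) * kap2 (fst j))).
Proof.
assert (HDG : forall j, DG j -> D (fst j)) by now intros j [H _].
assert (BG0 : forall l p q, bigO DG (fun j => Gam l p q (x0 (fst j))) (fun _ => 1)).
{ intros. apply Gam_bigO with (1 := Gam_bd_D) (pr := fst). now apply box_0. }
assert (Bg0 : forall m n, bigO DG (fun j => g0 (fst j) m n) (fun _ => 1)).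
{ intros. now apply g0_bd. }
assert (Btau : forall m, bigO DG (fun j => tau (fst j) m) (fun _ => 1)).
{ intros. now apply tau_bd. }
assert (BW0 : forall m, bigO DG (fun j => W0 (fst j) m) (fun _ => 1)).
{ intros. now apply W0_bd. }
assert (Bell : bigO DG (fun j => ell (fst j) (snd j)) (fun _ => 1)).
{ apply bigO_ext with (2 := ell_bigO_1 1). intros; ring. }
assert (Bacc : forall m, bigO DG (fun j => W0 (fst j) m - acc0 (fst j) m) (fun _ => 1)).
{ intros m. apply bigO_minus; [easy|].
  apply (quad_bigO_1 D box M Gam Gam_bd_D DG fst (fun j => x0 (fst j))
    (fun p j => tau (fst j) p) (fun p j => tau (fst j) p)); auto. now apply box_0. }
assert (Bg1 : forall m n, bigO DG (fun j => g1 (fst j) m n) (fun _ => 1)).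
{ intros. apply bigO_sum. intros l. apply bigO_sum. intros k.
  apply bigO_mult_l; auto. apply bigO_plus; now apply bigO_mult_l. }
set (el := fun j : string_data * R => ell (fst j) (snd j)) in *.
apply congO_trans with (fun j => con (omega (fst j)) (fun m => Wg (fst j) m (snd j)
   + quad Gam (x0 (fst j)) (fun p => el j * tau (fst j) p) (fun q => Wg (fst j) q (snd j)) m)).
{ apply con_congO; [intros; now apply omega_bd|]. intros m.
  apply congO_plus; [apply congO_refl|].
  apply congO_sum. intros p. apply congO_sum. intros q.
  apply congO_mult; [|apply congO_refl|apply Wg_bd|].
  - apply congO_mult; auto using congO_refl.
    + apply bigO_ext with (2 := g_position_2 p). intros j _. unfold rel, el. ring.
    + apply bigO_ext with (fun j => (crd p (Zg (fst j) (snd j)) - crd p (x0 (fst j)))); [intros; unfold rel; ring|].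
      apply bigO_trans with (1 := g_position_1 p). apply ell_bigO_1.
  - apply bigO_mult_l; [easy|]. now apply bigO_mult_l. }
assert (Z : congO DG (fun j => el j ^ 2) (fun j => 0)
  (fun j => form (fun m n => g0 (fst j) m n + el j * g1 (fst j) m n)
     (fun m => tau (fst j) m + el j * (W0 (fst j) m - acc0 (fst j) m))
     (fun n => Wg (fst j) n (snd j)))).
{ apply congO_trans with (fun j => form (fun m n => gg (fst j) m n (snd j))
    (fun m => Tg (fst j) m (snd j)) (fun n => Wg (fst j) n (snd j))).
  - apply congO_eq. intros [i w] [Hi Hw]; cbn [fst snd] in *. symmetry.
    now apply (c_orth _ _ _ (HD i Hi)).
  - apply congO_sum. intros m. apply congO_sum. intros n.
    apply congO_mult; [|apply congO_refl|apply Wg_bd|].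
    + apply congO_mult; [apply gg_expansion|apply g_velocity_2|apply Tg_bd|].
      apply bigO_plus; [easy|]. now apply bigO_mult_l.
    + apply bigO_mult_l; apply bigO_plus; auto; now apply bigO_mult_l. }
assert (BW : congO DG (fun j => el j ^ 2)
  (fun j => el j * form (g0 (fst j)) (W0 (fst j)) (fun n => Wg (fst j) n (snd j)))
  (fun j => el j * kap2 (fst j))).
{ apply bigO_ext with (fun j => el j ^ 1 *
    (form (g0 (fst j)) (W0 (fst j)) (fun n => Wg (fst j) n (snd j)) - kap2 (fst j))).
    intros; ring.
  apply bigO_le with (fun j => el j ^ 1 * el j ^ 1); [intros; lra|].
  apply bigO_mult; [exact (ell_pow_bigO 1)|].
  apply congO_sum. intros m. apply congO_sum. intros n.
  apply congO_mult; [apply congO_refl|apply Wg_lip|apply Wg_bd|]. now apply bigO_mult_l. }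
(* In the first-order term of [form], [g1] contributes [g0(acc0, W)], which cancels the Christoffel
   part of the velocity, and [omega(Gamma(tau, W))], which is the Christoffel term of the slope.
   There remains [ell * g0(W0, W)], that is [ell * kap2] up to [O(ell ^ 2)]. *)
apply bigO_ext with (fun j =>
  (form (fun m n => g0 (fst j) m n + el j * g1 (fst j) m n)
     (fun m => tau (fst j) m + el j * (W0 (fst j) m - acc0 (fst j) m))
     (fun n => Wg (fst j) n (snd j)) - 0)
  - el j ^ 2 * form (g1 (fst j)) (fun m => W0 (fst j) m - acc0 (fst j) m)
     (fun n => Wg (fst j) n (snd j))
  - (el j * form (g0 (fst j)) (W0 (fst j)) (fun n => Wg (fst j) n (snd j))
      - el j * kap2 (fst j))).
{ intros j Hj. assert (Hi := HDG j Hj).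
  assert (Hs := g0_sym (fst j) ax1 ax2 Hi).
  assert (HG : forall l, Gam l ax1 ax2 (x0 (fst j)) = Gam l ax2 ax1 (x0 (fst j))).
  { intros l. apply (c_Gam_sym _ _ _ (HD _ Hi)).
    apply (box_0 D (fun i => i) (fun i H => H) _ Hi). }
  fold (el j).
  unfold form, con, omega, acc0, g1, quad, sum_axis. rewrite Hs, !HG. ring. }
apply bigO_minus; [apply bigO_minus|]; [exact (congO_sym _ _ _ _ Z)| |exact BW].
apply bigO_mult_r; [exact (ell_pow_bigO 2)|].
apply bigO_sum. intros m. apply bigO_sum. intros n.
apply bigO_mult_l; [|apply Wg_bd]. now apply bigO_mult_l.
Qed.

Lemma geod_comp_pos bx d Z V (f : R -> R) w r m :
  geodesic_on Gam bx M d Z V -> is_derive f w r -> Rabs (f w) < d ->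
  is_derive (fun x => crd m (Z (f x))) w (r * V m (f w)).
Proof.
intros H Hf Hd. apply (is_derive_comp (fun x => crd m (Z x)) f); [|easy].
now apply (geod_pos _ _ _ _ _ _ H).
Qed.

Lemma geod_comp_vel bx d Z V (f : R -> R) w r m :
  geodesic_on Gam bx M d Z V -> is_derive f w r -> Rabs (f w) < d ->
  is_derive (fun x => V m (f x)) w
    (r * (0 - quad Gam (Z (f w)) (fun p => V p (f w)) (fun q => V q (f w)) m)).
Proof.
intros H Hf Hd. rewrite Rminus_0_l. apply (is_derive_comp (V m) f); [|easy].
now apply (geod_vel _ _ _ _ _ _ H).
Qed.

Lemma test_slope_0 i z : test_slope i z (fun _ => 0) = 0.
Proof. unfold test_slope, con, quad, sum_axis. ring. Qed.

Lemma geod_test_fun i bx Z V (f : R -> R) w r : D i ->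
  geodesic_on Gam bx M (del i) Z V -> is_derive f w r -> Rabs (f w) < del i ->
  is_derive (fun x => test_fun i (Z (f x))) w (r * test_slope i (Z (f w)) (fun m => V m (f w))).
Proof.
intros Hi H Hf Hd. apply (test_fun_derive i (fun x => Z (f x)) (fun m => V m (f w))); [easy|].
intros m. now apply geod_comp_pos with (1 := H).
Qed.

Lemma geod_test_slope i bx Z V (f : R -> R) w r : D i ->
  geodesic_on Gam bx M (del i) Z V -> is_derive f w r -> Rabs (f w) < del i ->
  is_derive (fun x => test_slope i (Z (f x)) (fun m => V m (f x))) w
    (r * test_hess i (Z (f w)) (fun m => V m (f w))).
Proof.
intros Hi H Hf Hd.
rewrite <- (Rplus_0_r (test_hess _ _ _)), <- (test_slope_0 i (Z (f w))).
apply (test_slope_derive i (fun x => Z (f x)) (fun m x => V m (f x)) (fun _ => 0)).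
- intros m. now apply geod_comp_pos with (1 := H).
- intros m. now apply geod_comp_vel with (1 := H).
Qed.

Lemma A_del i w : D i -> 0 <= w <= lam i -> Rabs w < del i.
Proof. intros Hi Hw. exact (DA_del (i, w) (conj Hi Hw)). Qed.

(** With the term in [kap2] moved to the left, the derivative in arc length is a difference of
    Hessians plus the remainder of [test_slope_W], both [O(ell ^ 2)]. *)
Lemma ga_test_slope : congO DG (fun j => ell (fst j) (snd j) ^ 3)
  (fun j => test_slope (fst j) (Zg (fst j) (snd j)) (fun m => Tg (fst j) m (snd j)))
  (fun j => test_slope (fst j) (Za (fst j) (ell (fst j) (snd j)))
      (fun m => Va (fst j) m (ell (fst j) (snd j)))
    - ell (fst j) (snd j) ^ 2 / 2 * kap2 (fst j)).
Proof.
assert (HDG : forall j, DG j -> D (fst j)) by now intros j [H _].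
set (F := fun i w => (test_slope i (Zg i w) (fun m => Tg i m w)
   - test_slope i (Za i (ell i w)) (fun m => Va i m (ell i w))) + ell i w ^ 2 / 2 * kap2 i).
apply bigO_ext with (fun j => F (fst j) (snd j) - F (fst j) (ds (fst j))).
{ intros [i w] [Hi Hw]; cbn [fst snd] in *. unfold F.
  rewrite (curve_ell0 _ _ _ _ _ _ _ _ (gamma_curve_on i Hi)), Za0 by easy.
  unfold test_slope, con, quad, sum_axis. rewrite !Va0 by easy. unfold tau, x0. field. }
apply (curve_integrate D Gam ds dt Zg Tg Wg rho ell gamma_curve_on F
  (fun i w => ((test_hess i (Zg i w) (fun m => Tg i m w) + test_slope i (Zg i w) (fun m => Wg i m w))
    - test_hess i (Za i (ell i w)) (fun m => Va i m (ell i w))) + ell i w * kap2 i) 2).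
- intros i w Hi Hw. unfold F. rewrite Rmult_plus_distr_l, Rmult_minus_distr_l.
  assert (Hl := curve_ell _ _ _ _ _ _ _ _ (gamma_curve_on i Hi) w Hw).
  apply (is_derive_plus (fun w => test_slope i (Zg i w) (fun m => Tg i m w)
   - test_slope i (Za i (ell i w)) (fun m => Va i m (ell i w)))).
  + apply (is_derive_minus (fun w => test_slope i (Zg i w) (fun m => Tg i m w))).
    * apply (test_slope_derive i (Zg i) (Tg i) (fun m => Wg i m w)); intros m.
      -- now apply (curve_pos _ _ _ _ _ _ _ _ (gamma_curve_on i Hi)).
      -- now apply (curve_vel _ _ _ _ _ _ _ _ (gamma_curve_on i Hi)).
    * apply (geod_test_slope i (box i)); [easy|apply (c_A _ _ _ (HD i Hi))|easy|].
      apply A_del; [easy|]. exact (DG_ell (i, w) (conj Hi Hw)).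
  + rewrite <- Rmult_assoc. apply (is_derive_mult_const (fun w => ell i w ^ 2 / 2)).
    auto_derive; [now exists (rho i w)|].
    replace (Derive (fun x => ell i x) w) with (rho i w); [field|].
    symmetry. now apply is_derive_unique.
- apply bigO_ext with (fun j => (test_hess (fst j) (Zg (fst j) (snd j)) (fun m => Tg (fst j) m (snd j))
    - test_hess (fst j) (Za (fst j) (ell (fst j) (snd j))) (fun m => Va (fst j) m (ell (fst j) (snd j))))
    + (test_slope (fst j) (Zg (fst j) (snd j)) (fun m => Wg (fst j) m (snd j))
       - - (ell (fst j) (snd j) * kap2 (fst j)))); [intros; ring|].
  apply bigO_plus; [|apply test_slope_W].
  assert (Hdel : forall j, DG j -> Rabs (ell (fst j) (snd j)) < del (fst j)).
  { intros j Hj. apply A_del; [now apply HDG|now apply DG_ell]. }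
  assert (E1 : forall f, bigO DG f (fun j => ell (fst j) (snd j) ^ 1) ->
     bigO DG f (fun j => ell (fst j) (snd j))).
  { intros f. apply bigO_le. intros; lra. }
  apply (test_hess_congO DG fst (fun j => Zg (fst j) (snd j)) (fun j => Za (fst j) (ell (fst j) (snd j)))
    (fun m j => Tg (fst j) m (snd j)) (fun m j => Va (fst j) m (ell (fst j) (snd j)))
    (fun j => ell (fst j) (snd j))).
  + exact HDG.
  + apply box_g.
  + now apply box_a.
  + apply Tg_bd.
  + intros m. now apply Va_bd.
  + intros m. apply E1, g_position_1.
  + intros m. apply E1. exact (congO_DA_DG _ _ _ (a_position_1 m)).
  + apply ga_position_2.
  + intros m. apply E1, ga_velocity_1.
  + intros j Hj. generalize (DG_ell j Hj) (lam_bounds _ (HDG j Hj)). lra.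
Qed.

Lemma ga_test_fun : congO DG (fun j => ell (fst j) (snd j) ^ 4)
  (fun j => test_fun (fst j) (Zg (fst j) (snd j)))
  (fun j => test_fun (fst j) (Za (fst j) (ell (fst j) (snd j)))
    - ell (fst j) (snd j) ^ 3 / 6 * kap2 (fst j)).
Proof.
set (F := fun i w => (test_fun i (Zg i w) - test_fun i (Za i (ell i w))) + ell i w ^ 3 / 6 * kap2 i).
apply bigO_ext with (fun j => F (fst j) (snd j) - F (fst j) (ds (fst j))).
{ intros [i w] [Hi Hw]; cbn [fst snd] in *. unfold F.
  rewrite (curve_ell0 _ _ _ _ _ _ _ _ (gamma_curve_on i Hi)), Za0 by easy. unfold x0. field. }
apply (curve_integrate D Gam ds dt Zg Tg Wg rho ell gamma_curve_on F
  (fun i w => (test_slope i (Zg i w) (fun m => Tg i m w)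
    - test_slope i (Za i (ell i w)) (fun m => Va i m (ell i w))) + ell i w ^ 2 / 2 * kap2 i) 3).
- intros i w Hi Hw. unfold F. rewrite Rmult_plus_distr_l, Rmult_minus_distr_l.
  assert (Hl := curve_ell _ _ _ _ _ _ _ _ (gamma_curve_on i Hi) w Hw).
  apply (is_derive_plus (fun w => test_fun i (Zg i w) - test_fun i (Za i (ell i w)))).
  + apply (is_derive_minus (fun w => test_fun i (Zg i w))).
    * apply (test_fun_derive i (Zg i) (fun m => Tg i m w)); [easy|]; intros m.
      now apply (curve_pos _ _ _ _ _ _ _ _ (gamma_curve_on i Hi)).
    * apply (geod_test_fun i (box i)); [easy|apply (c_A _ _ _ (HD i Hi))|easy|].
      apply A_del; [easy|]. exact (DG_ell (i, w) (conj Hi Hw)).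
  + rewrite <- Rmult_assoc. apply (is_derive_mult_const (fun w => ell i w ^ 3 / 6)).
    auto_derive; [now exists (rho i w)|].
    replace (Derive (fun x => ell i x) w) with (rho i w); [field|].
    symmetry. now apply is_derive_unique.
- apply bigO_ext with (2 := ga_test_slope). intros; ring.
Qed.

(* along the tangent geodesic at the first end point, [test_fun] is almost the
   arc length *)
Lemma a_test_slope : bigO DA
  (fun j => test_slope (fst j) (Za (fst j) (snd j)) (fun m => Va (fst j) m (snd j)) - 1)
  (fun j => lam (fst j)).
Proof.
assert (HDA : forall j, DA j -> D (fst j)) by now intros j [H _].
apply bigO_le with (fun j => snd j ^ 1).
{ intros [i w] [Hi Hw]; cbn in *. lra. }
set (F := fun i w => test_slope i (Za i w) (fun m => Va i m w)).
apply bigO_ext with (fun j => F (fst j) (snd j) - F (fst j) 0).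
{ intros [i w] [Hi Hw]; cbn [fst snd] in *. f_equal.
  unfold F. rewrite Za0 by easy. rewrite <- (con_omega_tau i Hi).
  unfold test_slope, con, quad, rel, sum_axis. rewrite !Va0 by easy. ring. }
apply (curve_integrate D Gam (fun _ => 0) lam Za Va (fun _ _ _ => 0) (fun _ _ => 1) (fun _ w => w)
  geodesic_curve_on F (fun i w => test_hess i (Za i w) (fun m => Va i m w)) 0).
- intros i w Hi Hw. apply (geod_test_slope i (box i) (Za i) (Va i) (fun w => w)); [easy| | |].
  + apply (c_A _ _ _ (HD i Hi)).
  + apply (is_derive_id (K := R_AbsRing)).
  + now apply A_del.
- apply con_bigO; [intros m; now apply omega_bd|]. intros m.
  assert (B := Va_bd_arc). assert (Bx := box_a_arc). assert (Bx0 := box_0 DA fst HDA).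
  assert (BQ : forall m, bigO DA (fun j => quad Gam (Za (fst j) (snd j))
     (fun p => Va (fst j) p (snd j)) (fun p => Va (fst j) p (snd j)) m) (fun _ => 1)).
  { intros m'. now apply (quad_bigO_1 D box M Gam Gam_bd_D DA fst (fun j => Za (fst j) (snd j))
     (fun p j => Va (fst j) p (snd j)) (fun p j => Va (fst j) p (snd j))). }
  apply bigO_minus; [apply bigO_minus|].
  + now apply (quad_bigO_1 D box M Gam Gam_bd_D DA fst (fun j => x0 (fst j))
     (fun p j => Va (fst j) p (snd j)) (fun p j => Va (fst j) p (snd j))).
  + apply BQ.
  + apply (quad_bigO_1 D box M Gam Gam_bd_D DA fst (fun j => x0 (fst j))
     (fun p j => rel (fst j) (Za (fst j) (snd j)) p)
     (fun q j => quad Gam (Za (fst j) (snd j))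
     (fun p => Va (fst j) p (snd j)) (fun p => Va (fst j) p (snd j)) q)); [easy| |easy].
    intros p. apply bigO_le with (fun j => snd j ^ 1); [|apply a_position_1].
    intros [i w] [Hi Hw]; cbn in *. generalize (lam_bounds i Hi). lra.
Qed.

(** * Excess length of the two tangents over the arc *)

Section StringLength.
Hypothesis Hu : forall i, D i -> 0 <= u i <= lam i.
Hypothesis Hv : forall i, D i -> - lam i <= v i <= 0.
Hypothesis Hmid : bigO D (fun i => lam i / 2 + v i) (fun i => lam i ^ 2).
Hypothesis Hexc : bigO D excess (fun i => lam i ^ 2).

(** [Zb] is followed backwards from the second end point, at parameter 0, to the meeting point at
    [v <= 0]. The point of [Za] compared with parameter [w] is at [lam + w]. *)
Definition DB := seg D v (fun _ => 0).

Lemma DB_D j : DB j -> D (fst j).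
Proof. now intros [H _]. Qed.

Lemma DB_lo i : D i -> DB (i, v i).
Proof. intros Hi. split; [easy|]. cbn. generalize (Hv i Hi). lra. Qed.

Lemma DB_del j : DB j -> Rabs (snd j) < del (fst j).
Proof.
destruct j as [i w]; intros [Hi Hw]; cbn in *.
generalize (Hv i Hi) (c_lam _ _ _ (HD i Hi)). intros. apply Rabs_def1; lra.
Qed.

Lemma DB_DA j : DB j -> 0 <= lam (fst j) + snd j <= lam (fst j).
Proof.
destruct j as [i w]; intros [Hi Hw]; cbn in *. generalize (Hv i Hi). lra.
Qed.

Lemma DB_Adel j : DB j -> Rabs (lam (fst j) + snd j) < del (fst j).
Proof. intros Hj. apply A_del; [now apply DB_D|now apply DB_DA]. Qed.

(** The segment is no longer than [lam], so integrating gains a power of [lam]. *)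
Lemma back_integrate (F G : string_data -> R -> R) n :
  (forall i w, DB (i, w) -> is_derive (F i) w (G i w)) ->
  bigO DB (fun j => G (fst j) (snd j)) (fun j => lam (fst j) ^ n) ->
  bigO DB (fun j => F (fst j) (snd j) - F (fst j) 0) (fun j => lam (fst j) ^ S n).
Proof.
intros HF [C [PC HC]]. exists C. split; [easy|].
intros [i w] [Hi Hw]; cbn [fst snd] in *.
assert (Hl := lam_bounds i Hi). assert (Hv' := Hv i Hi).
apply Rle_trans with (C * lam i ^ n * Rabs (w - 0)).
- apply mean_value_abs_le with (G i).
  + intros x Hx. rewrite Rmin_right, Rmax_left in Hx by lra. apply HF. split; cbn; [easy|lra].
  + intros x Hx. rewrite Rmin_right, Rmax_left in Hx by lra.
    apply (HC (i, x)). split; cbn; [easy|lra].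
- rewrite Rmult_assoc. apply Rmult_le_compat_l; [easy|]. rewrite <- tech_pow_Rmult, Rmult_comm.
  apply Rmult_le_compat_r; [apply pow_le; lra|]. apply Rabs_le; lra.
Qed.

Lemma back_integrate_0 (F G : string_data -> R -> R) n :
  (forall i w, DB (i, w) -> is_derive (F i) w (G i w)) ->
  bigO DB (fun j => G (fst j) (snd j)) (fun j => lam (fst j) ^ n) ->
  bigO D (fun i => F i 0) (fun i => lam i ^ S n) ->
  bigO DB (fun j => F (fst j) (snd j)) (fun j => lam (fst j) ^ S n).
Proof.
intros HF HG H0. apply bigO_ext with (fun j => (F (fst j) (snd j) - F (fst j) 0) + F (fst j) 0).
  intros; ring.
apply bigO_plus; [now apply back_integrate with G|].
apply (bigO_comp D DB fst _ _ DB_D H0).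
Qed.

Lemma shift_derive l w : is_derive (fun x => l + x) w 1.
Proof. auto_derive; [easy|ring]. Qed.

Lemma box_bB : in_box D box DB fst (fun j => Zb (fst j) (snd j)).
Proof. apply box_b; [apply DB_D|apply DB_del]. Qed.

Lemma box_aB : in_box D box DB fst (fun j => Za (fst j) (lam (fst j) + snd j)).
Proof. apply box_a; [apply DB_D|apply DB_Adel]. Qed.

Lemma Vb_bdB m : bigO DB (fun j => Vb (fst j) m (snd j)) (fun _ => 1).
Proof. apply Vb_bd; [apply DB_D|apply DB_del]. Qed.

Lemma Va_bdB m : bigO DB (fun j => Va (fst j) m (lam (fst j) + snd j)) (fun _ => 1).
Proof. apply Va_bd; [apply DB_D|apply DB_Adel]. Qed.

Lemma ba_velocity m : congO DB (fun j => lam (fst j) ^ 1)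
  (fun j => Vb (fst j) m (snd j)) (fun j => Va (fst j) m (lam (fst j) + snd j)).
Proof.
apply (back_integrate_0 (fun i w => Vb i m w - Va i m (lam i + w))
  (fun i w => - quad Gam (Zb i w) (fun p => Vb i p w) (fun q => Vb i q w) m
     - 1 * (0 - quad Gam (Za i (lam i + w)) (fun p => Va i p (lam i + w)) (fun q => Va i q (lam i + w)) m)) 0).
- intros i w Hj. apply (is_derive_minus (Vb i m) (fun w => Va i m (lam i + w))).
  + apply (geod_vel _ _ _ _ _ _ (c_B _ _ _ (HD i (proj1 Hj)))). exact (DB_del _ Hj).
  + apply (geod_comp_vel (box i) (del i) (Za i) (Va i) (fun w => lam i + w)).
    * apply (c_A _ _ _ (HD i (proj1 Hj))).
    * apply shift_derive.
    * exact (DB_Adel _ Hj).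
- cbn [pow]. apply bigO_ext with (fun j =>
   quad Gam (Za (fst j) (lam (fst j) + snd j)) (fun p => Va (fst j) p (lam (fst j) + snd j)) (fun q => Va (fst j) q (lam (fst j) + snd j)) m
   - quad Gam (Zb (fst j) (snd j)) (fun p => Vb (fst j) p (snd j)) (fun q => Vb (fst j) q (snd j)) m).
     intros; ring.
  apply bigO_minus.
  + apply (quad_bigO_1 D box M Gam Gam_bd_D DB fst (fun j => Za (fst j) (lam (fst j) + snd j))
      (fun p j => Va (fst j) p (lam (fst j) + snd j)) (fun p j => Va (fst j) p (lam (fst j) + snd j)));
      auto using box_aB, Va_bdB.
  + apply (quad_bigO_1 D box M Gam Gam_bd_D DB fst (fun j => Zb (fst j) (snd j))
      (fun p j => Vb (fst j) p (snd j)) (fun p j => Vb (fst j) p (snd j)));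
      auto using box_bB, Vb_bdB.
- apply bigO_le with lam; [intros; lra|]. apply bigO_ext with (2 := end_velocity_1 m).
  intros i Hi. now rewrite Rplus_0_r, (c_VB0 _ _ _ (HD i Hi)).
Qed.

Lemma ba_position m : congO DB (fun j => lam (fst j) ^ 2)
  (fun j => crd m (Zb (fst j) (snd j))) (fun j => crd m (Za (fst j) (lam (fst j) + snd j))).
Proof.
apply (back_integrate_0 (fun i w => crd m (Zb i w) - crd m (Za i (lam i + w)))
  (fun i w => Vb i m w - 1 * Va i m (lam i + w)) 1).
- intros i w Hj. apply (is_derive_minus (fun w => crd m (Zb i w)) (fun w => crd m (Za i (lam i + w)))).
  + apply (geod_pos _ _ _ _ _ _ (c_B _ _ _ (HD i (proj1 Hj)))). exact (DB_del _ Hj).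
  + apply (geod_comp_pos (box i) (del i) (Za i) (Va i) (fun w => lam i + w)).
    * apply (c_A _ _ _ (HD i (proj1 Hj))).
    * apply shift_derive.
    * exact (DB_Adel _ Hj).
- apply bigO_ext with (2 := ba_velocity m). intros; ring.
- apply bigO_ext with (2 := congO_hi _ _ _ (ga_position_2 m)).
  intros i Hi. now rewrite Rplus_0_r, (c_B0 _ _ _ (HD i Hi)).
Qed.

(** Both curves are geodesics, so only the difference of their Hessians changes the discrepancy of
    slopes; its value at the second end point, known from [ga_test_slope], persists up to
    [O(lam ^ 3)]. *)
Lemma ba_test_slope : bigO DB
  (fun j => (test_slope (fst j) (Zb (fst j) (snd j)) (fun m => Vb (fst j) m (snd j))
    - test_slope (fst j) (Za (fst j) (lam (fst j) + snd j)) (fun m => Va (fst j) m (lam (fst j) + snd j)))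
    + lam (fst j) ^ 2 / 2 * kap2 (fst j)) (fun j => lam (fst j) ^ 3).
Proof.
apply (back_integrate_0 (fun i w => (test_slope i (Zb i w) (fun m => Vb i m w)
    - test_slope i (Za i (lam i + w)) (fun m => Va i m (lam i + w))) + lam i ^ 2 / 2 * kap2 i)
  (fun i w => (1 * test_hess i (Zb i w) (fun m => Vb i m w)
    - 1 * test_hess i (Za i (lam i + w)) (fun m => Va i m (lam i + w))) + 0) 2).
- intros i w Hj. apply (is_derive_plus (fun w => test_slope i (Zb i w) (fun m => Vb i m w)
    - test_slope i (Za i (lam i + w)) (fun m => Va i m (lam i + w)))).
  2: apply is_derive_Reals, derivable_pt_lim_const.
  apply (is_derive_minus (fun w => test_slope i (Zb i w) (fun m => Vb i m w))).
  + apply (geod_test_slope i (box i) (Zb i) (Vb i) (fun w => w)); [apply Hj| | |].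
    * apply (c_B _ _ _ (HD i (proj1 Hj))).
    * apply (is_derive_id (K := R_AbsRing)).
    * exact (DB_del _ Hj).
  + apply (geod_test_slope i (box i) (Za i) (Va i) (fun w => lam i + w)); [apply Hj| | |].
    * apply (c_A _ _ _ (HD i (proj1 Hj))).
    * apply shift_derive.
    * exact (DB_Adel _ Hj).
- assert (L1 : forall f, bigO DB f (fun j => lam (fst j) ^ 1) -> bigO DB f (fun j => lam (fst j))).
  { intros f. apply bigO_le. intros; lra. }
  assert (A0 : forall m, congO DB (fun j => lam (fst j))
    (fun j => crd m (Za (fst j) (lam (fst j) + snd j))) (fun j => crd m (x0 (fst j)))).
  { intros m. apply bigO_le with (2 := bigO_comp DA DB (fun j => (fst j, lam (fst j) + snd j)) _ _
     (fun j Hj => conj (DB_D j Hj) (DB_DA j Hj)) (a_position_1 m)).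
    intros j Hj. cbn [fst snd]. generalize (DB_DA j Hj). lra. }
  eapply bigO_ext; [|apply (test_hess_congO DB fst (fun j => Zb (fst j) (snd j))
    (fun j => Za (fst j) (lam (fst j) + snd j))
    (fun m j => Vb (fst j) m (snd j)) (fun m j => Va (fst j) m (lam (fst j) + snd j))
    (fun j => lam (fst j)))]; auto using DB_D, box_bB, box_aB, Va_bdB, Vb_bdB, ba_position.
  + intros; cbn; ring.
  + intros m. apply congO_trans with (2 := A0 m).
    apply bigO_le with (2 := ba_position m). intros j Hj.
    rewrite <- (pow_1 (lam _)) at 2. apply lam_pow_le; [lia|now apply DB_D].
  + intros m. apply L1, ba_velocity.
  + intros j Hj. generalize (lam_bounds _ (DB_D j Hj)). lra.
- apply bigO_ext with (2 := congO_hi _ _ _ ga_test_slope).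
  intros i Hi. cbn [fst snd]. rewrite Rplus_0_r, (c_B0 _ _ _ (HD i Hi)).
  unfold test_slope, con, quad, sum_axis. rewrite !(c_VB0 _ _ _ (HD i Hi)).
  unfold lam. ring.
Qed.

(** The nearly constant discrepancy of slopes integrates to the term linear in [v]; [lam ^ 3 / 6] is
    the discrepancy of values at the second end point. At [v = - lam / 2] the bracket equals
    [- lam ^ 3 / 12]. *)
Lemma b_test_fun : bigO D
  (fun i => test_fun i (Zb i (v i)) - test_fun i (Za i (lam i + v i))
    + (lam i ^ 2 / 2 * v i + lam i ^ 3 / 6) * kap2 i) (fun i => lam i ^ 4).
Proof.
refine (bigO_comp DB D (fun i => (i, v i)) (fun j =>
    test_fun (fst j) (Zb (fst j) (snd j)) - test_fun (fst j) (Za (fst j) (lam (fst j) + snd j))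
    + (lam (fst j) ^ 2 / 2 * snd j + lam (fst j) ^ 3 / 6) * kap2 (fst j))
  (fun j => lam (fst j) ^ 4) DB_lo _).
apply (back_integrate_0 (fun i w => (test_fun i (Zb i w) - test_fun i (Za i (lam i + w)))
    + (lam i ^ 2 / 2 * w + lam i ^ 3 / 6) * kap2 i)
  (fun i w => (1 * test_slope i (Zb i w) (fun m => Vb i m w)
    - 1 * test_slope i (Za i (lam i + w)) (fun m => Va i m (lam i + w)))
    + lam i ^ 2 / 2 * kap2 i) 3).
- intros i w Hj. apply (is_derive_plus (fun w => test_fun i (Zb i w) - test_fun i (Za i (lam i + w)))).
  2: auto_derive; [easy|field].
  apply (is_derive_minus (fun w => test_fun i (Zb i w))).
  + apply (geod_test_fun i (box i) (Zb i) (Vb i) (fun w => w)); [apply Hj| | |].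
    * apply (c_B _ _ _ (HD i (proj1 Hj))).
    * apply (is_derive_id (K := R_AbsRing)).
    * exact (DB_del _ Hj).
  + apply (geod_test_fun i (box i) (Za i) (Va i) (fun w => lam i + w)); [apply Hj| | |].
    * apply (c_A _ _ _ (HD i (proj1 Hj))).
    * apply shift_derive.
    * exact (DB_Adel _ Hj).
- apply bigO_ext with (2 := ba_test_slope). intros; ring.
- apply bigO_ext with (2 := congO_hi _ _ _ ga_test_fun).
  intros i Hi. cbn [fst snd]. rewrite !Rplus_0_r, (c_B0 _ _ _ (HD i Hi)).
  fold (lam i). ring.
Qed.

Lemma kap2_bd : bigO D kap2 (fun _ => 1).
Proof.
apply bigO_sum. intros m. apply bigO_sum. intros n.
apply bigO_mult_l; [|now apply (W0_bd D (fun i => i))].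
apply bigO_mult_l; [now apply (g0_bd D (fun i => i))|now apply (W0_bd D (fun i => i))].
Qed.

(** As [Zb] at [v] is [Za] at [u], both values of [test_fun] are taken on one geodesic, at
    parameters whose difference [u - (lam + v)] is [- excess]. The second summand is the failure of
    [test_fun] to be arc length there, left for a separate estimate. *)
Lemma excess_relation : bigO D (fun i => (- excess i - kap2 i * lam i ^ 3 / 12)
    + (test_fun i (Za i (u i)) - test_fun i (Za i (lam i + v i)) - - excess i))
  (fun i => lam i ^ 4).
Proof.
apply bigO_ext with (fun i => (test_fun i (Zb i (v i)) - test_fun i (Za i (lam i + v i))
    + (lam i ^ 2 / 2 * v i + lam i ^ 3 / 6) * kap2 i)
  - lam i ^ 2 * (lam i / 2 + v i) * (/ 2 * kap2 i)).
{ intros i Hi. rewrite (c_meet _ _ _ (HD i Hi)). field. }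
apply bigO_minus; [apply b_test_fun|].
(* Replacing [v] by [- lam / 2] is affordable: the midpoint error [lam ^ 2] comes with a coefficient
   [lam ^ 2]. *)
apply bigO_le with (fun i => lam i ^ 2 * lam i ^ 2); [intros; lra|].
apply bigO_mult_r; [|apply bigO_mult_l; [apply bigO_const|apply kap2_bd]].
apply bigO_mult; [apply lam_pow_bigO|easy].
Qed.

(** Between the two parameters, at distance [Rabs (excess i)], the slope of [test_fun] on [Za] is 1
    up to [O(lam)]. *)
Lemma excess_defect : bigO D
  (fun i => test_fun i (Za i (u i)) - test_fun i (Za i (lam i + v i)) - - excess i)
  (fun i => lam i * Rabs (excess i)).
Proof.
destruct a_test_slope as [C [PC HC]]. exists C. split; [easy|]. intros i Hi.
replace (test_fun i (Za i (u i)) - test_fun i (Za i (lam i + v i)) - - excess i)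
  with ((test_fun i (Za i (u i)) - u i) - (test_fun i (Za i (lam i + v i)) - (lam i + v i)))
  by (unfold excess; ring).
replace (Rabs (excess i)) with (Rabs (u i - (lam i + v i))).
2:{ rewrite <- Rabs_Ropp. f_equal. unfold excess. ring. }
rewrite <- Rmult_assoc.
assert (Hb : forall x, Rmin (lam i + v i) (u i) <= x <= Rmax (lam i + v i) (u i) ->
  0 <= x <= lam i).
{ intros x. generalize (Hu i Hi) (Hv i Hi). unfold Rmin, Rmax. destruct Rle_dec; lra. }
apply (mean_value_abs_le (fun w => test_fun i (Za i w) - w)
  (fun w => 1 * test_slope i (Za i w) (fun m => Va i m w) - 1)).
- intros x Hx. apply (is_derive_minus (fun w => test_fun i (Za i w)) (fun w => w)).
  + apply (geod_test_fun i (box i) (Za i) (Va i) (fun w => w)); [easy| | |].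
    * apply (c_A _ _ _ (HD i Hi)).
    * apply (is_derive_id (K := R_AbsRing)).
    * apply A_del; auto.
  + apply (is_derive_id (K := R_AbsRing)).
- intros x Hx. rewrite Rmult_1_l. apply (HC (i, x)). split; [easy|]. now apply Hb.
Qed.

(** Bootstrap: the defect is [lam] times the excess, so a bound [lam ^ n] on the excess gives the
    expansion with remainder [lam ^ (n + 1)]. [Hexc] starts it at [n = 2]; the main term then gives
    excess [O(lam ^ 3)], and a second round ends with [lam ^ 4]. *)
Lemma string_length_bigO :
  bigO D (fun i => - excess i - kap2 i * lam i ^ 3 / 12) (fun i => lam i ^ 4).
Proof.
assert (step : forall n, (n <= 3)%nat -> bigO D excess (fun i => lam i ^ n) ->
  bigO D (fun i => - excess i - kap2 i * lam i ^ 3 / 12) (fun i => lam i ^ S n)).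
{ intros n Hn H.
  apply bigO_ext with (fun i => ((- excess i - kap2 i * lam i ^ 3 / 12)
    + (test_fun i (Za i (u i)) - test_fun i (Za i (lam i + v i)) - - excess i))
    - (test_fun i (Za i (u i)) - test_fun i (Za i (lam i + v i)) - - excess i)); [intros; ring|].
  apply bigO_minus.
  - apply bigO_le with (2 := excess_relation). intros i Hi. apply lam_pow_le; [lia|easy].
  - apply bigO_trans with (1 := excess_defect).
    apply bigO_mult; [|now apply bigO_abs].
    apply bigO_refl. exact lam_ge0. }
apply step; [lia|].
apply bigO_ext with (fun i => - ((- excess i - kap2 i * lam i ^ 3 / 12)
   + lam i ^ 3 * (kap2 i * / 12))); [intros; field|].
apply bigO_opp, bigO_plus; [now apply step; [lia|]|].
apply bigO_mult_r; [apply lam_pow_bigO|].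
apply bigO_mult_r; [apply kap2_bd|apply bigO_const].
Qed.

End StringLength.

End Core.

(** * The curve in a chart *)

Lemma is_derive_form (G dG : axis -> axis -> R -> R) (V dV : axis -> R -> R) (t : R) :
  (forall m n, is_derive (G m n) t (dG m n t)) -> (forall m, is_derive (V m) t (dV m t)) ->
  is_derive (fun s => form (fun m n => G m n s) (fun m => V m s) (fun m => V m s)) t
    (sum_axis (fun m => sum_axis (fun n => dG m n t * V m t * V n t
       + G m n t * dV m t * V n t + G m n t * V m t * dV n t))).
Proof.
intros HG HV. unfold form, sum_axis.
assert (E : forall m n, is_derive (fun s => G m n s * V m s * V n s) t
  (dG m n t * V m t * V n t + G m n t * dV m t * V n t + G m n t * V m t * dV n t)).
{ intros m n. apply is_derive_Reals.
  assert (H1 := HG m n). assert (H2 := HV m). assert (H3 := HV n).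
  apply is_derive_Reals in H1. apply is_derive_Reals in H2. apply is_derive_Reals in H3.
  replace (dG m n t * V m t * V n t + G m n t * dV m t * V n t + G m n t * V m t * dV n t)
    with ((dG m n t * V m t + G m n t * dV m t) * V n t + (G m n t * V m t) * dV n t) by ring.
  apply (derivable_pt_lim_mult (fun s => G m n s * V m s) (V n)); [|easy].
  now apply derivable_pt_lim_mult. }
apply (is_derive_plus (fun s => G ax1 ax1 s * V ax1 s * V ax1 s + G ax1 ax2 s * V ax1 s * V ax2 s)
  (fun s => G ax2 ax1 s * V ax2 s * V ax1 s + G ax2 ax2 s * V ax2 s * V ax2 s));
  [apply (is_derive_plus (fun s => G ax1 ax1 s * V ax1 s * V ax1 s))
  |apply (is_derive_plus (fun s => G ax2 ax1 s * V ax2 s * V ax1 s))]; apply E.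
Qed.

Section Curve.
Context {S : riemannian_surface} (k : chart S) (gamma : R -> S) (alpha beta : R).
Hypothesis Hgamma : C3_curve k gamma alpha beta.

Definition cpos (t : R) : R * R := coord k (gamma t).
Definition vel (m : axis) (t : R) : R := velocity k gamma t m.
Definition speed2 (t : R) : R := inner k (cpos t) (velocity k gamma t) (velocity k gamma t).
Definition acc_vel (t : R) : R :=
  inner k (cpos t) (cov_acceleration k gamma t) (velocity k gamma t).
Definition tangent (m : axis) (t : R) : R := velocity k gamma t m / speed k gamma t.
(** The curvature vector, that is the covariant acceleration with respect to arc length: the
    tangential part is removed and the division by [speed2] accounts for the parameter. *)
Definition curv (m : axis) (t : R) : R :=
  (cov_acceleration k gamma t m - acc_vel t / speed2 t * velocity k gamma t m) / speed2 t.

Lemma img_cpos t : alpha < t < beta -> img k (cpos t).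
Proof. intros Ht. apply img_coord. now apply (proj1 Hgamma). Qed.

Lemma cpos_derive m t : alpha < t < beta -> is_derive (fun s => crd m (cpos s)) t (vel m t).
Proof.
intros Ht. apply Derive_correct. destruct (proj1 Hgamma t Ht) as [_ [H _]].
destruct (H m) as [H1 _]. exact (H1 1%nat ltac:(auto)).
Qed.

Lemma vel_derive m t : alpha < t < beta ->
  is_derive (vel m) t (Derive_n (curve_crd k gamma m) 2 t).
Proof.
intros Ht. apply Derive_correct. destruct (proj1 Hgamma t Ht) as [_ [H _]].
destruct (H m) as [H1 _]. exact (H1 2%nat ltac:(auto)).
Qed.

Lemma acc_derive m t : alpha < t < beta ->
  is_derive (Derive_n (curve_crd k gamma m) 2) t (Derive_n (curve_crd k gamma m) 3 t).
Proof.
intros Ht. apply Derive_correct. destruct (proj1 Hgamma t Ht) as [_ [H _]].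
destruct (H m) as [H1 _]. exact (H1 3%nat ltac:(auto)).
Qed.

Lemma inside_near t : alpha < t < beta -> exists eps, 0 < eps /\
  forall x, Rabs (x - t) < eps -> alpha < x < beta.
Proof.
intros Ht. exists (Rmin (t - alpha) (beta - t)). split; [apply Rmin_pos; lra|].
intros x Hx. assert (H1 := Rlt_le_trans _ _ _ Hx (Rmin_l _ _)).
assert (H2 := Rlt_le_trans _ _ _ Hx (Rmin_r _ _)).
apply Rabs_def2 in H1. apply Rabs_def2 in H2. lra.
Qed.

Lemma acc_loc_lip m t : alpha < t < beta -> loc_lip dist1 (Derive_n (curve_crd k gamma m) 2) t.
Proof.
intros Ht. destruct (inside_near t Ht) as [eps [Pe H]].
apply loc_lip_C1 with (Derive_n (curve_crd k gamma m) 3) eps; [easy| |].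
- intros x Hx. now apply acc_derive, H.
- destruct (proj1 Hgamma t Ht) as [_ [H3 _]]. destruct (H3 m) as [_ C].
  now apply continuity_pt_filterlim.
Qed.

Lemma vel_loc_lip m t : alpha < t < beta -> loc_lip dist1 (vel m) t.
Proof.
intros Ht. destruct (inside_near t Ht) as [eps [Pe H]].
apply loc_lip_C1 with (Derive_n (curve_crd k gamma m) 2) eps; [easy| |].
- intros x Hx. now apply vel_derive, H.
- eapply is_derive_continuity_pt, acc_derive, Ht.
Qed.

Lemma cpos_loc_lip m t : alpha < t < beta -> loc_lip dist1 (fun s => crd m (cpos s)) t.
Proof.
intros Ht. destruct (inside_near t Ht) as [eps [Pe H]].
apply loc_lip_C1 with (vel m) eps; [easy| |].
- intros x Hx. now apply cpos_derive, H.
- eapply is_derive_continuity_pt, vel_derive, Ht.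
Qed.

Lemma metric_cpos_loc_lip m n t : alpha < t < beta ->
  loc_lip dist1 (fun s => metric k m n (cpos s)) t.
Proof.
intros Ht. apply loc_lip_comp; [now apply metric_loc_lip, img_cpos|].
intros; now apply cpos_loc_lip.
Qed.

Lemma cov_acc_loc_lip l t : alpha < t < beta ->
  loc_lip dist1 (fun s => cov_acceleration k gamma s l) t.
Proof.
intros Ht. apply (loc_lip_plus dist1); [now apply acc_loc_lip|].
apply (loc_lip_sum dist1). intros m. apply (loc_lip_sum dist1). intros n.
apply (loc_lip_mult dist1 dist1_ge0); [|now apply vel_loc_lip].
apply (loc_lip_mult dist1 dist1_ge0); [|now apply vel_loc_lip].
apply loc_lip_comp; [now apply christoffel_loc_lip, img_cpos|].
intros; now apply cpos_loc_lip.
Qed.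

Lemma inner_loc_lip (a b : R -> axis -> R) t : alpha < t < beta ->
  (forall m, loc_lip dist1 (fun s => a s m) t) -> (forall m, loc_lip dist1 (fun s => b s m) t) ->
  loc_lip dist1 (fun s => inner k (cpos s) (a s) (b s)) t.
Proof.
intros Ht Ha Hb. apply (loc_lip_sum dist1). intros m. apply (loc_lip_sum dist1). intros n.
apply (loc_lip_mult dist1 dist1_ge0); [|easy].
apply (loc_lip_mult dist1 dist1_ge0); [|easy]. now apply metric_cpos_loc_lip.
Qed.

Lemma speed2_loc_lip t : alpha < t < beta -> loc_lip dist1 speed2 t.
Proof. intros Ht. apply inner_loc_lip; [easy| |]; intros m; now apply vel_loc_lip. Qed.

Lemma speed2_pos t : alpha < t < beta -> 0 < speed2 t.
Proof.
intros Ht. apply inner_pos; [now apply img_cpos|]. now apply (proj1 Hgamma).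
Qed.

Lemma curv_loc_lip m t : alpha < t < beta -> loc_lip dist1 (curv m) t.
Proof.
intros Ht. assert (P := speed2_pos t Ht).
assert (L := speed2_loc_lip t Ht).
apply (loc_lip_div dist1 dist1_ge0 dist1_refl dist1_sym); [|easy|lra].
apply (loc_lip_minus dist1 dist1_ge0); [now apply cov_acc_loc_lip|].
apply (loc_lip_mult dist1 dist1_ge0); [|now apply vel_loc_lip].
apply (loc_lip_div dist1 dist1_ge0 dist1_refl dist1_sym); [|easy|lra].
apply inner_loc_lip; [easy| |]; intros n; [now apply cov_acc_loc_lip|now apply vel_loc_lip].
Qed.

Lemma speed_sq t : alpha < t < beta -> speed k gamma t * speed k gamma t = speed2 t.
Proof. intros Ht. apply sqrt_sqrt. left. now apply speed2_pos. Qed.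

Lemma speed_pos t : alpha < t < beta -> 0 < speed k gamma t.
Proof. intros Ht. apply sqrt_lt_R0. now apply speed2_pos. Qed.

Lemma vel_tangent t m : alpha < t < beta -> vel m t = speed k gamma t * tangent m t.
Proof. intros Ht. assert (H := speed_pos t Ht). unfold tangent, vel. field. lra. Qed.

Lemma metric_cpos_derive m n t : alpha < t < beta ->
  is_derive (fun s => metric k m n (cpos s)) t (sum_axis (fun l => sum_axis (fun q =>
    (metric k n l (cpos t) * christoffel k l q m (cpos t)
     + metric k m l (cpos t) * christoffel k l q n (cpos t)) * vel q t))).
Proof.
intros Ht. assert (Hi := img_cpos t Ht). destruct (img_open k _ Hi) as [eps [Pe H]].
replace (sum_axis _) with (sum_axis (fun q => pd q (metric k m n) (cpos t) * vel q t)).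
- apply is_derive_comp_2d with eps; [easy| |intros; now apply cpos_derive].
  intros y Hy. apply (smooth_weaken 3); [lia|]. now apply metric_smooth_img, H.
- unfold sum_axis at 1. rewrite !metric_compatible by easy. unfold sum_axis. ring.
Qed.

(** Metric compatibility: the derivative of the metric supplies the Christoffel terms of the
    covariant acceleration. *)
Lemma speed2_derive t : alpha < t < beta -> is_derive speed2 t (2 * acc_vel t).
Proof.
intros Ht.
assert (Hs := metric_sym_img k _ ax2 ax1 (img_cpos t Ht)).
assert (Hc : forall l, christoffel k l ax2 ax1 (cpos t) = christoffel k l ax1 ax2 (cpos t)).
{ intros l. now apply christoffel_sym, img_cpos. }
assert (E := is_derive_form
  (fun m n s => metric k m n (cpos s)) (fun m n s => sum_axis (fun l => sum_axis (fun q =>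
    (metric k n l (cpos s) * christoffel k l q m (cpos s)
     + metric k m l (cpos s) * christoffel k l q n (cpos s)) * vel q s)))
  vel (fun m => Derive_n (curve_crd k gamma m) 2) t
  (fun m n => metric_cpos_derive m n t Ht) (fun m => vel_derive m t Ht)).
match type of E with is_derive _ _ ?l => replace (2 * acc_vel t) with l; [exact E|] end.
unfold acc_vel, inner, cov_acceleration.
fold (cpos t). change (velocity k gamma t) with (fun m => vel m t).
unfold sum_axis. rewrite Hs, !Hc. ring.
Qed.

Lemma speed_derive t : alpha < t < beta ->
  is_derive (speed k gamma) t (acc_vel t / speed k gamma t).
Proof.
intros Ht. assert (P := speed_pos t Ht).
replace (acc_vel t / speed k gamma t) with (2 * acc_vel t / (2 * sqrt (speed2 t))).
- apply (is_derive_sqrt speed2); [now apply speed2_derive|now apply speed2_pos].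
- change (sqrt (speed2 t)) with (speed k gamma t). field. lra.
Qed.

(** The relation [D_T T = curv] in coordinates, with the factor [speed] of the parameter. *)
Lemma tangent_derive m t : alpha < t < beta ->
  is_derive (tangent m) t (speed k gamma t * (curv m t
    - quad (christoffel k) (cpos t) (fun p => tangent p t) (fun q => tangent q t) m)).
Proof.
intros Ht. assert (P := speed_pos t Ht).
replace (speed k gamma t * _) with
  ((Derive_n (curve_crd k gamma m) 2 t * speed k gamma t - vel m t * (acc_vel t / speed k gamma t))
   / (speed k gamma t) ^ 2).
- apply (is_derive_div (vel m) (speed k gamma));
    [now apply vel_derive|now apply speed_derive|lra].
- unfold curv. rewrite <- speed_sq by easy.
  unfold cov_acceleration. fold (cpos t). change (velocity k gamma t) with (fun m => vel m t).
  unfold tangent, quad, sum_axis. change (velocity k gamma t) with (fun m => vel m t).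
  cbv beta. field. lra.
Qed.

Lemma tangent_unit t : alpha < t < beta ->
  inner k (cpos t) (fun m => tangent m t) (fun m => tangent m t) = 1.
Proof.
intros Ht. assert (P := speed_pos t Ht).
replace (inner k _ _ _) with (speed2 t / (speed k gamma t * speed k gamma t)).
- rewrite speed_sq by easy. field. generalize (speed2_pos t Ht). lra.
- unfold speed2, tangent, inner, sum_axis. field. lra.
Qed.

Lemma tangent_curv_orth t : alpha < t < beta ->
  form (fun m n => metric k m n (cpos t)) (fun m => tangent m t) (fun n => curv n t) = 0.
Proof.
intros Ht. assert (P := speed_pos t Ht). assert (P2 := speed2_pos t Ht).
assert (Hs := metric_sym_img k _ ax2 ax1 (img_cpos t Ht)).
replace (form _ _ _) with ((acc_vel t - acc_vel t / speed2 t * speed2 t)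
  / (speed k gamma t * speed2 t)).
- field. lra.
- unfold form, curv, tangent. set (q := acc_vel t / speed2 t).
  replace (acc_vel t) with (inner k (cpos t) (cov_acceleration k gamma t) (velocity k gamma t))
    by easy.
  replace (speed2 t) with (inner k (cpos t) (velocity k gamma t) (velocity k gamma t)) at 1 by easy.
  unfold inner, sum_axis. rewrite Hs. field. lra.
Qed.

Lemma curvature_sq t : alpha < t < beta ->
  form (fun m n => metric k m n (cpos t)) (fun m => curv m t) (fun n => curv n t)
  = geodesic_curvature k gamma t ^ 2.
Proof.
intros Ht. assert (P2 := speed2_pos t Ht).
unfold geodesic_curvature. fold (cpos t). fold (speed2 t).
set (N := fun m => _ : R).
unfold norm_g. unfold Rdiv at 1. rewrite Rpow_mult_distr, <- Rsqr_pow2, Rsqr_sqrt.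
- unfold N, inner, form, curv, sum_axis. fold (acc_vel t).
  unfold acc_vel, inner, sum_axis. field. lra.
- now apply inner_ge0, img_cpos.
Qed.

End Curve.

(** * Uniform asymptotics of the string length *)

(** For small [del], [meeting_point] provides the four hypotheses of [StringLength], and its signs
    turn [Rabs (u i) + Rabs (v i) - lam i] into [- excess i]. *)
Lemma string_length_expansion (Gam : axis -> axis -> axis -> R * R -> R) (M : R) :
  exists eta C, 0 < eta /\ 0 <= C /\ forall i, string_config Gam M i -> del i <= eta ->
    Rabs (Rabs (u i) + Rabs (v i) - lam i - kap2 i * lam i ^ 3 / 12) <= C * lam i ^ 4.
Proof.
set (D := string_config Gam M).
destruct (meeting_point Gam M D (fun i H => H)) as [eta [Peta [Huv [Hmid Hexc]]]].
assert (HS : forall i, small D eta i -> string_config Gam M i) by now intros i [H _].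
destruct (string_length_bigO Gam M (small D eta) HS) as [C [PC HC]].
- intros i Hi. apply Huv, Hi.
- intros i Hi. apply Huv, Hi.
- exact Hmid.
- exact Hexc.
- exists eta, C. split; [easy|]. split; [easy|]. intros i Hi Hd.
  assert (Hs : small D eta i) by now split.
  destruct (Huv i Hs) as [Hv Hu].
  rewrite (Rabs_pos_eq (u i)) by lra. rewrite (Rabs_left1 (v i)) by lra.
  replace (u i + - v i - lam i) with (- excess i) by (unfold excess; ring).
  now apply HC.
Qed.

Lemma axis_bound (Q : axis -> R -> Prop) :
  (forall m M M', Q m M -> M <= M' -> Q m M') -> (forall m, exists M, Q m M) ->
  exists M, forall m, Q m M.
Proof.
intros mono H. destruct (H ax1) as [M1 H1]. destruct (H ax2) as [M2 H2].
exists (Rmax M1 M2). intros []; [now apply mono with (2 := Rmax_l _ _)|now apply mono with (2 := Rmax_r _ _)].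
Qed.

Definition tame (f : R * R -> R) (x : R * R) (M : R) : Prop :=
  0 < M /\ forall y z, dist2 x y < / M -> dist2 x z < / M ->
    Rabs (f y) <= M /\ Rabs (f y - f z) <= M * dist2 y z.

Lemma tame_mono f x M M' : tame f x M -> M <= M' -> tame f x M'.
Proof.
intros [PM H] HM. split; [lra|]. intros y z Hy Hz.
assert (HI : / M' <= / M) by (apply Rinv_le_contravar; lra).
destruct (H y z) as [A B]; [lra|lra|]. split; [lra|].
apply Rle_trans with (1 := B). apply Rmult_le_compat_r; [apply dist2_ge0|easy].
Qed.

(** A lower bound obtained as an upper bound for [/ f]. *)
Lemma inv_bound (f : R -> R) (a b : R) :
  (forall t, a <= t <= b -> loc_lip dist1 f t) -> (forall t, a <= t <= b -> 0 < f t) ->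
  exists M, 0 < M /\ forall t, a <= t <= b -> / M <= f t.
Proof.
intros Hf Pf. destruct (loc_lip_uniform_1d (fun t => / f t) a b) as [M [PM H]].
- intros t Ht. apply (loc_lip_inv dist1 dist1_ge0 dist1_refl dist1_sym); [auto|].
  generalize (Pf t Ht). lra.
- exists M. split; [easy|]. intros t Ht. destruct (H t t Ht Ht) as [A _].
  assert (P := Pf t Ht). assert (P' := Rinv_0_lt_compat _ P).
  rewrite Rabs_pos_eq in A by lra. rewrite <- (Rinv_inv (f t)).
  now apply Rinv_le_contravar.
Qed.

(** * Uniform constants on a compact subarc *)

Section Constants.
Context {S : riemannian_surface} (k : chart S) (gamma : R -> S) (alpha beta : R).
Hypothesis Hgamma : C3_curve k gamma alpha beta.
Hypothesis Hkappa : forall t, alpha < t < beta -> 0 < geodesic_curvature k gamma t.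

Definition path := cpos k gamma.

Lemma tame_uniform (f : R * R -> R) (a b : R) : alpha < a -> b < beta ->
  (forall z, img k z -> loc_lip dist2 f z) ->
  exists M, forall t, a <= t <= b -> tame f (path t) M.
Proof.
intros Ha Hb Hf. apply loc_lip_uniform.
- intros t Ht. apply Hf. apply (img_cpos k gamma alpha beta Hgamma). lra.
- intros t m Ht. apply (cpos_loc_lip k gamma alpha beta Hgamma). lra.
Qed.

(** [cb_unit] bounds the coordinates of unit vectors near the curve; it controls the tangent
    geodesics, about which nothing but their initial data and unit speed is known. *)
Record curve_bounds (a b M : R) : Prop := {
  cb_M : 1 <= M;
  cb_speed : forall t, a <= t <= b -> / M <= speed k gamma t;
  cb_curv : forall m t t', a <= t <= b -> a <= t' <= b ->
    Rabs (curv k gamma m t) <= M /\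
    Rabs (curv k gamma m t - curv k gamma m t') <= M * Rabs (t - t');
  cb_kappa : forall t, a <= t <= b -> / M <= geodesic_curvature k gamma t ^ 2;
  cb_Gam : forall l p q t, a <= t <= b -> tame (christoffel k l p q) (path t) M;
  cb_g : forall m n t, a <= t <= b -> tame (metric k m n) (path t) M;
  cb_unit : forall t z w m, a <= t <= b -> dist2 (path t) z < / M -> img k z ->
    inner k z w w = 1 -> Rabs (w m) <= M
}.

Lemma inv_mono M M' : 0 < M -> M <= M' -> / M' <= / M.
Proof. intros. now apply Rinv_le_contravar. Qed.

Lemma curve_bounds_exist a b : alpha < a -> b < beta -> exists M, curve_bounds a b M.
Proof.
intros Ha Hb.
assert (Hin : forall t, a <= t <= b -> alpha < t < beta) by (intros; lra).
destruct (inv_bound (speed2 k gamma) a b) as [M1 [P1 H1]].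
{ intros t Ht. apply (speed2_loc_lip k gamma alpha beta Hgamma). auto. }
{ intros t Ht. apply (speed2_pos k gamma alpha beta Hgamma). auto. }
destruct (axis_bound (fun m M => 0 < M /\ forall t t', a <= t <= b -> a <= t' <= b ->
    Rabs (curv k gamma m t) <= M /\
    Rabs (curv k gamma m t - curv k gamma m t') <= M * Rabs (t - t'))) as [M2 H2].
{ intros m M M' [PM H] HM. split; [lra|]. intros t t' Ht Ht'.
  destruct (H t t' Ht Ht') as [A B]. split; [lra|].
  apply Rle_trans with (1 := B). apply Rmult_le_compat_r; [apply Rabs_pos|easy]. }
{ intros m. apply loc_lip_uniform_1d. intros t Ht.
  apply (curv_loc_lip k gamma alpha beta Hgamma). auto. }
destruct (inv_bound (fun t => geodesic_curvature k gamma t ^ 2) a b) as [M3 [P3 H3]].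
{ intros t Ht. destruct (inside_near alpha beta t (Hin t Ht)) as [eps [Pe He]].
  assert (L : loc_lip dist1 (fun t => form (fun m n => metric k m n (cpos k gamma t))
    (fun m => curv k gamma m t) (fun n => curv k gamma n t)) t).
  { apply (inner_loc_lip k gamma alpha beta Hgamma (fun t m => curv k gamma m t)
      (fun t m => curv k gamma m t)); auto;
    intros m; apply (curv_loc_lip k gamma alpha beta Hgamma); auto. }
  destruct L as [K [e [PK [Pe' L]]]].
  (* [curvature_sq] holds only between [alpha] and [beta], so the neighbourhood is shrunk by
     [eps]. *)
  exists K, (Rmin e eps). split; [easy|]. split; [now apply Rmin_pos|].
  intros y z Hy Hz.
  assert (Hy' : alpha < y < beta) by apply He, (Rlt_le_trans _ _ _ Hy (Rmin_r _ _)).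
  assert (Hz' : alpha < z < beta) by apply He, (Rlt_le_trans _ _ _ Hz (Rmin_r _ _)).
  rewrite <- !(curvature_sq k gamma alpha beta Hgamma) by easy.
  apply L; [apply (Rlt_le_trans _ _ _ Hy (Rmin_l _ _))|apply (Rlt_le_trans _ _ _ Hz (Rmin_l _ _))]. }
{ intros t Ht. apply pow_lt, Hkappa. auto. }
assert (tmono : forall f M M', (forall t, a <= t <= b -> tame f (path t) M) -> M <= M' ->
  forall t, a <= t <= b -> tame f (path t) M').
{ intros f M M' H HM t Ht. apply tame_mono with M; auto. }
destruct (axis_bound (fun l M => forall p q t, a <= t <= b -> tame (christoffel k l p q) (path t) M))
  as [M4 H4].
{ intros l M M' H HM p q. apply tmono with M; auto. }
{ intros l. apply (axis_bound (fun p M => forall q t, a <= t <= b -> tame (christoffel k l p q) (path t) M)).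
  { intros p M M' H HM q. apply tmono with M; auto. }
  intros p. apply (axis_bound (fun q M => forall t, a <= t <= b -> tame (christoffel k l p q) (path t) M)).
  { intros q M M' H HM. apply tmono with M; auto. }
  intros q. apply tame_uniform; [easy|easy|]. intros. now apply christoffel_loc_lip. }
destruct (axis_bound (fun m M => forall n t, a <= t <= b -> tame (metric k m n) (path t) M))
  as [M5 H5].
{ intros l M M' H HM p. apply tmono with M; auto. }
{ intros m. apply (axis_bound (fun n M => forall t, a <= t <= b -> tame (metric k m n) (path t) M)).
  { intros p M M' H HM. apply tmono with M; auto. }
  intros n. apply tame_uniform; [easy|easy|]. intros. now apply metric_loc_lip. }
destruct (axis_bound (fun m M => forall t, a <= t <= b ->
    tame (fun y => metric k m m y / det_metric k y) (path t) M)) as [M6 H6].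
{ intros l M M' H HM. apply tmono with M; auto. }
{ intros m. apply tame_uniform; [easy|easy|]. intros. now apply metric_det_loc_lip. }
set (M := Rmax 1 (Rmax M1 (Rmax M2 (Rmax M3 (Rmax M4 (Rmax M5 M6)))))).
assert (L0 : 1 <= M) by apply Rmax_l.
assert (L : Rmax M1 (Rmax M2 (Rmax M3 (Rmax M4 (Rmax M5 M6)))) <= M) by apply Rmax_r.
assert (L1 : M1 <= M) by (apply Rle_trans with (2 := L), Rmax_l).
apply (Rle_trans _ _ _ (Rmax_r _ _)) in L.
assert (L2 : M2 <= M) by (apply Rle_trans with (2 := L), Rmax_l).
apply (Rle_trans _ _ _ (Rmax_r _ _)) in L.
assert (L3 : M3 <= M) by (apply Rle_trans with (2 := L), Rmax_l).
apply (Rle_trans _ _ _ (Rmax_r _ _)) in L.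
assert (L4 : M4 <= M) by (apply Rle_trans with (2 := L), Rmax_l).
apply (Rle_trans _ _ _ (Rmax_r _ _)) in L.
assert (L5 : M5 <= M) by (apply Rle_trans with (2 := L), Rmax_l).
apply (Rle_trans _ _ _ (Rmax_r _ _)) in L.
exists M. split.
- easy.
- intros t Ht. assert (A := H1 t Ht). assert (B := inv_mono M1 M P1 L1).
  rewrite <- (speed_sq k gamma alpha beta Hgamma) in A by auto.
  assert (P := speed_pos k gamma alpha beta Hgamma t (Hin t Ht)).
  (* The bound known is on the square of the speed; it passes to the speed because [/ M <= 1]. *)
  assert (IM : / M <= 1) by (rewrite <- Rinv_1; apply inv_mono; lra).
  destruct (Rle_or_lt (/ M) (speed k gamma t)); [easy|]. nra.
- intros m t t' Ht Ht'. destruct (H2 m) as [P2 H2']. destruct (H2' t t' Ht Ht') as [A B].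
  split; [lra|]. apply Rle_trans with (1 := B). apply Rmult_le_compat_r; [apply Rabs_pos|easy].
- intros t Ht. apply Rle_trans with (2 := H3 t Ht). now apply inv_mono.
- intros l p q t Ht. apply tame_mono with M4; auto.
- intros m n t Ht. apply tame_mono with M5; auto.
- intros t z w m Ht Hz Hi Hw.
  assert (T := tame_mono _ _ _ _ (H6 (other m) t Ht) L).
  destruct T as [PM T]. destruct (T z z Hz Hz) as [A _]. apply Rabs_le_between in A.
  assert (Q := unit_vector_bound k z w m Hi Hw).
  assert (PA := Rabs_pos (w m)). rewrite <- (pow2_abs (w m)) in Q.
  destruct (Rle_or_lt (Rabs (w m)) M); [easy|]. nra.
Qed.

Lemma speed_continuous t : alpha < t < beta -> continuous (speed k gamma) t.
Proof.
intros Ht. apply (@ex_derive_continuous R_AbsRing R_NormedModule).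
eexists. now apply (speed_derive k gamma alpha beta Hgamma).
Qed.

Lemma arc_length_derive s t : alpha < s < beta -> alpha < t < beta ->
  is_derive (arc_length k gamma s) t (speed k gamma t).
Proof.
intros Hs Ht. apply is_derive_RInt with s; [|now apply speed_continuous].
destruct (inside_near alpha beta t Ht) as [eps [Pe He]]. exists (mkposreal eps Pe).
intros y Hy. apply (RInt_correct (V := R_CompleteNormedModule)).
apply (ex_RInt_continuous (V := R_CompleteNormedModule)).
intros z Hz. apply speed_continuous.
assert (Hy' : alpha < y < beta) by apply (He y Hy).
revert Hz. unfold Rmin, Rmax. destruct Rle_dec; lra.
Qed.

Lemma arc_length_ge a b M s w : curve_bounds a b M -> alpha < a -> b < beta ->
  a <= s -> s <= w -> w <= b -> (w - s) * / M <= arc_length k gamma s w.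
Proof.
intros CB Ha Hb Hs Hsw Hw.
assert (H := derive_nonneg_le (fun x => arc_length k gamma s x - (x - s) * / M)
  (fun x => speed k gamma x - / M) s w Hsw). cbv beta in H.
assert (E : arc_length k gamma s s = 0) by apply (RInt_point (V := R_CompleteNormedModule)).
rewrite E in H. cut (0 - (s - s) * / M <= arc_length k gamma s w - (w - s) * / M); [lra|].
apply H.
- intros x Hx. apply (is_derive_minus (arc_length k gamma s) (fun x => (x - s) * / M)).
  + apply arc_length_derive; lra.
  + auto_derive; [easy|ring].
- intros x Hx. generalize (cb_speed _ _ _ CB x). intros A. assert (/ M <= speed k gamma x) by (apply A; lra). lra.
Qed.

(** Unit speed bounds the coordinate velocities only within the ball of radius [/ M], so
    [stays_in_ball] must show that the geodesic remains there; two axes at velocity at most [M]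
    account for [2 * M * del]. *)
Lemma geodesic_config a b M M' del s (c : R -> S) : curve_bounds a b M -> M <= M' ->
  a <= s <= b -> unit_speed_geodesic k c del ->
  dist2 (path s) (coord k (c 0)) + 2 * M * del < / M ->
  geodesic_on (christoffel k) (fun z => dist2 (path s) z < / M /\ img k z) M' del
    (fun w => coord k (c w)) (fun m w => velocity k c w m).
Proof.
intros CB HM Hs Hc H0.
assert (Hin : forall w, Rabs w < del -> - del < w < del).
{ intros w Hw. apply Rabs_def2 in Hw. lra. }
assert (Himg : forall w, Rabs w < del -> img k (coord k (c w))).
{ intros w Hw. apply img_coord. now apply Hc, Hin. }
assert (Hpos : forall m w, Rabs w < del ->
  is_derive (fun x => crd m (coord k (c x))) w (velocity k c w m)).
{ intros m w Hw. apply Derive_correct. destruct (Hc w (Hin w Hw)) as [_ [H _]].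
  destruct (H m) as [H1 _]. exact (H1 1%nat ltac:(auto)). }
assert (Hbd : forall w, Rabs w < del -> dist2 (path s) (coord k (c w)) < / M ->
  forall m, Rabs (velocity k c w m) <= M).
{ intros w Hw Hd m. apply (cb_unit _ _ _ CB s (coord k (c w)) (velocity k c w)); auto.
  destruct (Hc w (Hin w Hw)) as [_ [_ [_ H1]]]. unfold speed, norm_g in H1.
  assert (Q := sqrt_sqrt _ (inner_ge0 k _ (velocity k c w) (Himg w Hw))).
  rewrite H1 in Q. lra. }
assert (Hball : forall w, Rabs w < del -> dist2 (path s) (coord k (c w)) < / M).
{ apply (stays_in_ball (fun m w => crd m (coord k (c w))) (fun m w => velocity k c w m)
    (fun m => crd m (path s)) (/ M) M del); auto.
  generalize (cb_M _ _ _ CB). lra. }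
split.
- intros w Hw. auto.
- exact Hpos.
- intros m w Hw.
  assert (H : is_derive (fun w => velocity k c w m) w (Derive_n (curve_crd k c m) 2 w)).
  { apply Derive_correct. destruct (Hc w (Hin w Hw)) as [_ [H _]].
    destruct (H m) as [H1 _]. exact (H1 2%nat ltac:(auto)). }
  destruct (Hc w (Hin w Hw)) as [_ [_ [H1 _]]].
  replace (- quad _ _ _ _ _) with (Derive_n (curve_crd k c m) 2 w); [exact H|].
  assert (E := H1 m). unfold cov_acceleration in E. unfold quad.
  apply Rplus_opp_r_uniq in E. now rewrite E, Ropp_involutive.
- intros m w Hw. apply Rle_trans with M; auto.
Qed.

(** The constant is [M ^ 2] because the curvature vector is Lipschitz in the parameter with constant
    [M], and passing to arc length costs another [M], the speed being at least [/ M]. *)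
Lemma string_config_exists a b M delta s t l : curve_bounds a b M -> alpha < a -> b < beta ->
  delta <= 1 -> delta <= / (8 * M ^ 2) -> a <= s -> s < t -> t <= b ->
  is_L k gamma delta s t l ->
  exists i, string_config (christoffel k) (M ^ 2) i /\ del i = delta /\
    lam i = arc_length k gamma s t /\ kap2 i = geodesic_curvature k gamma s ^ 2 /\
    l = Rabs (u i) + Rabs (v i) - lam i.
Proof.
intros CB Ha Hb Hd1 Hd2 Hs Hst Ht [Hlam [cA [cB [pu [pv [TA [TB [Hu [Hv [Hm Hl]]]]]]]]]].
assert (PM := cb_M _ _ _ CB).
assert (PIM : 0 < / M) by (apply Rinv_0_lt_compat; lra).
assert (HM2 : M <= M ^ 2) by nra.
assert (Hin : forall w, s <= w <= t -> alpha < w < beta) by (intros; lra).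
assert (Hl0 : 0 < arc_length k gamma s t).
{ assert (A := arc_length_ge a b M s t CB Ha Hb Hs ltac:(lra) Ht).
  assert (0 < (t - s) * / M) by (apply Rmult_lt_0_compat; lra). lra. }
(* Room for a displacement [2 * M * delta] along the arc and another along the geodesic from its
   second end, all in the ball around the first end. *)
assert (Hdel : 4 * M * delta < / M).
{ assert (E : / (8 * M ^ 2) = / 8 * / M * / M) by (field; lra).
  rewrite E in Hd2. assert (4 * M * delta <= 4 * M * (/ 8 * / M * / M)).
  { apply Rmult_le_compat_l; lra. }
  replace (4 * M * (/ 8 * / M * / M)) with (/ 2 * / M) in H by (field; lra). lra. }
assert (R0 : forall z, dist2 z z < / M) by (intros; now rewrite dist2_refl).
assert (Bt : forall m w, s <= w <= t -> Rabs (tangent k gamma m w) <= M).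
{ intros m w Hw. apply (cb_unit _ _ _ CB w (path w) (fun m => tangent k gamma m w)); auto; try lra.
  - apply (img_cpos k gamma alpha beta Hgamma). auto.
  - apply (tangent_unit k gamma alpha beta Hgamma). auto. }
assert (HL : forall w, s <= w <= t -> is_derive (arc_length k gamma s) w (speed k gamma w)).
{ intros w Hw. apply arc_length_derive; apply Hin; lra. }
assert (Hrho : forall w, s <= w <= t -> 0 <= speed k gamma w).
{ intros w Hw. left. apply (speed_pos k gamma alpha beta Hgamma). auto. }
assert (E0 : arc_length k gamma s s = 0) by apply (RInt_point (V := R_CompleteNormedModule)).
assert (HZ : forall w, s <= w <= t -> dist2 (path s) (path w) <= 2 * M * delta).
{ intros w Hw.
  assert (A : forall m, Rabs (crd m (path s) - crd m (path w)) <= M * delta).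
  { intros m. rewrite Rabs_minus_sym.
    apply Rle_trans with (M * (arc_length k gamma s w - arc_length k gamma s s)).
    - apply (mean_value_le (fun x => crd m (path x)) (tangent k gamma m) (speed k gamma)); try lra.
      + intros x Hx. rewrite <- (vel_tangent k gamma alpha beta Hgamma) by (apply Hin; lra).
        apply (cpos_derive k gamma alpha beta Hgamma). apply Hin; lra.
      + intros x Hx. apply HL; lra.
      + intros x Hx. apply Hrho; lra.
      + intros x Hx. apply Bt; lra.
    - apply Rmult_le_compat_l; [lra|]. rewrite E0, Rminus_0_r.
      apply Rle_trans with (arc_length k gamma s t).
      + apply derive_nonneg_le with (speed k gamma); [lra| |]; intros x Hx;
          [apply HL|apply Hrho]; lra.
      + rewrite Rabs_pos_eq in Hlam by lra. lra. }
  unfold dist2, sum_axis. generalize (A ax1) (A ax2). lra. }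
rewrite (Rabs_pos_eq (arc_length k gamma s t)) in Hlam, Hl by lra.
destruct TA as [TA1 [TA2 TA3]]. destruct TB as [TB1 [TB2 TB3]].
exists (Build_string_data s t delta pu pv path (tangent k gamma) (curv k gamma)
  (speed k gamma) (arc_length k gamma s) (fun m n w => metric k m n (path w))
  (fun w => coord k (cA w)) (fun m w => velocity k cA w m)
  (fun w => coord k (cB w)) (fun m w => velocity k cB w m)
  (fun z => dist2 (path s) z < / M /\ img k z)).
split.
2:{ unfold lam, kap2, g0, tau, W0, x0; cbn [ds dt del u v Zg Tg Wg rho ell gg Za Va Zb Vb box]. repeat split; [|exact Hl].
  apply (curvature_sq k gamma alpha beta Hgamma). apply Hin; lra. }
split; unfold lam, kap2, g0, tau, W0, x0; cbn [ds dt del u v Zg Tg Wg rho ell gg Za Va Zb Vb box].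
- nra.
- lra.
- lra.
- easy.
- apply Rabs_def1; lra.
- apply Rabs_def1; lra.
- intros z p q r [Hz _]. destruct (cb_Gam _ _ _ CB p q r s) as [_ H]; [lra|].
  apply Rle_trans with M; [|lra]. now apply (H z z).
- intros z z' p q r [Hz _] [Hz' _]. destruct (cb_Gam _ _ _ CB p q r s) as [_ H]; [lra|].
  apply Rle_trans with (M * dist2 z z'); [now apply H|].
  apply Rmult_le_compat_r; [apply dist2_ge0|easy].
- intros z p q r [_ Hz]. now apply christoffel_sym.
- split.
  + intros m w Hw. rewrite <- (vel_tangent k gamma alpha beta Hgamma) by auto.
    apply (cpos_derive k gamma alpha beta Hgamma). auto.
  + intros m w Hw. apply (tangent_derive k gamma alpha beta Hgamma). auto.
  + exact HL.
  + exact Hrho.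
  + exact E0.
- intros w Hw. split; [|apply (img_cpos k gamma alpha beta Hgamma); auto].
  assert (A := HZ w Hw). assert (0 <= delta) by lra. nra.
- intros m w Hw. apply Rle_trans with (2 := HM2). auto.
- intros m w Hw. apply Rle_trans with (2 := HM2). apply (cb_curv _ _ _ CB m w w); lra.
- intros m w Hw. destruct (cb_curv _ _ _ CB m w s) as [_ A]; [lra|lra|].
  apply Rle_trans with (1 := A). rewrite Rabs_pos_eq by lra.
  assert (B := arc_length_ge a b M s w CB Ha Hb Hs ltac:(lra) ltac:(lra)).
  apply Rle_trans with (M * (M * ((w - s) * / M))).
  + right. field. lra.
  + rewrite <- Rmult_assoc. replace (M * M) with (M * (M * 1)) by ring.
    apply Rmult_le_compat_l; [nra|easy].
- apply (geodesic_config a b M (M ^ 2) delta s cA CB HM2); [lra|easy|].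
  rewrite TA2. change (dist2 (path s) (path s) + 2 * M * delta < / M). rewrite dist2_refl.
  assert (0 < M * delta) by (apply Rmult_lt_0_compat; lra). lra.
- apply (geodesic_config a b M (M ^ 2) delta s cB CB HM2); [lra|easy|].
  rewrite TB2. change (dist2 (path s) (path t) + 2 * M * delta < / M).
  assert (A := HZ t ltac:(lra)). lra.
- now rewrite TA2.
- exact TA3.
- now rewrite TB2.
- exact TB3.
- now rewrite Hm.
- intros m n w Hw. destruct (cb_g _ _ _ CB m n w) as [_ H]; [lra|].
  apply Rle_trans with M; [|lra]. apply (H (path w) (path w)); auto.
- intros m n w Hw. apply metric_sym_img. apply (img_cpos k gamma alpha beta Hgamma). auto.
- intros m n w Hw.
  assert (H := metric_cpos_derive k gamma alpha beta Hgamma m n w (Hin w Hw)).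
  replace (speed k gamma w * _) with (sum_axis (fun l => sum_axis (fun q =>
    (metric k n l (path w) * christoffel k l q m (path w)
     + metric k m l (path w) * christoffel k l q n (path w)) * vel k gamma q w))); [exact H|].
  unfold sum_axis. rewrite !(vel_tangent k gamma alpha beta Hgamma) by auto. ring.
- apply (tangent_unit k gamma alpha beta Hgamma). apply Hin; lra.
- intros w Hw. apply (tangent_curv_orth k gamma alpha beta Hgamma). auto.
- rewrite (curvature_sq k gamma alpha beta Hgamma) by (apply Hin; lra).
  apply Rle_trans with (/ M); [|apply (cb_kappa _ _ _ CB); lra].
  apply inv_mono; [lra|cbn in HM2; lra].
Qed.

Lemma string_length_uniform a b : alpha < a -> a <= b -> b < beta ->
  exists delta0 K C, 0 < delta0 /\ 0 < K /\ 0 <= C /\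
  (forall s, a <= s <= b -> K <= geodesic_curvature k gamma s ^ 2) /\
  forall delta s t l, delta <= delta0 -> a <= s <= b -> s < t < beta ->
    is_L k gamma delta s t l ->
    0 < arc_length k gamma s t < delta /\
    Rabs (l - geodesic_curvature k gamma s ^ 2 * arc_length k gamma s t ^ 3 / 12)
      <= C * arc_length k gamma s t ^ 4.
Proof.
(* The image point [t] may lie beyond [b], so the constants are taken on the longer arc up to [b'];
   the bound [delta0 <= (b' - b) * / M] keeps [t] on it. *)
intros Ha Hab Hb. set (b' := (b + beta) / 2).
assert (Hb' : b < b' < beta) by (unfold b'; lra).
destruct (curve_bounds_exist a b' Ha ltac:(lra)) as [M CB].
assert (PM := cb_M _ _ _ CB).
assert (PIM : 0 < / M) by (apply Rinv_0_lt_compat; lra).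
destruct (string_length_expansion (christoffel k) (M ^ 2)) as [eta [C [Peta [PC HC]]]].
set (delta0 := Rmin (Rmin 1 (/ (8 * M ^ 2))) (Rmin eta ((b' - b) * / M))).
assert (D1 : delta0 <= 1) by (apply Rle_trans with (1 := Rmin_l _ _), Rmin_l).
assert (D2 : delta0 <= / (8 * M ^ 2)) by (apply Rle_trans with (1 := Rmin_l _ _), Rmin_r).
assert (D3 : delta0 <= eta) by (apply Rle_trans with (1 := Rmin_r _ _), Rmin_l).
assert (D4 : delta0 <= (b' - b) * / M) by (apply Rle_trans with (1 := Rmin_r _ _), Rmin_r).
exists delta0, (/ M), C. split.
{ repeat apply Rmin_pos; try lra.
  - apply Rinv_0_lt_compat. nra.
  - apply Rmult_lt_0_compat; lra. }
split; [easy|]. split; [easy|]. split.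
{ intros s Hs. apply (cb_kappa _ _ _ CB). lra. }
intros delta s t l Hd Hs Ht HL.
assert (Htb : t <= b').
{ destruct (Rle_or_lt t b') as [|N]; [easy|]. exfalso.
  assert (A := arc_length_ge a b' M s b' CB Ha ltac:(lra) ltac:(lra) ltac:(lra) ltac:(lra)).
  assert (B : arc_length k gamma s b' <= arc_length k gamma s t).
  { apply derive_nonneg_le with (speed k gamma); [lra| |]; intros x Hx.
    - apply arc_length_derive; lra.
    - left. apply (speed_pos k gamma alpha beta Hgamma). lra. }
  destruct HL as [HL _]. apply Rabs_def2 in HL.
  assert ((b' - b) * / M <= (b' - s) * / M) by (apply Rmult_le_compat_r; lra). lra. }
destruct (string_config_exists a b' M delta s t l CB Ha ltac:(lra) ltac:(lra) ltac:(lra)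
  ltac:(lra) ltac:(lra) Htb HL) as [i [Hi [E1 [E2 [E3 E4]]]]].
rewrite <- E2, <- E3, E4. split.
- rewrite <- E1. apply (c_lam _ _ _ Hi).
- apply HC; [easy|lra].
Qed.

End Constants.

(** * From the expansion to the equivalence *)

Lemma cube_ratio (x y p tau : R) : 0 < x -> 0 < y -> 0 < tau <= 1 / 2 ->
  Rabs (p - x ^ 3) <= tau * x ^ 3 -> Rabs (p - y ^ 3) <= tau * y ^ 3 ->
  Rabs (x / y - 1) <= 4 * tau.
Proof.
intros Px Py Ht Hx Hy.
apply Rabs_le_between in Hx. apply Rabs_le_between in Hy.
set (r := x / y). assert (Pr : 0 < r) by (apply Rdiv_lt_0_compat; easy).
assert (E : x ^ 3 = r ^ 3 * y ^ 3) by (unfold r; field; lra).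
rewrite E in Hx. assert (Py3 : 0 < y ^ 3) by now apply pow_lt.
assert (B1 : (1 - tau) * r ^ 3 <= 1 + tau).
{ apply Rmult_le_reg_r with (y ^ 3); lra. }
assert (B2 : 1 - tau <= (1 + tau) * r ^ 3).
{ apply Rmult_le_reg_r with (y ^ 3); lra. }
(* No cube root is taken: this factor makes [r - 1] no larger than [r ^ 3 - 1] in absolute value,
   and the latter is at most [2 * tau / (1 - tau) <= 4 * tau]. *)
assert (Q : 1 <= r ^ 2 + r + 1) by (generalize (pow2_ge_0 r); lra).
assert (F : r ^ 3 - 1 = (r - 1) * (r ^ 2 + r + 1)) by ring.
apply Rabs_le. split.
- assert (r ^ 3 - 1 >= - (4 * tau)) by nra. nra.
- assert (r ^ 3 - 1 <= 4 * tau) by nra. nra.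
Qed.

Lemma Rpower_two_thirds_cube x : 0 < x -> Rpower x (2 / 3) ^ 3 = x ^ 2.
Proof.
intros Hx. rewrite <- (Rpower_pow 3) by apply exp_pos.
rewrite Rpower_mult, <- (Rpower_pow 2) by easy. f_equal. cbn [INR]. field.
Qed.

(** The scale [delta0] at which points count as nearby is chosen from the subarc alone, before the
    string maps and the precision; [p0] then depends on the family [T] only through its range of
    validity [p1]. *)
Theorem corollary1p17
  (S : riemannian_surface) (k : chart S) (gamma : R -> S) (alpha beta : R)
  (Hgamma : C3_curve k gamma alpha beta)
  (Hkappa : forall t, alpha < t < beta -> 0 < geodesic_curvature k gamma t)
  (a b : R) (Hab : alpha < a <= b /\ b < beta) :
  exists delta0, 0 < delta0 /\
  forall delta, 0 < delta <= delta0 ->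
  forall T : R -> R -> R, string_maps k gamma beta a b delta T ->
  forall eps, 0 < eps ->
  exists p0, 0 < p0 /\
  forall p s q, 0 < p < p0 -> a <= s <= b -> a <= q <= b ->
    Rabs (Rpower (geodesic_curvature k gamma s) (2 / 3)
            * arc_length k gamma s (T p s)
          / (Rpower (geodesic_curvature k gamma q) (2 / 3)
            * arc_length k gamma q (T p q)) - 1) < eps.
Proof.
destruct Hab as [[Ha Hab] Hb].
destruct (string_length_uniform k gamma alpha beta Hgamma Hkappa a b Ha Hab Hb)
  as [delta1 [K [C [Pd [PK [PC [HK HL]]]]]]].
assert (P24 : 0 < K / (24 * (C + 1))) by (apply Rdiv_lt_0_compat; lra).
(* Makes the remainder [C * l ^ 4] at most half of the main term [K * l ^ 3 / 12] for every arc
   shorter than [delta], so that [p >= K * l ^ 3 / 24]. *)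
exists (Rmin delta1 (K / (24 * (C + 1)))). split; [now apply Rmin_pos|].
intros delta [Pdelta Hdelta] T [p1 [Pp1 HT]] eps Peps.
assert (D1 := Rle_trans _ _ _ Hdelta (Rmin_l _ _)).
assert (D2 := Rle_trans _ _ _ Hdelta (Rmin_r _ _)).
set (tau := Rmin (1 / 2) (eps / 8)).
assert (Ptau : 0 < tau <= 1 / 2) by (split; [apply Rmin_pos; lra|apply Rmin_l]).
assert (Htau : tau <= eps / 8) by apply Rmin_r.
(* Arcs shorter than [theta] have [12 * C * l <= tau * K], that is a relative error at most [tau].
   Since [p >= K * l ^ 3 / 24], the bound [p < K * theta ^ 3 / 24] enforces this length. *)
set (theta := tau * K / (12 * (C + 1))).
assert (Ptheta : 0 < theta).
{ apply Rdiv_lt_0_compat; [apply Rmult_lt_0_compat|]; lra. }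
exists (Rmin p1 (K * theta ^ 3 / 24)). split.
{ apply Rmin_pos; [easy|]. assert (0 < theta ^ 3) by now apply pow_lt.
  apply Rdiv_lt_0_compat; [|lra]. now apply Rmult_lt_0_compat. }
intros p s q Hp Hs Hq.
assert (Hp1 : 0 < p < p1) by (generalize (Rmin_l p1 (K * theta ^ 3 / 24)); lra).
assert (Hp2 : p < K * theta ^ 3 / 24) by (generalize (Rmin_r p1 (K * theta ^ 3 / 24)); lra).
assert (main : forall s, a <= s <= b ->
  let x := Rpower (geodesic_curvature k gamma s) (2 / 3) * arc_length k gamma s (T p s) in
  0 < x /\ Rabs (12 * p - x ^ 3) <= tau * x ^ 3).
{ clear s q Hs Hq. intros s Hs.
  assert (Hk : 0 < geodesic_curvature k gamma s) by (apply Hkappa; lra).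
  destruct (HT p s Hp1 Hs) as [Hst HisL].
  destruct (HL delta s (T p s) p D1 Hs Hst HisL) as [Hl He].
  assert (HKs := HK s Hs).
  set (l := arc_length k gamma s (T p s)) in *.
  set (kap := geodesic_curvature k gamma s) in *. cbv zeta.
  assert (Pl3 : 0 < l ^ 3) by (apply pow_lt; lra).
  rewrite Rpow_mult_distr, Rpower_two_thirds_cube by easy.
  split; [apply Rmult_lt_0_compat; [apply exp_pos|lra]|].
  replace (l ^ 4) with (l * l ^ 3) in He by ring.
  assert (HKl : K * l ^ 3 <= kap ^ 2 * l ^ 3) by (apply Rmult_le_compat_r; lra).
  assert (Cdelta : C * l <= K / 24).
  { apply Rle_trans with ((C + 1) * (K / (24 * (C + 1)))); [|right; field; lra].
    apply Rmult_le_compat; lra. }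
  assert (C1 : C * (l * l ^ 3) <= K / 24 * l ^ 3).
  { rewrite <- Rmult_assoc. apply Rmult_le_compat_r; lra. }
  assert (He' := He). apply Rabs_le_between in He'.
  assert (Hl3 : l ^ 3 < theta ^ 3).
  { apply Rmult_lt_reg_l with (K / 24); lra. }
  assert (Hlt : l < theta).
  { destruct (Rlt_or_le l theta) as [|N]; [easy|].
    assert (theta ^ 3 <= l ^ 3) by (apply pow_incr; lra). lra. }
  replace (12 * p - kap ^ 2 * l ^ 3) with (12 * (p - kap ^ 2 * l ^ 3 / 12)) by field.
  rewrite Rabs_mult, (Rabs_pos_eq 12) by lra.
  apply Rle_trans with (12 * (C * (l * l ^ 3))); [lra|].
  apply Rle_trans with (tau * (K * l ^ 3)); [|apply Rmult_le_compat_l; lra].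
  replace (12 * (C * (l * l ^ 3))) with (12 * C * l * l ^ 3) by ring.
  rewrite <- Rmult_assoc. apply Rmult_le_compat_r; [lra|].
  apply Rle_trans with (12 * (C + 1) * theta).
  - apply Rmult_le_compat; lra.
  - right. unfold theta. field. lra. }
destruct (main s Hs) as [Px Hx]. destruct (main q Hq) as [Py Hy].
apply Rle_lt_trans with (4 * tau); [|lra].
now apply cube_ratio with (12 * p).
Qed.
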